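(* Let $H$ be a (finite dimensional) semisimple Hopf algebra, and let $R$ be a noetherian connected graded Artin-Schelter regular algebra equipped with a (grading-preserving) left $H$-module algebra structure. If $R^H\neq R$ and the homological determinant of the $H$-action on $R$ is trivial, then $R^H$ is not Artin-Schelter regular.
   Context: $k$ is an algebraically closed field of characteristic zero. A connected graded $k$-algebra $R$ is Artin-Schelter (AS) Gorenstein if it has finite injective dimension $d$ and $\mathrm{Ext}^i_R(k,R)=\delta_{i,d}\,k(\ell)$ for some integer $\ell$; it is AS regular if in addition it has finite global dimension and finite Gelfand-Kirillov dimension. $R^H=\{a\in R: h\cdot a=\epsilon(h)a\ \forall h\in H\}$. Homological determinant: let $R$ be connected graded noetherian AS Gorenstein of injective dimension $d$, and let $H$ act on $R$ preserving the grading. Let $\mathfrak m$ be the ideal of $R^H$ of positive degree elements and $H^d_{\mathfrak m}(R)$ the $d$-th local cohomology of $R$ with respect to $\mathfrak m$, with left $H$-module structure induced from $R$. The graded dual $H^d_{\mathfrak m}(R)^*$ is a right $H$-module whose lowest degree nonzero component is one-dimensional, spanned by $\mathfrak e$, and $\mathfrak e\cdot h=\eta(h)\mathfrak e$ for an algebra map $\eta:H\to k$. The homological determinant is $\mathrm{hdet}_H R=\eta\circ S$ ($S$ the antipode); it is trivial if $\eta\circ S=\epsilon$. *)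

(* Defs.v *)
From HB Require Import structures.
From mathcomp Require Import all_boot all_order all_algebra all_field.
From mathcomp Require Import boolp.
Set Implicit Arguments.
Unset Strict Implicit.
Unset Printing Implicit Defensive.
Import Order.TTheory GRing.Theory Num.Theory.
Local Open Scope ring_scope.

(** * Finite dimensional Hopf algebras *)

(* Tensors over a finite dimensional H are represented by their coordinates in
   the basis b_i (x) b_j (resp. b_i (x) b_j (x) b_l), where b is the canonical
   basis [vbasis {:H}] of H. *)

Definition tens2 (k : fieldType) (H : falgType k) (x y : H)
    : 'M[k]_(\dim {:H}, \dim {:H}) :=
  \matrix_(i, j) (coord (vbasis {:H}) i x * coord (vbasis {:H}) j y).

Definition tens3 (k : fieldType) (H : falgType k) (x y z : H)
    : {ffun 'I_(\dim {:H}) * 'I_(\dim {:H}) * 'I_(\dim {:H}) -> k^o} :=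
  [ffun p => coord (vbasis {:H}) p.1.1 x * coord (vbasis {:H}) p.1.2 y
             * coord (vbasis {:H}) p.2 z].

(* Sweedler notation: [tapply t F] is the image of t under the linear map
   H (x) H -> V induced by the bilinear map F, so that [tapply (Delta h) F] is
   \sum_(h) F h_1 h_2. *)
Definition tapply (k : fieldType) (H : falgType k) (V : lmodType k)
    (t : 'M[k]_(\dim {:H}, \dim {:H})) (F : H -> H -> V) : V :=
  \sum_(i < \dim {:H}) \sum_(j < \dim {:H})
    t i j *: F (vbasis {:H})`_i (vbasis {:H})`_j.

Record hopf_algebra (k : fieldType) (H : falgType k) := HopfAlgebra {
  comul : {linear H -> 'M[k]_(\dim {:H}, \dim {:H})};
  counit : {lrmorphism H -> k^o};
  antipode : {linear H -> H};
  comul1 : comul 1 = tens2 1 1;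
  comulM : forall g h, comul (g * h) =
    tapply (comul g) (fun g1 g2 =>
      tapply (comul h) (fun h1 h2 => tens2 (g1 * h1) (g2 * h2)));
  comulA : forall h,
    tapply (comul h) (fun h1 h2 =>
      tapply (comul h1) (fun h11 h12 => tens3 h11 h12 h2)) =
    tapply (comul h) (fun h1 h2 =>
      tapply (comul h2) (fun h21 h22 => tens3 h1 h21 h22));
  counit_l : forall h, tapply (comul h) (fun h1 h2 => counit h1 *: h2) = h;
  counit_r : forall h, tapply (comul h) (fun h1 h2 => counit h2 *: h1) = h;
  antipode_l : forall h,
    tapply (comul h) (fun h1 h2 => antipode h1 * h2) = (counit h)%:A;
  antipode_r : forall h,
    tapply (comul h) (fun h1 h2 => h1 * antipode h2) = (counit h)%:A
}.

(* H is a completely reducible left module over itself. *)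
Definition semisimple (k : fieldType) (H : falgType k) : Prop :=
  forall I : {vspace H}, ({:H} * I <= I)%VS ->
  exists J : {vspace H}, [/\ ({:H} * J <= J)%VS,
    (I + J)%VS = fullv & (I :&: J)%VS = 0%VS].

(** * Noetherian rings and Gelfand-Kirillov dimension *)

Definition left_noetherian (A : pzRingType) : Prop :=
  forall I : A -> Prop,
    I 0 -> (forall x y, I x -> I y -> I (x + y)) ->
    (forall a x, I x -> I (a * x)) ->
  exists s : seq A, forall x,
    I x <-> exists c : nat -> A, x = \sum_(i < size s) c i * s`_i.

Definition right_noetherian (A : pzRingType) : Prop :=
  forall I : A -> Prop,
    I 0 -> (forall x y, I x -> I y -> I (x + y)) ->
    (forall a x, I x -> I (x * a)) ->
  exists s : seq A, forall x,
    I x <-> exists c : nat -> A, x = \sum_(i < size s) s`_i * c i.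

Definition noetherian (A : pzRingType) : Prop :=
  left_noetherian A /\ right_noetherian A.

(* [V_n] being the span of the products of at most n elements of s, this says
   that [dim V_n <= N]. *)
Definition growth_le (k : fieldType) (A : algType k) (s : seq A) (n N : nat)
    : Prop :=
  exists2 t : seq A, (size t <= N)%N &
  forall w : seq A, (size w <= n)%N -> {subset w <= s} ->
  exists c : nat -> k, \prod_(a <- w) a = \sum_(i < size t) c i *: t`_i.

(* GKdim A is the supremum over s of the growth exponents
   inf {r | dim V_n <= n ^ r for n large}; it is finite iff one r, which may be
   taken to be an integer, serves all s. *)
Definition finite_GKdim (k : fieldType) (A : algType k) : Prop :=
  exists r : nat, forall s : seq A, exists n0 : nat, forall n : nat,
    (n0 <= n)%N -> growth_le s n (n ^ r).

(** * Connected graded algebras and graded modules *)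

(* V is the internal direct sum of the images of the [gcomp i]. *)
Record grading (V : zmodType) := Grading {
  gcomp : int -> V -> V;
  gcompD : forall i, {morph gcomp i : x y / x + y};
  gcomp_gcomp : forall i j x, gcomp i (gcomp j x) = if i == j then gcomp j x else 0;
  gcomp_sum : forall x, exists2 s : seq int, uniq s & x = \sum_(i <- s) gcomp i x
}.

(* A is graded in nonnegative degrees, with A_0 = k. The augmentation
   A -> A_0 = k is determined by the other fields. *)
Record connected_grading (k : fieldType) (A : algType k) := ConnectedGrading {
  agr :> grading A;
  agr_mul : forall i j a b, gcomp agr i a = a -> gcomp agr j b = b ->
    gcomp agr (i + j) (a * b) = a * b;
  agr_ge0 : forall i a, i < 0 -> gcomp agr i a = 0;
  augmentation : {lrmorphism A -> k^o};
  agr_connected : forall a, gcomp agr 0 a = (augmentation a)%:A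
}.

Definition pos_ideal (k : fieldType) (A : algType k)
    (gA : connected_grading A) (a : A) : Prop :=
  forall i : int, i <= 0 -> gcomp gA i a = 0.

Record gmod (k : fieldType) (A : algType k) (gA : connected_grading A) := GMod {
  gmod_sort :> lmodType A;
  mgr : grading gmod_sort;
  mgr_scale : forall i j a (x : gmod_sort), gcomp gA i a = a ->
    gcomp mgr j x = x -> gcomp mgr (i + j) (a *: x) = a *: x
}.

Definition homogeneous (k : fieldType) (A : algType k)
    (gA : connected_grading A) (M N : gmod gA) (j : int) (f : M -> N) : Prop :=
  forall n x, f (gcomp (mgr M) n x) = gcomp (mgr N) (n + j) (f x).

Definition regular_gmod (k : fieldType) (A : algType k)
    (gA : connected_grading A) : gmod gA :=
  @GMod k A gA (A^o : lmodType A) (agr gA) (@agr_mul k A gA).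

(** The trivial module k = A / A_{>0}, in degree 0 *)

Definition trivial_module (k : fieldType) (A : algType k)
  (gA : connected_grading A) : Type := k.

HB.instance Definition _ (k : fieldType) (A : algType k)
  (gA : connected_grading A) := GRing.Zmodule.on (trivial_module gA).

Definition trivial_scale (k : fieldType) (A : algType k)
    (gA : connected_grading A) (a : A) (x : trivial_module gA)
    : trivial_module gA := (augmentation gA a : k) * (x : k).

Section TrivialModule.
Context (k : fieldType) (A : algType k) (gA : connected_grading A).

Let scaleA (a b : A) (x : trivial_module gA) :
  trivial_scale a (trivial_scale b x) = trivial_scale (a * b) x.
Proof. by rewrite /trivial_scale rmorphM mulrA. Qed.

Let scale1 : left_id 1 (@trivial_scale k A gA).
Proof. by move=> x; rewrite /trivial_scale rmorph1 mul1r. Qed.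

Let scaleDr : right_distributive (@trivial_scale k A gA) +%R.
Proof. by move=> a x y; rewrite /trivial_scale mulrDr. Qed.

Let scaleDl (x : trivial_module gA) :
  {morph (@trivial_scale k A gA)^~ x : a b / a + b}.
Proof. by move=> a b; rewrite /trivial_scale rmorphD mulrDl. Qed.

HB.instance Definition _ := GRing.Zmodule_isLmodule.Build A (trivial_module gA)
  scaleA scale1 scaleDr scaleDl.

Let tcomp (i : int) (x : trivial_module gA) : trivial_module gA :=
  if i == 0 then x else 0.

Let tcompD i : {morph tcomp i : x y / x + y}.
Proof. by move=> x y; rewrite /tcomp; case: ifP => // _; rewrite addr0. Qed.

Let tcomp_comp i j x : tcomp i (tcomp j x) = if i == j then tcomp j x else 0.
Proof.
rewrite /tcomp; have [->|ij] := eqVneq i j; first by case: (j == 0).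
case: ifP => // /eqP i0; case: ifP => // /eqP j0.
by rewrite i0 j0 eqxx in ij.
Qed.

Let tcomp_sum x : exists2 s : seq int, uniq s & x = \sum_(i <- s) tcomp i x.
Proof. by exists [:: 0] => //; rewrite big_seq1. Qed.

Definition trivial_grading : grading (trivial_module gA) :=
  Grading tcompD tcomp_comp tcomp_sum.

Let tscale i j (a : A) (x : trivial_module gA) : gcomp gA i a = a ->
  gcomp trivial_grading j x = x ->
  gcomp trivial_grading (i + j) (a *: x) = a *: x.
Proof.
rewrite /= /tcomp => ai; case: (eqVneq j 0) => [-> _|_ <-]; last first.
  by rewrite scaler0 if_same.
rewrite addr0; case: ifP => // /negbT i0.
suff a0 : augmentation gA a = 0.
  by rewrite [RHS]/GRing.scale /= /trivial_scale a0 mul0r.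
have : gcomp gA 0 a = 0 by rewrite -ai gcomp_gcomp eq_sym (negbTE i0).
rewrite agr_connected => /(congr1 (augmentation gA)).
by rewrite linearZ rmorph1 linear0 /= [LHS]mulr1.
Qed.

Definition trivial_gmod : gmod gA := GMod tscale.

End TrivialModule.

(** * Graded homological algebra *)

(* Everything takes place in the category of Z-graded left modules, with the
   homogeneous linear maps of degree 0 as morphisms. *)

Definition graded_injective (k : fieldType) (A : algType k)
    (gA : connected_grading A) (E : gmod gA) : Prop :=
  forall (X Y : gmod gA) (u : {linear X -> Y}) (f : {linear X -> E}),
    injective u -> homogeneous 0 u -> homogeneous 0 f ->
  exists2 g : {linear Y -> E}, homogeneous 0 g & forall x, g (u x) = f x.

Definition graded_projective (k : fieldType) (A : algType k)
    (gA : connected_grading A) (P : gmod gA) : Prop :=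
  forall (X Y : gmod gA) (u : {linear X -> Y}) (f : {linear P -> Y}),
    (forall y, exists x, u x = y) -> homogeneous 0 u -> homogeneous 0 f ->
  exists2 g : {linear P -> X}, homogeneous 0 g & forall x, u (g x) = f x.

Record injective_resolution (k : fieldType) (A : algType k)
    (gA : connected_grading A) (N : gmod gA) := InjectiveResolution {
  ir_obj :> nat -> gmod gA;
  ir_injective : forall i, graded_injective (ir_obj i);
  ir_eta : {linear N -> ir_obj 0%N};
  ir_eta_deg : homogeneous 0 ir_eta;
  ir_d : forall i, {linear ir_obj i -> ir_obj i.+1};
  ir_d_deg : forall i, homogeneous 0 (ir_d i);
  ir_eta_inj : injective ir_eta;
  ir_exact0 : forall x, ir_d 0%N x = 0 <-> exists y, x = ir_eta y;
  ir_exactS : forall i x, ir_d i.+1 x = 0 <-> exists y, x = ir_d i y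
}.

Record projective_resolution (k : fieldType) (A : algType k)
    (gA : connected_grading A) (M : gmod gA) := ProjectiveResolution {
  pr_obj :> nat -> gmod gA;
  pr_projective : forall i, graded_projective (pr_obj i);
  pr_eps : {linear pr_obj 0%N -> M};
  pr_eps_deg : homogeneous 0 pr_eps;
  pr_d : forall i, {linear pr_obj i.+1 -> pr_obj i};
  pr_d_deg : forall i, homogeneous 0 (pr_d i);
  pr_eps_surj : forall y, exists x, pr_eps x = y;
  pr_exact0 : forall x, pr_eps x = 0 <-> exists y, x = pr_d 0%N y;
  pr_exactS : forall i x, pr_d i x = 0 <-> exists y, x = pr_d i.+1 y
}.

Definition injdim_le (k : fieldType) (A : algType k)
    (gA : connected_grading A) (N : gmod gA) (n : nat) : Prop :=
  exists E : injective_resolution N,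
    forall i, (n < i)%N -> forall x : E i, x = 0.

Definition injdim_eq (k : fieldType) (A : algType k)
    (gA : connected_grading A) (N : gmod gA) (d : nat) : Prop :=
  injdim_le N d /\ forall n, injdim_le N n -> (d <= n)%N.

Definition projdim_le (k : fieldType) (A : algType k)
    (gA : connected_grading A) (M : gmod gA) (n : nat) : Prop :=
  exists P : projective_resolution M,
    forall i, (n < i)%N -> forall x : P i, x = 0.

Definition finite_gldim (k : fieldType) (A : algType k)
    (gA : connected_grading A) : Prop :=
  exists n : nat, forall M : gmod gA, projdim_le M n.

(* For an injective resolution E of N, [Ext^i(M, N)_j] is the quotient of
   [ext_cocycle E M i j] by [ext_coboundary E M i j], where degree j refers to
   homomorphisms mapping M_n to N_(n+j). *)

Definition ext_cocycle (k : fieldType) (A : algType k)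
    (gA : connected_grading A) (N : gmod gA) (E : injective_resolution N)
    (M : gmod gA) (i : nat) (j : int) (f : {linear M -> E i}) : Prop :=
  homogeneous j f /\ forall x, ir_d E i (f x) = 0.

Definition ext_coboundary (k : fieldType) (A : algType k)
    (gA : connected_grading A) (N : gmod gA) (E : injective_resolution N)
    (M : gmod gA) (i : nat) (j : int) : (M -> E i) -> Prop :=
  match i return (M -> E i) -> Prop with
  | 0 => fun f => forall x, f x = 0
  | i'.+1 => fun f => exists2 g : {linear M -> E i'},
      homogeneous j g & forall x, f x = ir_d E i' (g x)
  end.

Definition ext_zero (k : fieldType) (A : algType k)
    (gA : connected_grading A) (N : gmod gA) (E : injective_resolution N)
    (M : gmod gA) (i : nat) (j : int) : Prop :=
  forall f : {linear M -> E i}, ext_cocycle j f -> ext_coboundary j f.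

Definition ext_dim1 (k : fieldType) (A : algType k)
    (gA : connected_grading A) (N : gmod gA) (E : injective_resolution N)
    (M : gmod gA) (i : nat) (j : int) : Prop :=
  exists f : {linear M -> E i}, [/\ ext_cocycle j f, ~ ext_coboundary j f &
    forall g : {linear M -> E i}, ext_cocycle j g ->
    exists c : k, ext_coboundary j (fun x => g x - c%:A *: f x)].

(** * Artin-Schelter conditions *)

(* k(l) is one-dimensional, concentrated in degree -l. Ext does not depend on
   the injective resolution by which it is computed. *)
Definition AS_gorenstein_of (k : fieldType) (A : algType k)
    (gA : connected_grading A) (d : nat) (l : int) : Prop :=
  injdim_eq (regular_gmod gA) d /\
  exists E : injective_resolution (regular_gmod gA),
    ext_dim1 E (trivial_gmod gA) d (- l) /\
    forall i j, (i, j) != (d, - l) -> ext_zero E (trivial_gmod gA) i j.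

Definition AS_regular_of (k : fieldType) (A : algType k)
    (gA : connected_grading A) (d : nat) (l : int) : Prop :=
  [/\ AS_gorenstein_of gA d l, finite_gldim gA & finite_GKdim A].

Definition AS_regular (k : fieldType) (A : algType k)
    (gA : connected_grading A) : Prop :=
  exists d l, AS_regular_of gA d l.

(** * Hopf actions and invariants *)

Record module_algebra (k : fieldType) (H : falgType k) (D : hopf_algebra H)
    (R : algType k) (gR : connected_grading R) := ModuleAlgebra {
  act : H -> {linear R -> R};
  act_linear : forall c g h r, act (c *: g + h) r = c *: act g r + act h r;
  act1 : forall r, act 1 r = r;
  actM : forall g h r, act (g * h) r = act g (act h r);
  act_one : forall h, act h 1 = (counit D h)%:A;
  act_mul : forall h a b, act h (a * b) =
    tapply (comul D h) (fun h1 h2 => act h1 a * act h2 b);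
  act_deg : forall h i r, act h (gcomp gR i r) = gcomp gR i (act h r)
}.

Definition invariants (k : fieldType) (H : falgType k) (D : hopf_algebra H)
    (R : algType k) (gR : connected_grading R) (X : module_algebra D gR)
    : {pred R} :=
  [pred r | `[< forall h, act X h r = (counit D h : k) *: r >]].

Lemma invariantsP (k : fieldType) (H : falgType k) (D : hopf_algebra H)
    (R : algType k) (gR : connected_grading R) (X : module_algebra D gR) r :
  reflect (forall h, act X h r = (counit D h : k) *: r) (r \in invariants X).
Proof. exact: asboolP. Qed.

Section Invariants.
Context (k : fieldType) (H : falgType k) (D : hopf_algebra H).
Context (R : algType k) (gR : connected_grading R) (X : module_algebra D gR).

Lemma act_invl a r h : a \in invariants X -> act X h (a * r) = a * act X h r.
Proof.
move=> /invariantsP aI; rewrite act_mul -[in RHS](counit_l D h).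
have actZ c g s : act X (c *: g) s = c *: act X g s.
  have act0 : act X 0 s = 0.
    have := act_linear X 1 0 0 s.
    by rewrite scale1r addr0 scale1r => /eqP; rewrite addrC -subr_eq subrr => /eqP <-.
  by rewrite -[c *: g]addr0 act_linear act0 addr0.
have act0 s : act X 0 s = 0 by rewrite -(scale0r 0) actZ scale0r.
have actD g g' s : act X (g + g') s = act X g s + act X g' s.
  by rewrite -[g]scale1r act_linear !scale1r.
rewrite /tapply (big_morph (fun g => act X g r) (fun g g' => actD g g' r) (act0 r)).
rewrite mulr_sumr; apply: eq_bigr => i _.
rewrite (big_morph (fun g => act X g r) (fun g g' => actD g g' r) (act0 r)).
rewrite mulr_sumr; apply: eq_bigr => j _.
by rewrite aI !actZ -!scalerAr -scalerAl.
Qed.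

Lemma invariants_subalg : GRing.subalg_closed (invariants X).
Proof.
split.
- by apply/invariantsP => h; rewrite act_one.
- move=> c a b /invariantsP aI /invariantsP bI; apply/invariantsP => h.
  by rewrite linearP aI bI scalerDr !scalerA mulrC.
- move=> a b aI /invariantsP bI; apply/invariantsP => h.
  by rewrite act_invl // bI scalerAr.
Qed.

HB.instance Definition _ :=
  GRing.isSubalgClosed.Build k R (invariants X) invariants_subalg.

End Invariants.

(** The algebra R^H *)
Record inv_alg (k : fieldType) (H : falgType k) (D : hopf_algebra H)
    (R : algType k) (gR : connected_grading R) (X : module_algebra D gR) :=
  InvAlg { inv_val : R; inv_valP : inv_val \in invariants X }.

Section InvariantAlgebra.
Context (k : fieldType) (H : falgType k) (D : hopf_algebra H).
Context (R : algType k) (gR : connected_grading R) (X : module_algebra D gR).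

HB.instance Definition _ := [isSub of inv_alg X for @inv_val k H D R gR X].
HB.instance Definition _ := [Choice of inv_alg X by <:].
HB.instance Definition _ := [SubChoice_isSubAlgebra of inv_alg X by <:].

Lemma inv_valD (a b : inv_alg X) : inv_val (a + b) = inv_val a + inv_val b.
Proof. by []. Qed.

Lemma inv_val0 : inv_val (0 : inv_alg X) = 0.
Proof. by []. Qed.

Lemma inv_valM (a b : inv_alg X) : inv_val (a * b) = inv_val a * inv_val b.
Proof. by []. Qed.

Lemma inv_valZ c (a : inv_alg X) : inv_val (c *: a) = c *: inv_val a.
Proof. by []. Qed.

Lemma inv_val1 : inv_val (1 : inv_alg X) = 1.
Proof. by []. Qed.

Let icomp0 i : gcomp gR i 0 = 0.
Proof. by apply: (addrI (gcomp gR i 0)); rewrite -gcompD !addr0. Qed.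

Let compZ i (c : k) r : gcomp gR i (c *: r) = c *: gcomp gR i r.
Proof.
have c0 : gcomp gR 0 c%:A = c%:A.
  by rewrite agr_connected linearZ rmorph1 /= [X in X%:A]mulr1.
have [s _ ->] := gcomp_sum gR r.
rewrite scaler_sumr !(big_morph _ (gcompD gR i) (icomp0 i)) scaler_sumr.
apply: eq_bigr => j _; rewrite gcomp_gcomp.
have cj : gcomp gR j (c *: gcomp gR j r) = c *: gcomp gR j r.
  rewrite -mulr_algl -[X in gcomp _ X (_ * _)]add0r.
  by apply: agr_mul; rewrite // gcomp_gcomp eqxx.
rewrite -{1}cj gcomp_gcomp cj.
by case: eqP => // _; rewrite scaler0.
Qed.

Lemma comp_invariant i r : r \in invariants X -> gcomp gR i r \in invariants X.
Proof.
by move=> /invariantsP rI; apply/invariantsP => h; rewrite act_deg rI compZ.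
Qed.

Let icomp (i : int) (a : inv_alg X) : inv_alg X :=
  InvAlg (comp_invariant i (inv_valP a)).

Let icompD i : {morph icomp i : a b / a + b}.
Proof. by move=> a b; apply: val_inj; exact: (gcompD gR). Qed.

Let icomp_comp i j a : icomp i (icomp j a) = if i == j then icomp j a else 0.
Proof.
by apply: val_inj; rewrite /= gcomp_gcomp; case: eqP.
Qed.

Let icomp_sum a : exists2 s : seq int, uniq s & a = \sum_(i <- s) icomp i a.
Proof.
have [s us e] := gcomp_sum gR (inv_val a).
by exists s => //; apply: val_inj; rewrite /= (big_morph _ inv_valD inv_val0).
Qed.

Let igr : grading (inv_alg X) := Grading icompD icomp_comp icomp_sum.

Let igr_mul i j a b : gcomp igr i a = a -> gcomp igr j b = b ->
  gcomp igr (i + j) (a * b) = a * b.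
Proof.
move=> /(congr1 val) /= ai /(congr1 val) /= bj; apply: val_inj.
exact: agr_mul.
Qed.

Let igr_ge0 i a : i < 0 -> gcomp igr i a = 0.
Proof. by move=> i0; apply: val_inj; exact: agr_ge0. Qed.

Definition inv_aug (a : inv_alg X) : k^o := augmentation gR (inv_val a).

Let inv_aug_linear : linear inv_aug.
Proof. by move=> c a b; rewrite /inv_aug -linearP. Qed.

Let inv_aug_monoid : monoid_morphism inv_aug.
Proof.
by split=> [|a b]; rewrite /inv_aug ?inv_val1 ?inv_valM ?rmorph1 ?rmorphM.
Qed.

HB.instance Definition _ :=
  GRing.isLinear.Build k (inv_alg X) k^o _ inv_aug inv_aug_linear.
HB.instance Definition _ :=
  GRing.isMonoidMorphism.Build (inv_alg X) k^o inv_aug inv_aug_monoid.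

Let igr_connected a : gcomp igr 0 a = (inv_aug a)%:A.
Proof.
by apply: val_inj; exact: agr_connected.
Qed.

Definition inv_grading : connected_grading (inv_alg X) :=
  ConnectedGrading igr_mul igr_ge0 igr_connected.

End InvariantAlgebra.

(** R as a graded left module over R^H *)
Definition inv_module (k : fieldType) (H : falgType k) (D : hopf_algebra H)
  (R : algType k) (gR : connected_grading R) (X : module_algebra D gR)
  : Type := R.

HB.instance Definition _ (k : fieldType) (H : falgType k) (D : hopf_algebra H)
  (R : algType k) (gR : connected_grading R) (X : module_algebra D gR) :=
  GRing.Zmodule.on (inv_module X).

Section InvariantModule.
Context (k : fieldType) (H : falgType k) (D : hopf_algebra H).
Context (R : algType k) (gR : connected_grading R) (X : module_algebra D gR).

Definition inv_scale (a : inv_alg X) (r : inv_module X) : inv_module X :=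
  inv_val a * (r : R).

Let scaleA a b r : inv_scale a (inv_scale b r) = inv_scale (a * b) r.
Proof. by rewrite /inv_scale inv_valM mulrA. Qed.

Let scale1 : left_id 1 inv_scale.
Proof. by move=> r; rewrite /inv_scale inv_val1 mul1r. Qed.

Let scaleDr : right_distributive inv_scale +%R.
Proof. by move=> a r s; rewrite /inv_scale mulrDr. Qed.

Let scaleDl r : {morph inv_scale^~ r : a b / a + b}.
Proof. by move=> a b; rewrite /inv_scale inv_valD mulrDl. Qed.

HB.instance Definition _ :=
  GRing.Zmodule_isLmodule.Build (inv_alg X) (inv_module X)
    scaleA scale1 scaleDr scaleDl.

Let mscale i j (a : inv_alg X) (r : inv_module X) :
  gcomp (inv_grading X) i a = a -> gcomp (agr gR) j r = r ->
  gcomp (agr gR) (i + j) (a *: r : inv_module X) = a *: r.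
Proof. by move=> /(congr1 val) /= ai rj; apply: agr_mul. Qed.

Definition inv_gmod : gmod (inv_grading X) :=
  @GMod k _ (inv_grading X) (inv_module X) (agr gR) mscale.

End InvariantModule.

(** * Local cohomology and the homological determinant *)

(* [torsion] is the m-torsion functor, m being the ideal of positive degree
   elements: an element is torsion iff some power of m kills it. *)
Definition torsion (k : fieldType) (A : algType k)
    (gA : connected_grading A) (M : gmod gA) (x : M) : Prop :=
  exists n : nat, forall s : seq A, size s = n ->
    (forall a, a \in s -> pos_ideal gA a) -> (\prod_(a <- s) a) *: x = 0.

(* For an injective resolution E of N, [H^i_m(N)_j], the i-th right derived
   functor of [torsion] in degree j, is the quotient of [lc_cocycle E i j] by
   the elements of [lc_coboundary E i] that it contains. *)

Definition lc_cocycle (k : fieldType) (A : algType k)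
    (gA : connected_grading A) (N : gmod gA) (E : injective_resolution N)
    (i : nat) (j : int) (x : E i) : Prop :=
  [/\ torsion x, ir_d E i x = 0 & gcomp (mgr (E i)) j x = x].

Definition lc_coboundary (k : fieldType) (A : algType k)
    (gA : connected_grading A) (N : gmod gA) (E : injective_resolution N)
    (i : nat) : E i -> Prop :=
  match i return E i -> Prop with
  | 0 => fun x => x = 0
  | i'.+1 => fun x => exists2 y : E i', torsion y & x = ir_d E i' y
  end.

(* The degree n component of the graded dual of [H^i_m(N)] consists of the
   linear forms on [H^i_m(N)_(-n)]. Such a form is given by a function on E i,
   of which only the values on [lc_cocycle E i (- n)] matter. *)

Definition lc_dual (k : fieldType) (A : algType k)
    (gA : connected_grading A) (N : gmod gA) (E : injective_resolution N)
    (i : nat) (n : int) (f : E i -> k) : Prop :=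
  (forall (c : k) x y, lc_cocycle (- n) x -> lc_cocycle (- n) y ->
     f (c%:A *: x + y) = c * f x + f y) /\
  (forall x, lc_cocycle (- n) x -> lc_coboundary x -> f x = 0).

Definition lc_dual_eq (k : fieldType) (A : algType k)
    (gA : connected_grading A) (N : gmod gA) (E : injective_resolution N)
    (i : nat) (n : int) (f g : E i -> k) : Prop :=
  forall x, lc_cocycle (- n) x -> f x = g x.

(* [phi] is a morphism of complexes E -> E extending the endomorphism f of N;
   it induces the action of f on the local cohomology of N. *)
Definition extends_to (k : fieldType) (A : algType k)
    (gA : connected_grading A) (N : gmod gA) (E : injective_resolution N)
    (f : N -> N) (phi : forall i, {linear E i -> E i}) : Prop :=
  [/\ forall i, homogeneous 0 (phi i),
      forall y, phi 0%N (ir_eta E y) = ir_eta E (f y)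
    & forall i x, phi i.+1 (ir_d E i x) = ir_d E i (phi i x)].

(* [is_hdet X d chi] says that chi is the homological determinant of the action
   X on R, d being the injective dimension of R. The right action of h on the
   dual of [H^d_m(R)] is f |-> f \o phi h d; n is the lowest degree of this
   dual, and e spans its degree n component. None of this depends on the
   choice of E and phi. *)
Definition is_hdet (k : fieldType) (H : falgType k) (D : hopf_algebra H)
    (R : algType k) (gR : connected_grading R) (X : module_algebra D gR)
    (d : nat) (chi : H -> k) : Prop :=
  exists (E : injective_resolution (inv_gmod X))
         (phi : H -> forall i, {linear E i -> E i})
         (n : int) (e : E d -> k) (eta : {lrmorphism H -> k^o}),
    [/\ forall h, extends_to (N := inv_gmod X) (act X h : R -> R) (phi h),
        forall (m : int) (f : E d -> k), m < n -> lc_dual m f ->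
          lc_dual_eq m f (fun=> 0),
        [/\ lc_dual n e, ~ lc_dual_eq n e (fun=> 0) &
            forall f : E d -> k, lc_dual n f ->
            exists c : k, lc_dual_eq n f (fun x => c * e x)],
        forall h, lc_dual_eq n (fun x => e (phi h d x)) (fun x => eta h * e x)
      & forall h, chi h = eta (antipode D h)].

Definition hdet_trivial (k : fieldType) (H : falgType k) (D : hopf_algebra H)
    (R : algType k) (gR : connected_grading R) (X : module_algebra D gR)
    (d : nat) : Prop := is_hdet X d (counit D).

(* Main.v *)
(* Write A = R^H, let (d, l) be the injective dimension and the AS index of R,
   and suppose that A is regular, with invariants (dA, lA). An integral of H
   gives an A-bimodule projection R -> A. As the homological determinant is
   trivial, this projection is nonzero on the top degree -n of H^d_m(R), so that
   H^d_m(A) is nonzero in degree -n; hence d = dA and lA <= n.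

   Let F be the minimal free resolution of k over A, of length d. The modules
   Tor_q^A(R, k) = H_q(R (x) F) are bounded in degree, and Ext_R^i(k, R) = 0 for
   i < d, so by the acyclicity lemma R (x) F is a resolution of W = R / R A_+
   over R. Therefore Ext_A^i(k, R) = Ext_R^i(W, R) vanishes for i < d and, for
   i = d, it is nonzero in degree -l; as it then embeds into H^d_m(R), n <= l.

   If A <> R, then W has a top degree p > 0, and Ext_R^d(W, R) is nonzero in
   degree -l - p. But it is a subquotient of Hom(F_d, R), which starts in degree
   -lA because F_d is generated in degree lA; so lA >= l + p > l, contradicting
   lA <= n <= l. *)

Require Import Defs.
From HB Require Import structures.
From mathcomp Require Import all_boot all_order all_algebra all_field.
From mathcomp Require Import boolp classical_sets functions.
From mathcomp Require Import zify ring.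
Set Implicit Arguments.
Unset Strict Implicit.
Unset Printing Implicit Defensive.
Import Order.TTheory GRing.Theory Num.Theory.
Local Open Scope ring_scope.

(** * Homogeneous elements *)

(** Ext and local cohomology are defined through injective resolutions of the second argument,
    whereas every degree estimate comes from free resolutions of the first. The bridge is that only
    cyclic modules occur as first argument: k = A / A_+, W = R / R A_+ and A / A_{>=m}. A map from A
    / J to an injective term is an element killed by J, a map out of a free module is a column of
    elements, and balancing becomes a chase on elements ([zigzag]), without Hom modules, tensor
    products or quotients.

    Passage between A / J for different J is by devissage: when J contains A_{>=n}, each layer of
    the degree filtration is a finite sum of copies of one shift of k. Bounds on degrees are
    therefore what has to be proved; for W and the Tor modules they come from the finite generation
    of R as a right A-module, which is extracted from the integral.

    The last step does not choose a top degree of W: lA <= l is shown to force all elements of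
    positive degree of R into R A_+, by descending induction on the degree, and R = A follows by
    ascending induction. *)

Definition ofdeg (V : zmodType) (g : grading V) (i : int) (x : V) : Prop :=
  gcomp g i x = x.

Section Gradings.
Context (V : zmodType) (g : grading V).
Implicit Types (i j : int) (x y : V).

Lemma gcomp0 i : gcomp g i 0 = 0.
Proof. by apply: (addrI (gcomp g i 0)); rewrite -gcompD !addr0. Qed.

Lemma gcompN i x : gcomp g i (- x) = - gcomp g i x.
Proof. by apply/eqP; rewrite -addr_eq0 -gcompD addNr gcomp0. Qed.

Lemma gcompB i x y : gcomp g i (x - y) = gcomp g i x - gcomp g i y.
Proof. by rewrite gcompD gcompN. Qed.

Lemma gcomp_bigsum i I (r : seq I) (P : pred I) (F : I -> V) :
  gcomp g i (\sum_(a <- r | P a) F a) = \sum_(a <- r | P a) gcomp g i (F a).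
Proof. exact: (big_morph _ (gcompD g i) (gcomp0 i)). Qed.

Lemma ofdeg_gcomp i x : ofdeg g i (gcomp g i x).
Proof. by rewrite /ofdeg gcomp_gcomp eqxx. Qed.

Lemma ofdeg0 i : ofdeg g i 0.
Proof. exact: gcomp0. Qed.

Lemma ofdegD i x y : ofdeg g i x -> ofdeg g i y -> ofdeg g i (x + y).
Proof. by rewrite /ofdeg gcompD => -> ->. Qed.

Lemma ofdegB i x y : ofdeg g i x -> ofdeg g i y -> ofdeg g i (x - y).
Proof. by rewrite /ofdeg gcompB => -> ->. Qed.

Lemma ofdeg_bigsum i I (r : seq I) (P : pred I) (F : I -> V) :
  (forall a, P a -> ofdeg g i (F a)) -> ofdeg g i (\sum_(a <- r | P a) F a).
Proof.
by move=> h; rewrite /ofdeg gcomp_bigsum; apply: eq_bigr => a /h ->.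
Qed.

Lemma gcomp_ofdeg i j x : ofdeg g j x -> gcomp g i x = if i == j then x else 0.
Proof. by move=> <-; rewrite gcomp_gcomp. Qed.

Lemma gcomp_inj0 x : (forall i, gcomp g i x = 0) -> x = 0.
Proof. by move=> h; have [s _ ->] := gcomp_sum g x; rewrite big1. Qed.

End Gradings.

Section GradedModules.
Context (k : fieldType) (A : algType k) (gA : connected_grading A) (M : gmod gA).
Implicit Types (i j : int) (a : A) (x : M).

Lemma ofdegZ i j a x : ofdeg gA i a -> ofdeg (mgr M) j x ->
  ofdeg (mgr M) (i + j) (a *: x).
Proof. exact: mgr_scale. Qed.

Lemma ofdegZ_eq t i j a x : ofdeg gA i a -> ofdeg (mgr M) j x -> t = i + j ->
  ofdeg (mgr M) t (a *: x).
Proof. by move=> ha hx ->; apply: ofdegZ. Qed.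

Lemma gcompZr i j a x : ofdeg (mgr M) j x ->
  gcomp (mgr M) i (a *: x) = gcomp gA (i - j) a *: x.
Proof.
move=> hx; have [s _ ->] := gcomp_sum gA a.
rewrite scaler_suml !gcomp_bigsum scaler_suml; apply: eq_bigr => l _.
rewrite (gcomp_ofdeg i (ofdegZ (ofdeg_gcomp gA l a) hx)).
rewrite gcomp_gcomp subr_eq.
by case: ifP => // _; rewrite scale0r.
Qed.

Lemma gcompZl i j a x : ofdeg gA j a ->
  gcomp (mgr M) i (a *: x) = a *: gcomp (mgr M) (i - j) x.
Proof.
move=> ha; have [s _ ->] := gcomp_sum (mgr M) x.
rewrite scaler_sumr !gcomp_bigsum scaler_sumr; apply: eq_bigr => l _.
rewrite (gcomp_ofdeg i (ofdegZ ha (ofdeg_gcomp (mgr M) l x))).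
rewrite gcomp_gcomp subr_eq [l + j]addrC.
by case: ifP => // _; rewrite scaler0.
Qed.

Lemma ofdeg0_scalar (c : k) : ofdeg gA 0 c%:A.
Proof. by rewrite /ofdeg agr_connected linearZ rmorph1 /= [X in X%:A]mulr1. Qed.

Lemma ofdegZk j (c : k) x : ofdeg (mgr M) j x -> ofdeg (mgr M) j (c%:A *: x).
Proof. by move=> hx; have := ofdegZ (ofdeg0_scalar c) hx; rewrite add0r. Qed.

End GradedModules.

Section GradedAlgebra.
Context (k : fieldType) (A : algType k) (gA : connected_grading A).
Implicit Types (i j : int) (a b : A).

Lemma ofdegM i j a b : ofdeg gA i a -> ofdeg gA j b -> ofdeg gA (i + j) (a * b).
Proof. exact: agr_mul. Qed.

Lemma ofdegM_eq t i j a b : ofdeg gA i a -> ofdeg gA j b -> t = i + j ->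
  ofdeg gA t (a * b).
Proof. by move=> ha hb ->; apply: ofdegM. Qed.

Lemma gcompMr i j a b : ofdeg gA j b -> gcomp gA i (a * b) = gcomp gA (i - j) a * b.
Proof. exact: (@gcompZr _ _ _ (regular_gmod gA)). Qed.

Lemma gcompMl i j a b : ofdeg gA j a -> gcomp gA i (a * b) = a * gcomp gA (i - j) b.
Proof. exact: (@gcompZl _ _ _ (regular_gmod gA)). Qed.

Lemma ofdeg_lt0 i a : ofdeg gA i a -> i < 0 -> a = 0.
Proof. by move=> <- i0; rewrite agr_ge0. Qed.

Lemma ofdeg1 : ofdeg gA 0 1.
Proof. by have := ofdeg0_scalar gA 1; rewrite scale1r. Qed.

Definition aug (a : A) : k := augmentation gA a.

Lemma augD a b : aug (a + b) = aug a + aug b.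
Proof. exact: linearD. Qed.

Lemma augB a b : aug (a - b) = aug a - aug b.
Proof. exact: linearB. Qed.

Lemma aug0 : aug 0 = 0.
Proof. exact: linear0. Qed.

Lemma aug1 : aug 1 = 1.
Proof. exact: rmorph1. Qed.

Lemma augM a b : aug (a * b) = aug a * aug b.
Proof. exact: rmorphM. Qed.

Lemma augZ (c : k) a : aug (c *: a) = c * aug a.
Proof. by rewrite /aug linearZ. Qed.

Lemma aug_scalar (c : k) : aug c%:A = c.
Proof. by rewrite /aug linearZ rmorph1 /= [LHS]mulr1. Qed.

Lemma aug_bigsum I (r : seq I) (P : pred I) (F : I -> A) :
  aug (\sum_(i <- r | P i) F i) = \sum_(i <- r | P i) aug (F i).
Proof. exact: (big_morph _ augD aug0). Qed.

Lemma gcomp_aug a : gcomp gA 0 a = (aug a)%:A.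
Proof. exact: agr_connected. Qed.

Lemma aug_ofdeg i a : ofdeg gA i a -> i <> 0 -> aug a = 0.
Proof.
move=> ha /eqP i0; have := gcomp_ofdeg 0 ha; rewrite eq_sym (negbTE i0).
by rewrite gcomp_aug => /(congr1 aug); rewrite aug_scalar aug0.
Qed.

Lemma ofdeg0_aug a : ofdeg gA 0 a -> a = (aug a)%:A.
Proof. by move=> <-; rewrite !gcomp_aug aug_scalar. Qed.

Lemma pos_idealP a : pos_ideal gA a <-> aug a = 0.
Proof.
split=> [h|h i].
  by have := h 0 (lexx _); rewrite gcomp_aug => /(congr1 aug);
     rewrite aug_scalar aug0.
rewrite le_eqVlt => /orP[/eqP ->|/(agr_ge0 gA)//].
by rewrite gcomp_aug h scale0r.
Qed.

Lemma aug_eq0_gcomp i a : aug a = 0 -> i <= 0 -> gcomp gA i a = 0.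
Proof. by move=> /pos_idealP; apply. Qed.

Lemma aug_subr a : aug (a - (aug a)%:A) = 0.
Proof. by rewrite augB aug_scalar subrr. Qed.

End GradedAlgebra.

Section GradingSupport.
Context (V : zmodType) (g : grading V).

(** Components outside [s] vanish, so any larger list serves as well; this gives finitely many
    elements a common list of degrees. *)
Lemma gcomp_sum_sub (x : V) : exists s : seq int, forall s' : seq int,
  uniq s' -> {subset s <= s'} -> x = \sum_(i <- s') gcomp g i x.
Proof.
have [s us ex] := gcomp_sum g x; exists s => s' us' ss'.
have out i : i \notin s -> gcomp g i x = 0.
  move=> si; rewrite ex gcomp_bigsum big1_seq // => j /andP[_ js].
  by rewrite gcomp_gcomp; case: eqP => // ij; rewrite ij js in si.
rewrite (bigID (fun i => i \in s)) /= [X in _ + X]big1 ?addr0 => [|i /out//].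
rewrite -big_filter {1}ex; apply: perm_big.
apply: uniq_perm; rewrite ?filter_uniq // => i.
rewrite mem_filter; case si: (i \in s) => //=; by rewrite (ss' _ si).
Qed.

Lemma gcomp_sum_family (n : nat) (F : 'I_n -> V) (w : 'I_n -> int) :
  exists2 s : seq int, uniq s &
    forall a, F a = \sum_(i <- s) gcomp g (i - w a) (F a).
Proof.
have [s hs] := choice (fun a => gcomp_sum_sub (F a)).
pose t := undup (flatten [seq [seq l + w a | l <- s a] | a <- enum 'I_n]).
exists t; first exact: undup_uniq.
move=> a; have inj_w : injective (fun i : int => i - w a).
  by move=> i j /(congr1 (fun l => l + w a)); rewrite !subrK.
rewrite {1}(hs a [seq i - w a | i <- t]) ?big_map //.
  by rewrite map_inj_uniq ?undup_uniq.
move=> l ls; apply/mapP; exists (l + w a); last by rewrite addrK.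
rewrite mem_undup; apply/flattenP; exists [seq l + w a | l <- s a].
  by apply/mapP; exists a; rewrite ?mem_enum.
by apply/mapP; exists l.
Qed.

End GradingSupport.

(** * Free graded modules and injectivity *)

Section FreeModule.
Context (k : fieldType) (A : algType k) (gA : connected_grading A).
Context (n : nat) (w : 'I_n -> int).

Let row := {ffun 'I_n -> A^o}.

(** The basis vector e_a has degree [w a], so coordinate a of a row of degree i has degree
    [i - w a]. *)
Let fcomp (i : int) (v : row) : row := [ffun a => gcomp gA (i - w a) (v a)].

Let fcompD i : {morph fcomp i : x y / x + y}.
Proof. by move=> x y; apply/ffunP => a; rewrite !ffunE gcompD. Qed.

Let fcomp_comp i j v : fcomp i (fcomp j v) = if i == j then fcomp j v else 0.
Proof.
apply/ffunP => a; rewrite !ffunE gcomp_gcomp.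
rewrite (inj_eq (addIr _)); by case: ifP => _; rewrite !ffunE.
Qed.

Let fcomp_sum v : exists2 s : seq int, uniq s & v = \sum_(i <- s) fcomp i v.
Proof.
have [s us hs] := gcomp_sum_family gA (fun a => v a : A) w.
exists s => //; apply/ffunP => a; rewrite sum_ffunE {1}hs.
by apply: eq_bigr => i _; rewrite ffunE.
Qed.

Definition free_grading : grading row := Grading fcompD fcomp_comp fcomp_sum.

Let free_scale i j a (v : row) : gcomp gA i a = a ->
  gcomp free_grading j v = v -> gcomp free_grading (i + j) (a *: v) = a *: v.
Proof.
move=> ha hv; apply/ffunP => b; rewrite !ffunE.
have hb : gcomp gA (j - w b) (v b) = v b by rewrite -[in RHS]hv ffunE.
by rewrite -addrA; apply: (agr_mul (c := gA)).
Qed.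

Definition free_gmod : gmod gA := GMod free_scale.

Lemma free_gcompE i (v : free_gmod) a :
  gcomp (mgr free_gmod) i v a = gcomp gA (i - w a) (v a).
Proof. by rewrite ffunE. Qed.

End FreeModule.

Section SubModule.
Context (k : fieldType) (A : algType k) (gA : connected_grading A) (M : gmod gA).

Record graded_submod (S : M -> Prop) : Prop := GradedSubmod {
  gsub0 : S 0;
  gsubD : forall x y, S x -> S y -> S (x + y);
  gsubZ : forall (a : A) x, S x -> S (a *: x);
  gsub_comp : forall i x, S x -> S (gcomp (mgr M) i x)
}.

Lemma gsubN S : graded_submod S -> forall x, S x -> S (- x).
Proof. by move=> hS x Sx; rewrite -scaleN1r; apply: gsubZ. Qed.

Lemma gsubB S : graded_submod S -> forall x y, S x -> S y -> S (x - y).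
Proof. by move=> hS x y Sx Sy; apply: gsubD => //; apply: gsubN. Qed.

Lemma gsub_sum S : graded_submod S -> forall I (r : seq I) (P : pred I) F,
  (forall i, P i -> S (F i)) -> S (\sum_(i <- r | P i) F i).
Proof. by move=> hS I r P F h; apply: big_ind => //; [apply: gsub0|apply: gsubD]. Qed.

Context (S : M -> Prop) (hS : graded_submod S).

(** The proof that [S] is a graded submodule is an unnamed argument, so that the closure instance,
    which depends on it, can be inferred from the predicate. *)
Definition submod_pred of graded_submod S : {pred M} := [pred x | `[< S x >]].

Let submod_closed : GRing.submod_closed (submod_pred hS).
Proof.
split=> [|a x y]; first by apply/asboolP; apply: gsub0.
move=> /asboolP Sx /asboolP Sy; apply/asboolP.
by apply: gsubD => //; apply: gsubZ.
Qed.

HB.instance Definition _ :=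
  GRing.isSubmodClosed.Build A M (submod_pred hS) submod_closed.

Record submod_type :=
  SubmodType { submod_val : M; submod_valP : submod_val \in submod_pred hS }.

HB.instance Definition _ := [isSub of submod_type for submod_val].
HB.instance Definition _ := [Choice of submod_type by <:].
HB.instance Definition _ := [SubChoice_isSubLmodule of submod_type by <:].

Let sub_comp_in i (x : submod_type) : gcomp (mgr M) i (submod_val x) \in submod_pred hS.
Proof. by apply/asboolP; apply: gsub_comp => //; apply/asboolP; exact: submod_valP. Qed.

Let scomp i (x : submod_type) : submod_type := SubmodType (sub_comp_in i x).

Let scompD i : {morph scomp i : x y / x + y}.
Proof. by move=> x y; apply: val_inj; exact: (gcompD (mgr M)). Qed.

Let scomp_comp i j x : scomp i (scomp j x) = if i == j then scomp j x else 0.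
Proof. by apply: val_inj; rewrite /= gcomp_gcomp; case: eqP. Qed.

Lemma submod_val_linear : linear (submod_val : submod_type -> M).
Proof. by []. Qed.

HB.instance Definition _ :=
  GRing.isLinear.Build A submod_type M _ submod_val submod_val_linear.

Let scomp_sum x : exists2 s : seq int, uniq s & x = \sum_(i <- s) scomp i x.
Proof.
have [s us e] := gcomp_sum (mgr M) (submod_val x).
by exists s => //; apply: val_inj; rewrite /= raddf_sum.
Qed.

Let sgr : grading submod_type := Grading scompD scomp_comp scomp_sum.

Let sscale i j (a : A) (x : submod_type) : gcomp gA i a = a ->
  gcomp sgr j x = x -> gcomp sgr (i + j) (a *: x) = a *: x.
Proof.
by move=> ha /(congr1 val) /= hx; apply: val_inj; apply: mgr_scale.
Qed.

Definition sub_gmod : gmod gA := GMod sscale.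

Lemma sub_gmod_val_deg : homogeneous 0 (submod_val : sub_gmod -> M).
Proof. by move=> n x; rewrite addr0. Qed.

End SubModule.

Section InjectiveExtension.
Context (k : fieldType) (A : algType k) (gA : connected_grading A).
Context (E : gmod gA) (injE : graded_injective E).

(** [f] is a total function constrained on [S] only, so that later applications need no type for the
    subobject. *)
Lemma injective_extend (M : gmod gA) (S : M -> Prop) (f : M -> E) :
  graded_submod S ->
  (forall a x y, S x -> S y -> f (a *: x + y) = a *: f x + f y) ->
  (forall i x, S x -> f (gcomp (mgr M) i x) = gcomp (mgr E) i (f x)) ->
  exists2 h : {linear M -> E}, homogeneous 0 h & forall x, S x -> h x = f x.
Proof.
move=> hS flin fdeg.
pose f' (x : sub_gmod hS) : E := f (submod_val x).
have Sv (x : sub_gmod hS) : S (submod_val x) by apply/asboolP; exact: submod_valP.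
have lf' : linear f' by move=> a x y; rewrite /f' -flin.
pose fL := GRing.isLinear.Build A (sub_gmod hS) E _ f' lf'.
pose fl : {linear sub_gmod hS -> E} := HB.pack f' fL.
have [|||h hh he] := @injE (sub_gmod hS) M (@submod_val _ _ _ _ _ hS) fl.
- exact: val_inj.
- exact: sub_gmod_val_deg.
- by move=> i x; rewrite addr0 /= /f' -fdeg.
exists h => // x Sx; have Sx' : x \in submod_pred hS by apply/asboolP.
by rewrite -[x]/(submod_val (SubmodType Sx')) he.
Qed.

(** A map out of a free module is the column [v] of the images of the basis vectors, so the
    extension takes the form of a column. *)
Lemma injective_extend_row n (w : 'I_n -> int)
    (S : {ffun 'I_n -> A^o} -> Prop) (f : {ffun 'I_n -> A^o} -> E) :
  @graded_submod _ _ _ (free_gmod gA w) S ->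
  (forall a x y, S x -> S y -> f (a *: x + y) = a *: f x + f y) ->
  (forall i x, S x ->
     f (gcomp (mgr (free_gmod gA w)) i x) = gcomp (mgr E) i (f x)) ->
  exists2 v : 'I_n -> E, forall a, ofdeg (mgr E) (w a) (v a) &
    forall x, S x -> f x = \sum_a (x a : A) *: v a.
Proof.
move=> hS flin fdeg; have [h hh he] := injective_extend hS flin fdeg.
pose e (a : 'I_n) : free_gmod gA w := [ffun b => (a == b)%:R : A^o].
exists (fun a => h (e a)) => [a|x Sx].
  rewrite /ofdeg -[X in gcomp _ X]addr0 -hh; congr (h _); apply/ffunP => b.
  rewrite free_gcompE !ffunE; case: eqP => [->|_]; last exact: gcomp0.
  by rewrite subrr; apply: ofdeg1.
rewrite -he //.
have {1}-> : x = \sum_a (x a : A) *: e a.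
  apply/ffunP => b; rewrite sum_ffunE (bigD1 b) //= !ffunE eqxx.
  rewrite big1 => [|a /negbTE ab]; first by rewrite addr0 [RHS]mulr1.
  by rewrite !ffunE ab [LHS]mulr0.
by rewrite linear_sum; apply: eq_bigr => a _; rewrite linearZ.
Qed.

End InjectiveExtension.

(** * Balancing Ext over a cyclic module *)

Section DoubleComplex.
Context (C : nat -> zmodType) (N : zmodType).
Context (P : forall k, nat -> C k -> Prop) (PN : nat -> N -> Prop).
Context (d : forall k, C k -> C k.+1) (D : forall k, nat -> C k -> C k).
Context (DN : nat -> N -> N) (eta : N -> C 0).
Arguments P {k}. Arguments d {k}. Arguments D {k}.
Hypothesis PB : forall k l (x y : C k), P l x -> P l y -> P l (x - y).
Hypothesis dB : forall k (x y : C k), d (x - y) = d x - d y.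
Hypothesis DB : forall k l (x y : C k), D l (x - y) = D l x - D l y.
Hypothesis Pd : forall k l (x : C k), P l x -> P l (d x).
Hypothesis PD : forall k l (x : C k), P l x -> P l.+1 (D l x).
Hypothesis Peta : forall l y, PN l y -> P l (eta y).
Hypothesis eta_inj : injective eta.
Hypothesis eta0 : eta 0 = 0.
Hypothesis dD : forall k l (x : C k), d (D l x) = D l (d x).
Hypothesis etaD : forall l y, eta (DN l y) = D l (eta y).
Hypothesis deta : forall y, d (eta y) = 0.
Hypothesis dd : forall k (x : C k), d (d x) = 0.
Hypothesis DD : forall k l (x : C k), D l.+1 (D l x) = 0.
Hypothesis exd0 : forall l (u : C 0), P l u -> d u = 0 ->
  exists2 y, PN l y & u = eta y.
Hypothesis exdS : forall k l (u : C k.+1), P l u -> d u = 0 ->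
  exists2 v : C k, P l v & u = d v.
Hypothesis exD : forall k l (u : C k), P l.+1 u -> D l.+1 u = 0 ->
  exists2 v : C k, P l v & u = D l v.

(** Staircase in a double complex. [C k] holds the terms of bidegree (k, l) for all l, and [P l]
    singles out one of them; [d] raises k and [D] raises l. From [u] in bidegree (k, l), each stage
    takes a [d]-preimage and applies [D], down to [eta y] in bidegree (0, k + l). The squares
    commute, as no total complex is formed. *)
Fixpoint zigzag k l : C k -> N -> Prop :=
  match k with
  | 0 => fun u y => u = eta y
  | k'.+1 => fun u y => exists v : C k', [/\ P l v, u = d v & zigzag l.+1 (D l v) y]
  end.

Let d0 k : d (0 : C k) = 0.
Proof. by rewrite -[X in d X](subrr 0) dB subrr. Qed.

Lemma zigzag_right k l (u : C k) : P l u -> d u = 0 -> D l u = 0 ->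
  exists y, [/\ zigzag l u y, PN (k + l)%N y & DN (k + l) y = 0].
Proof.
elim: k l u => [|k IH] l u Pu du Du.
  have [y Py uy] := exd0 Pu du; exists y; split=> //.
  by apply: eta_inj; rewrite etaD -uy Du.
have [v Pv uv] := exdS Pu du.
have [|||y [z Py Dy]] := IH l.+1 (D l v); first exact: PD.
- by rewrite dD -uv.
- exact: DD.
rewrite !addnS in Py Dy; exists y; split=> //; by exists v.
Qed.

Lemma zigzag_left k l y : PN (k + l)%N y -> DN (k + l) y = 0 ->
  exists u : C k, [/\ zigzag l u y, P l u, d u = 0 & D l u = 0].
Proof.
elim: k l => [|k IH] l Py Dy.
  exists (eta y); split=> //; first exact: Peta.
  by rewrite -etaD Dy eta0.
rewrite addSnnS in Py Dy.
have [u [z Pu du Du]] := IH _ Py Dy.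
have [v Pv uv] := exD Pu Du.
exists (d v); split; last by rewrite -dD -uv du.
- by exists v; rewrite -uv.
- exact: Pd.
- exact: dd.
Qed.

(** Correcting the last preimage by [eta w], and each earlier one by a [d]-boundary, makes its
    [D]-image zero without changing its [d]-image. *)
Lemma zigzag_coboundary_left k l (u : C k.+1) y w : zigzag l u y ->
  PN (k + l)%N w -> y = DN (k + l) w ->
  exists x : C k, [/\ P l x, D l x = 0 & u = d x].
Proof.
elim: k l u => [|k IH] l u [v [Pv uv z]] Pw yw.
  exists (v - eta w); split; first by apply: PB => //; apply: Peta.
    by rewrite DB -etaD -yw z subrr.
  by rewrite dB deta subr0.
rewrite addSnnS in Pw yw.
have [x [Px Dx e]] := IH l.+1 (D l v) z Pw yw.
have [x' Px' ex'] := exD Px Dx.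
exists (v - d x'); split; first by apply: PB => //; apply: Pd.
  by rewrite DB -dD -ex' -e subrr.
by rewrite dB dd subr0.
Qed.

Lemma zigzag_coboundary_right k l (u : C k.+1) y (x : C k) : zigzag l u y ->
  P l x -> D l x = 0 -> u = d x ->
  exists2 w, PN (k + l)%N w & y = DN (k + l) w.
Proof.
elim: k l u x => [|k IH] l u x [v [Pv uv z]] Px Dx ux.
  have [||w Pw ew] := @exd0 l (v - x); first exact: PB.
    by rewrite dB -uv -ux subrr.
  exists w => //; apply: eta_inj; rewrite etaD -ew DB Dx subr0; exact: esym.
have [||x' Px' ex'] := @exdS k l (v - x); first exact: PB.
  by rewrite dB -uv -ux subrr.
have := IH l.+1 (D l v) (D l x') z (PD Px') (DD l x').
rewrite addSnnS; apply.
by rewrite dD -ex' DB Dx subr0.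
Qed.

End DoubleComplex.

(** * Homogeneous families and matrix products *)

Section Vectors.
Context (V : zmodType) (g : grading V).

(* Families indexed by an initial segment of nat are functions on nat that
   vanish beyond it; this keeps the lengths out of the types. *)
Definition vec (n : nat) (w : nat -> int) (v : nat -> V) : Prop :=
  (forall a, ofdeg g (w a) (v a)) /\ (forall a, (n <= a)%N -> v a = 0).

Lemma vec0 n w : vec n w 0.
Proof. by split=> // a; apply: ofdeg0. Qed.

Lemma vecB n w u v : vec n w u -> vec n w v -> vec n w (u - v).
Proof.
move=> [hu ou] [hv ov]; split=> a; first exact: ofdegB.
by move=> na; rewrite -[LHS]/(u a - v a) ou ?ov ?subrr.
Qed.

Definition fext n (v : 'I_n -> V) (a : nat) : V := oapp v 0 (insub a).

Lemma fext_ord n (v : 'I_n -> V) (i : 'I_n) : fext v i = v i.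
Proof. by rewrite /fext valK. Qed.

Lemma fext_out n (v : 'I_n -> V) a : (n <= a)%N -> fext v a = 0.
Proof. by move=> na; rewrite /fext insubF // ltnNge na. Qed.

Lemma vec_fext n (w : nat -> int) (v : 'I_n -> V) :
  (forall i : 'I_n, ofdeg g (w i) (v i)) -> vec n w (fext v).
Proof.
move=> h; split=> a; last exact: fext_out.
rewrite /fext; case: insubP => [i _ <-|_] /=; [exact: h|exact: ofdeg0].
Qed.

Lemma vec_cut n w (v : nat -> V) : (forall a, (a < n)%N -> ofdeg g (w a) (v a)) ->
  vec n w (fun a => if (a < n)%N then v a else 0).
Proof.
move=> h; split=> a; last by rewrite leqNgt => /negbTE ->.
by case: ifP => [/h //|_]; apply: ofdeg0.
Qed.

End Vectors.

(** [rmul] is the differential of a free resolution acting on row vectors, [cmul] the one it induces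
    on homomorphisms to [M], a homomorphism being the column of its values on the basis. *)
Definition rmul (A : pzRingType) n (u : nat -> A) (D : nat -> nat -> A) (b : nat) : A :=
  \sum_(a < n) u a * D a b.

Definition cmul (A : pzRingType) (M : lmodType A) n (D : nat -> nat -> A)
  (x : nat -> M) (a : nat) : M := \sum_(b < n) D a b *: x b.

Section Multiplication.
Context (A : pzRingType) (M : lmodType A).
Implicit Types (u v : nat -> A) (D : nat -> nat -> A) (x y : nat -> M).

Lemma rmulB n u v D : rmul n (u - v) D = rmul n u D - rmul n v D.
Proof.
apply/funext => b; rewrite /rmul -[RHS]/(_ - _) -sumrB; apply: eq_bigr => a _.
by rewrite -mulrBl.
Qed.

Lemma rmulD n u v D : rmul n (u + v) D = rmul n u D + rmul n v D.
Proof.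
apply/funext => b; rewrite /rmul -[RHS]/(_ + _) -big_split; apply: eq_bigr => a _.
by rewrite /= -mulrDl.
Qed.

Lemma rmulZ n (c : A) v D : rmul n (fun a => c * v a) D = (fun b => c * rmul n v D b).
Proof.
by apply/funext => b; rewrite /rmul mulr_sumr; apply: eq_bigr => a _; rewrite mulrA.
Qed.

Lemma rmul0 n D : rmul n 0 D = 0.
Proof. by apply/funext => b; rewrite /rmul big1 // => a _; rewrite mul0r. Qed.

Lemma cmulB n D x y : cmul n D (x - y) = cmul n D x - cmul n D y.
Proof.
apply/funext => b; rewrite /cmul -[RHS]/(_ - _) -sumrB; apply: eq_bigr => a _.
by rewrite -scalerBr.
Qed.

Lemma cmul0 n D : cmul n D (0 : nat -> M) = 0.
Proof. by apply/funext => b; rewrite /cmul big1 // => a _; rewrite scaler0. Qed.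

Lemma cmul_cmul n m D D' x : cmul n D (cmul m D' x) =
  cmul m (fun a => rmul n (D a) D') x.
Proof.
apply/funext => a; rewrite /cmul.
under eq_bigr do rewrite scaler_sumr.
rewrite exchange_big; apply: eq_bigr => b _.
by rewrite scaler_suml; apply: eq_bigr => c _; rewrite scalerA.
Qed.

Lemma rmul_rmul n m u D D' : rmul n (rmul m u D) D' =
  rmul m u (fun a => rmul n (D a) D').
Proof.
apply/funext => a; rewrite /rmul.
under eq_bigr do rewrite mulr_suml.
rewrite exchange_big; apply: eq_bigr => b _.
by rewrite mulr_sumr; apply: eq_bigr => c _; rewrite mulrA.
Qed.

Lemma rmul_cmul n m u D x :
  \sum_(b < m) rmul n u D b *: x b = \sum_(a < n) u a *: cmul m D x a.
Proof.
under eq_bigr do rewrite scaler_suml.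
rewrite exchange_big; apply: eq_bigr => a _.
by rewrite scaler_sumr; apply: eq_bigr => b _; rewrite scalerA.
Qed.

Lemma cmul_map (M' : lmodType A) (f : {linear M -> M'}) n D x :
  cmul n D (fun a => f (x a)) = (fun a => f (cmul n D x a)).
Proof.
by apply/funext => a; rewrite linear_sum; apply: eq_bigr => b _; rewrite linearZ.
Qed.

End Multiplication.

(** * Graded free resolutions and maps to injective modules *)

Section FreeResolutions.
Context (k : fieldType) (A : algType k) (gA : connected_grading A).

(* A graded free resolution of a cyclic module by finitely generated modules:
   the l-th term has basis elements e_a (a < fr_n l) of degree fr_w l a, and
   fr_d l maps e_a to \sum_b fr_d l a b e_b. *)
Record free_res := FreeRes {
  fr_n : nat -> nat;
  fr_w : nat -> nat -> int;
  fr_d : nat -> nat -> nat -> A;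
  fr_n0 : fr_n 0 = 1;
  fr_w0 : fr_w 0 0 = 0;
  fr_out : forall l a b, (fr_n l.+1 <= a)%N || (fr_n l <= b)%N -> fr_d l a b = 0;
  fr_deg : forall l a b, ofdeg gA (fr_w l.+1 a - fr_w l b) (fr_d l a b);
  fr_dd : forall l a, rmul (fr_n l.+1) (fr_d l.+1 a) (fr_d l) = 0;
  fr_exact : forall l t v, vec gA (fr_n l.+1) (fun a => t - fr_w l.+1 a) v ->
    rmul (fr_n l.+1) v (fr_d l) = 0 ->
    exists2 u, vec gA (fr_n l.+2) (fun a => t - fr_w l.+2 a) u
             & v = rmul (fr_n l.+2) u (fr_d l.+1)
}.

(** The image of term 1 in term 0, which is A itself: F resolves A modulo this left ideal. *)
Definition fr_ideal (F : free_res) (a : A) : Prop :=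
  exists u, a = rmul (fr_n F 1) u (fr_d F 0) 0.

Context (F : free_res).
Local Notation n := (fr_n F).
Local Notation w := (fr_w F).
Local Notation D := (fr_d F).

Lemma gcomp_rmul l t v b :
  gcomp gA (t - w l b) (rmul (n l.+1) v (D l) b) =
  rmul (n l.+1) (fun a => gcomp gA (t - w l.+1 a) (v a)) (D l) b.
Proof.
rewrite /rmul gcomp_bigsum; apply: eq_bigr => a _.
rewrite (gcompMr _ _ (fr_deg F l a b)); congr (gcomp _ _ _ * _); ring.
Qed.

Lemma vec_cmul (M : gmod gA) l t (x : nat -> M) :
  vec (mgr M) (n l) (fun a => t + w l a) x ->
  vec (mgr M) (n l.+1) (fun a => t + w l.+1 a) (cmul (n l) (D l) x).
Proof.
move=> [hx ox]; split=> a.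
  apply: ofdeg_bigsum => b _; apply: ofdegZ_eq (fr_deg F l a b) (hx b) _; ring.
by move=> na; rewrite /cmul big1 // => b _; rewrite fr_out ?na ?scale0r.
Qed.

Lemma cmul_dd (M : lmodType A) l (x : nat -> M) :
  cmul (n l.+1) (D l.+1) (cmul (n l) (D l) x) = 0.
Proof.
rewrite cmul_cmul; apply/funext => a; rewrite /cmul big1 // => b _.
by rewrite fr_dd scale0r.
Qed.

(** The column [u] is a map F_{l+1} -> E vanishing on boundaries, hence on cycles since F is exact.
    It descends to the image of F_{l+1} in F_l, and injectivity of E extends it to F_l. *)
Lemma injective_exact (E : gmod gA) (injE : graded_injective E) l t (u : nat -> E) :
  vec (mgr E) (n l.+1) (fun a => t + w l.+1 a) u ->
  cmul (n l.+1) (D l.+1) u = 0 ->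
  exists2 v, vec (mgr E) (n l) (fun a => t + w l a) v & u = cmul (n l) (D l) v.
Proof.
move=> [hu ou] Du.
(* The descent is well defined. Exactness is available one degree at a time, so the relation [r] is
   split into homogeneous components. *)
have wd0 r : (forall b, rmul (n l.+1) r (D l) b = 0) -> \sum_(a < n l.+1) r a *: u a = 0.
  move=> hr; apply: (@gcomp_inj0 _ (mgr E)) => i; rewrite gcomp_bigsum.
  pose r' a := if (a < n l.+1)%N then gcomp gA ((i - t) - w l.+1 a) (r a) else 0.
  transitivity (\sum_(a < n l.+1) r' a *: u a).
    apply: eq_bigr => a _; rewrite (gcompZr _ _ (hu a)) /r' ltn_ord.
    by congr (gcomp _ _ _ *: _); ring.
  have [||s _ ->] := @fr_exact F l (i - t) r'.
  - by apply: vec_cut => a _; apply: ofdeg_gcomp.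
  - apply/funext => b; rewrite -[RHS](gcomp0 gA (i - t - w l b)) -(hr b) gcomp_rmul.
    by apply: eq_bigr => a _; rewrite /r' ltn_ord.
  rewrite rmul_cmul big1 // => a _; by rewrite Du scaler0.
pose row (x : {ffun 'I_(n l) -> A^o}) r := forall b : 'I_(n l), x b = rmul (n l.+1) r (D l) b.
pose S x := exists r, row x r.
(* A row of coefficients for each [x] in the image; elsewhere its value is irrelevant. *)
have /choice[c hc] : forall x, exists r, S x -> row x r.
  by move=> x; have [[r hr]|h] := pselect (S x); [exists r|exists 0].
pose f x := \sum_(a < n l.+1) c x a *: u a.
have fE x r : row x r -> f x = \sum_(a < n l.+1) r a *: u a.
  move=> hr; apply/eqP; rewrite -subr_eq0 /f -sumrB; apply/eqP.
  under eq_bigr do rewrite -scalerBl.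
  apply: (wd0 (c x - r)) => b; rewrite rmulB -[LHS]/(_ - _).
  have [bn|nb] := ltnP b (n l).
    by rewrite -(hc x (ex_intro _ r hr) (Ordinal bn)) -(hr (Ordinal bn)) subrr.
  by rewrite /rmul !big1 ?subrr // => a _; rewrite fr_out ?nb ?orbT ?mulr0.
have rowD a x y r s : row x r -> row y s -> row (a *: x + y) ((fun i => a * r i) + s).
  by move=> hr hs b; rewrite !ffunE hr hs rmulD rmulZ.
pose w' (b : 'I_(n l)) := t + w l b.
have row_comp i x r : row x r ->
    row (gcomp (mgr (free_gmod gA w')) i x) (fun a => gcomp gA (i - t - w l.+1 a) (r a)).
  move=> hr b; rewrite free_gcompE hr -gcomp_rmul; congr (gcomp _ _ _).
  by rewrite /w'; ring.
have [|a x y [r hr] [s hs]|i x [r hr]|v hv ev] :=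
    @injective_extend_row _ _ _ _ injE (n l) w' S f.
- split.
  + by exists 0 => b; rewrite ffunE rmul0.
  + move=> x y [r hr] [s hs]; exists ((fun i => 1 * r i) + s).
    by rewrite -[x]scale1r; apply: rowD.
  + move=> a x [r hr]; exists ((fun i => a * r i) + 0); rewrite -[_ *: x]addr0.
    by apply: rowD => // b; rewrite ffunE rmul0.
  + by move=> i x [r hr]; eexists; apply: row_comp hr.
- rewrite (fE _ _ (rowD a _ _ _ _ hr hs)) (fE _ _ hr) (fE _ _ hs).
  rewrite scaler_sumr -big_split /=; apply: eq_bigr => b _.
  by rewrite scalerA -scalerDl.
- rewrite (fE _ _ (row_comp i _ _ hr)) (fE _ _ hr) gcomp_bigsum.
  apply: eq_bigr => a _; rewrite (gcompZr _ _ (hu a)); congr (gcomp _ _ _ *: _); ring.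
exists (fext v); first exact: vec_fext.
apply/funext => a; have [an|na] := ltnP a (n l.+1); last first.
  by rewrite ou // /cmul big1 // => b _; rewrite fr_out ?na ?scale0r.
(* Row a of [D l] is the image of the a-th basis vector; evaluating the extension there gives entry
   a of the required equation. *)
pose x : {ffun 'I_(n l) -> A^o} := [ffun b : 'I_(n l) => D l a b : A^o].
have hx : row x (fun i => (i == a)%:R).
  move=> b; rewrite ffunE /rmul (bigD1 (Ordinal an)) //= eqxx mul1r big1 ?addr0 //.
  move=> i /negbTE ia; rewrite -[_ == a]/(i == Ordinal an) ia mul0r //.
have := ev x (ex_intro _ _ hx); rewrite (fE _ _ hx).
rewrite (bigD1 (Ordinal an)) //= eqxx scale1r big1 ?addr0.
  by move=> ->; apply: eq_bigr => b _; rewrite ffunE fext_ord.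
by move=> i /negbTE ia; rewrite -[nat_of_ord i == a]/(i == Ordinal an) ia scale0r.
Qed.

End FreeResolutions.

(** * Ext of cyclic modules read off either resolution *)

Section ExtOfCyclicModules.
Context (k : fieldType) (A : algType k) (gA : connected_grading A).

Definition killed (M : lmodType A) (J : A -> Prop) (x : M) : Prop :=
  forall a, J a -> a *: x = 0.

Lemma killedB (M : lmodType A) J (x y : M) : killed J x -> killed J y -> killed J (x - y).
Proof. by move=> hx hy a Ja; rewrite scalerBr hx ?hy ?subrr. Qed.

Lemma killedD (M : lmodType A) J (x y : M) : killed J x -> killed J y -> killed J (x + y).
Proof. by move=> hx hy a Ja; rewrite scalerDr hx ?hy ?addr0. Qed.

Context (N : gmod gA) (E : injective_resolution N).

Lemma ir_d_deg0 i t (x : E i) : ofdeg (mgr (E i)) t x ->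
  ofdeg (mgr (E i.+1)) t (ir_d E i x).
Proof. by move=> hx; rewrite /ofdeg -[X in gcomp _ X]addr0 -ir_d_deg hx. Qed.

Lemma ir_eta_deg0 t (y : N) : ofdeg (mgr N) t y -> ofdeg (mgr (E 0%N)) t (ir_eta E y).
Proof. by move=> hx; rewrite /ofdeg -[X in gcomp _ X]addr0 -ir_eta_deg hx. Qed.

Lemma ir_d_gcomp i t (x : E i) :
  ir_d E i (gcomp (mgr (E i)) t x) = gcomp (mgr (E i.+1)) t (ir_d E i x).
Proof. by rewrite ir_d_deg addr0. Qed.

Lemma ir_dd i (x : E i) : ir_d E i.+1 (ir_d E i x) = 0.
Proof. by apply/ir_exactS; exists x. Qed.

Lemma ir_d_eta (y : N) : ir_d E 0 (ir_eta E y) = 0.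
Proof. by apply/ir_exact0; exists y. Qed.

Lemma ir_exact0_deg t (x : E 0%N) : ofdeg (mgr (E 0%N)) t x -> ir_d E 0 x = 0 ->
  exists2 y, ofdeg (mgr N) t y & x = ir_eta E y.
Proof.
move=> hx /ir_exact0[y xy]; exists (gcomp (mgr N) t y); first exact: ofdeg_gcomp.
by rewrite ir_eta_deg addr0 -xy hx.
Qed.

Lemma ir_exactS_deg i t (x : E i.+1) : ofdeg (mgr (E i.+1)) t x ->
  ir_d E i.+1 x = 0 -> exists2 y, ofdeg (mgr (E i)) t y & x = ir_d E i y.
Proof.
move=> hx /ir_exactS[y xy]; exists (gcomp (mgr (E i)) t y); first exact: ofdeg_gcomp.
by rewrite ir_d_gcomp -xy hx.
Qed.

(* A map A/J -> E i of degree t is an element of degree t killed by J. *)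
Definition cobound (J : A -> Prop) (i : nat) (t : int) : E i -> Prop :=
  match i return E i -> Prop with
  | 0 => fun x => x = 0
  | i'.+1 => fun x => exists y, [/\ ofdeg (mgr (E i')) t y, killed J y & x = ir_d E i' y]
  end.

(** Vanishing of Ext^i(A / J, N) in degree t. *)
Definition ext_cyc_zero (J : A -> Prop) (i : nat) (t : int) : Prop :=
  forall x : E i, ofdeg (mgr (E i)) t x -> ir_d E i x = 0 -> killed J x ->
  cobound J t x.

(** A map out of k is determined by its value at 1, and every element killed by A_+ is such a
    value. *)
Lemma ext_zero_trivialP i t : ext_zero E (trivial_gmod gA) i t <->
  ext_cyc_zero (fun a => aug gA a = 0) i t.
Proof.
have lin j (f : {linear trivial_gmod gA -> E j}) c :
    f (c : k) = c%:A *: f (1 : k).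
  rewrite -linearZ; congr (f _); rewrite /GRing.scale /= /trivial_scale mulr1.
  exact/esym/aug_scalar.
have mk j (x : E j) : ofdeg (mgr (E j)) t x -> killed (fun a => aug gA a = 0) x ->
    exists2 f : {linear trivial_gmod gA -> E j}, homogeneous t f & f (1 : k) = x.
  move=> hx kx; pose f (c : trivial_gmod gA) : E j := (c : k)%:A *: x.
  have lf : linear f.
    move=> a c e; rewrite /f.
    transitivity ((aug gA a * (c : k) + (e : k))%:A *: x); first by [].
    rewrite scalerDl [in LHS]scalerDl; congr (_ + _); rewrite [RHS]scalerA.
    apply/eqP; rewrite -subr_eq0 -scalerBl; apply/eqP/kx.
    by rewrite augB augM !aug_scalar subrr.
  pose fL := GRing.isLinear.Build A (trivial_gmod gA) (E j) _ f lf.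
  pose fl : {linear trivial_gmod gA -> E j} := HB.pack f fL.
  exists fl; last by rewrite /= /f !scale1r.
  move=> i0 c /=; rewrite /f (gcompZr _ _ hx) addrK.
  rewrite (gcomp_ofdeg _ (ofdeg0_scalar gA c)) //.
  rewrite -[in LHS]/(if i0 == 0 then c else 0).
  by case: ifP => // _; rewrite scale0r.
split=> [h x hx dx kx|h f [hf df]].
  have [f ff f1] := mk _ x hx kx.
  have h' : ext_coboundary t f.
    by apply: h; split=> // c; rewrite lin linearZ /= f1 dx scaler0.
  clear h; case: i x hx dx kx f ff f1 h' => [|i] x hx dx kx f ff f1 /=.
    by move=> /(_ (1 : k)); rewrite f1.
  case=> g hg fg; exists (g (1 : k)); split; last by rewrite -f1 fg.
    by rewrite /ofdeg -[X in gcomp _ X]add0r -hg.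
  move=> a a0; rewrite -linearZ -[X in g X]/((aug gA a * 1 : k) : trivial_gmod gA).
  by rewrite a0 mul0r linear0.
have hx : ofdeg (mgr (E i)) t (f (1 : k)).
  by rewrite /ofdeg -[X in gcomp _ X]add0r -hf.
have kx : killed (fun a => aug gA a = 0) (f (1 : k)).
  move=> a a0; rewrite -linearZ -[X in f X]/((aug gA a * 1 : k) : trivial_gmod gA).
  by rewrite a0 mul0r linear0.
have := h _ hx (df _) kx.
case: i f hf df hx kx h => [|i] f hf df hx kx h /=.
  by move=> f1 c; rewrite lin f1 scaler0.
move=> [y [hy ky fy]]; have [g hg g1] := mk _ y hy ky.
by exists g => // c; rewrite [LHS]lin fy [g c]lin linearZ /= g1.
Qed.

Section Balancing.
Context (F : free_res gA) (t : int).
Local Notation n := (fr_n F).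
Local Notation w := (fr_w F).
Local Notation D := (fr_d F).

Definition is_col (M : gmod gA) l (u : nat -> M) : Prop :=
  vec (mgr M) (n l) (fun a => t + w l a) u.

Definition col_cobound (M : gmod gA) (i : nat) : (nat -> M) -> Prop :=
  match i with
  | 0 => fun y => y = 0
  | i'.+1 => fun y => exists2 v, is_col i' v & y = cmul (n i') (D i') v
  end.

(** Vanishing in degree t of the i-th cohomology of Hom(F, M). Only ranks, degrees and matrices of F
    enter, which makes resolutions over different rings comparable. *)
Definition col_zero (M : gmod gA) (i : nat) : Prop :=
  forall y : nat -> M, is_col i y -> cmul (n i) (D i) y = 0 -> col_cobound i y.

(** The double complex has the degree t part of Hom(F_l, E_i) in bidegree (i, l); [sg] identifies
    E_i with Hom(F_0, E_i), as F_0 is free on one generator of degree 0. *)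
Let C (i : nat) : zmodType := nat -> E i.
Let P i l (u : C i) : Prop := is_col l u.
Let d i (u : C i) : C i.+1 := fun a => ir_d E i (u a).
Let DE i l (u : C i) : C i := cmul (n l) (D l) u.
Let DN l (u : nat -> N) : nat -> N := cmul (n l) (D l) u.
Let eta (y : nat -> N) : C 0 := fun a => ir_eta E (y a).
Let sg (V : zmodType) (x : V) : nat -> V := fun a => if a == 0%N then x else 0.

Definition ext_zigzag (i : nat) (x : E i) (y : nat -> N) : Prop :=
  @zigzag C (nat -> N) P d DE eta i 0 (sg x) y.

Let PB i l (x y : C i) : P l x -> P l y -> P l (x - y).
Proof. exact: vecB. Qed.

Let dB i (x y : C i) : d (x - y) = d x - d y.
Proof. by apply/funext => a; rewrite /d -[RHS]/(_ - _) -linearB. Qed.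

Let DB i l (x y : C i) : DE l (x - y) = DE l x - DE l y.
Proof. exact: cmulB. Qed.

Let Pd i l (x : C i) : P l x -> P l (d x).
Proof.
move=> [hx ox]; split=> a; first exact/ir_d_deg0/hx.
by move=> na; rewrite /d ox // linear0.
Qed.

Let PD i l (x : C i) : P l x -> P l.+1 (DE l x).
Proof. exact: vec_cmul. Qed.

Let Peta l (y : nat -> N) : is_col l y -> P l (eta y).
Proof.
move=> [hx ox]; split=> a; first exact/ir_eta_deg0/hx.
by move=> na; rewrite /eta ox // linear0.
Qed.

Let eta_inj : injective eta.
Proof.
move=> x y e; apply/funext => a; apply: (@ir_eta_inj _ _ _ _ E).
exact: (congr1 (fun f => f a) e).
Qed.

Let eta0 : eta 0 = 0.
Proof. by apply/funext => a; rewrite /eta linear0. Qed.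

Let dD i l (x : C i) : d (DE l x) = DE l (d x).
Proof. by rewrite /DE /d cmul_map. Qed.

Let etaD l y : eta (DN l y) = DE l (eta y).
Proof. by rewrite /DE /eta cmul_map. Qed.

Let deta y : d (eta y) = 0.
Proof. by apply/funext => a; rewrite /d ir_d_eta. Qed.

Let dd i (x : C i) : d (d x) = 0.
Proof. by apply/funext => a; rewrite /d ir_dd. Qed.

Let DD i l (x : C i) : DE l.+1 (DE l x) = 0.
Proof. exact: cmul_dd. Qed.

Let exd0 l (u : C 0) : P l u -> d u = 0 -> exists2 y, is_col l y & u = eta y.
Proof.
move=> [hu ou] du.
have /choice[y hy] : forall a, exists y : N, [/\ ofdeg (mgr N) (t + w l a) y,
    u a = ir_eta E y & (n l <= a)%N -> y = 0].
  move=> a; have [na|na] := leqP (n l) a.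
    by exists 0; split; [apply: ofdeg0|rewrite ou // linear0|].
  have [|y hy e] := ir_exact0_deg (hu a); last by exists y.
  exact: (congr1 (fun f => f a) du).
exists y; first by split=> a; have [] := hy a.
by apply/funext => a; have [] := hy a.
Qed.

Let exdS i l (u : C i.+1) : P l u -> d u = 0 -> exists2 v : C i, P l v & u = d v.
Proof.
move=> [hu ou] du.
have /choice[y hy] : forall a, exists y : E i, [/\ ofdeg (mgr (E i)) (t + w l a) y,
    u a = ir_d E i y & (n l <= a)%N -> y = 0].
  move=> a; have [na|na] := leqP (n l) a.
    by exists 0; split; [apply: ofdeg0|rewrite ou // linear0|].
  have [|y hy e] := ir_exactS_deg (hu a); last by exists y.
  exact: (congr1 (fun f => f a) du).
exists y; first by split=> a; have [] := hy a.
by apply/funext => a; have [] := hy a.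
Qed.

Let exD i l (u : C i) : P l.+1 u -> DE l.+1 u = 0 ->
  exists2 v : C i, P l v & u = DE l v.
Proof. by apply: injective_exact; apply: ir_injective. Qed.

Let P_sg i (x : E i) : ofdeg (mgr (E i)) t x -> P 0 (sg x).
Proof.
move=> hx; split=> [[|a]|[|a]]; rewrite /sg /= ?fr_w0 ?addr0 ?fr_n0 //.
exact: ofdeg0.
Qed.

Let sg_P i (u : C i) : P 0 u -> u = sg (u 0%N) /\ ofdeg (mgr (E i)) t (u 0%N).
Proof.
move=> [hu ou]; split; last by have := hu 0%N; rewrite fr_w0 addr0.
by apply/funext => -[|a] //; rewrite ou // fr_n0.
Qed.

(** This identifies the kernel of the first [D] with Hom(A / J, E_i), J being the ideal resolved by
    F. *)
Let D_sg i (x : E i) : DE 0 (sg x) = 0 <-> killed (fr_ideal F) x.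
Proof.
split=> [e a [u ->]|h].
  rewrite /rmul scaler_suml big1 // => b _; rewrite -scalerA.
  have := congr1 (fun f => f (b : nat)) e; rewrite /DE /cmul fr_n0 big_ord1 /= => ->.
  exact: scaler0.
apply/funext => a; rewrite /DE /cmul fr_n0 big_ord1 /=.
have [na|na] := ltnP a (n 1); last by rewrite fr_out ?na // scale0r.
apply: h; exists (fun i => (i == a)%:R); rewrite /rmul (bigD1 (Ordinal na)) //=.
rewrite eqxx mul1r big1 ?addr0 // => j /negbTE ja.
by rewrite -[nat_of_ord j == a]/(j == Ordinal na) ja mul0r.
Qed.

Let d_sg i (x : E i) : d (sg x) = sg (ir_d E i x).
Proof. by apply/funext => -[|a]; rewrite /d /sg //= linear0. Qed.

Let sg_inj (V : zmodType) : injective (@sg V).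
Proof. by move=> x y /(congr1 (fun f => f 0%N)). Qed.

Let sg0 (V : zmodType) : sg (0 : V) = 0.
Proof. by apply/funext => -[]. Qed.

Lemma ext_zigzag_right i (x : E i) : ofdeg (mgr (E i)) t x -> ir_d E i x = 0 ->
  killed (fr_ideal F) x ->
  exists y, [/\ ext_zigzag x y, is_col i y & cmul (n i) (D i) y = 0].
Proof.
move=> hx dx kx.
have := @zigzag_right C (nat -> N) P (fun l => @is_col N l) d DE DN eta PD eta_inj
  eta0 dD etaD DD exd0 exdS i 0 (sg x) (P_sg hx).
rewrite addn0; apply; first by rewrite d_sg dx sg0.
exact/D_sg.
Qed.

Lemma ext_zigzag_left i (y : nat -> N) : is_col i y -> cmul (n i) (D i) y = 0 ->
  exists x : E i, [/\ ext_zigzag x y, ofdeg (mgr (E i)) t x, ir_d E i x = 0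
    & killed (fr_ideal F) x].
Proof.
move=> hy Dy.
have := @zigzag_left C (nat -> N) P (fun l => @is_col N l) d DE DN eta Pd
  Peta eta0 dD etaD deta dd exD i 0 y.
rewrite addn0 => /(_ hy Dy)[u [z Pu du Du]].
have [eu hu] := sg_P Pu; exists (u 0%N); split=> //.
- by rewrite /ext_zigzag -eu.
- by apply: sg_inj; rewrite sg0 -d_sg -eu.
- by apply/D_sg; rewrite -eu.
Qed.

Lemma ext_zigzag_cobound i (x : E i) (y : nat -> N) : ext_zigzag x y ->
  cobound (fr_ideal F) t x <-> col_cobound i y.
Proof.
case: i x => [|i] x z; split.
- move=> /= x0; apply: eta_inj; rewrite eta0.
  by move: z; rewrite /ext_zigzag /= x0 sg0 => <-.
- move=> /= y0; apply: (@sg_inj (E 0%N)).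
  by move: z; rewrite /ext_zigzag /= y0 eta0 => ->; rewrite sg0.
- move=> [x' [hx kx e]].
  have [||w Pw ew] := @zigzag_coboundary_right C (nat -> N) P (fun l => @is_col N l)
    d DE DN eta PB dB DB PD eta_inj dD etaD DD exd0 exdS i 0 (sg x) y (sg x') z (P_sg hx).
  + exact/D_sg.
  + by rewrite d_sg e.
  by rewrite addn0 in Pw ew; exists w.
- move=> [w hw e].
  have := @zigzag_coboundary_left C (nat -> N) P (fun l => @is_col N l)
    d DE DN eta PB dB DB Pd Peta dD etaD deta dd exD i 0 (sg x) y w z.
  rewrite addn0 => /(_ hw e)[u [Pu Du du]].
  have [eu hu] := sg_P Pu; exists (u 0%N); split=> //.
    by apply/D_sg; rewrite -eu.
  by apply: sg_inj; rewrite -d_sg -eu.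
Qed.

(** Naturality of balancing: [f] is linear over A, so it commutes with the matrices of F, and [phi]
    carries each stage of a staircase to a stage of another. *)
Lemma ext_zigzag_map (f : {linear N -> N}) (phi : forall i, {linear E i -> E i}) i
    (x : E i) (y : nat -> N) :
  extends_to f phi -> homogeneous 0 f -> ext_zigzag x y ->
  ext_zigzag (phi i x) (fun a => f (y a)).
Proof.
move=> [phi_deg phi_eta phi_d] f_deg.
have gen j l (u : C j) : zigzag P d DE eta l u y ->
    zigzag P d DE eta l (fun a => phi j (u a) : E j) (fun a => f (y a)).
  elim: j l u => [|j IH] l u /=.
    by move=> ->; apply/funext => a; rewrite /eta phi_eta.
  move=> [v [[hv ov] -> z]]; exists (fun a => phi j (v a)); split.
  - split=> a; last by move=> na; rewrite ov // linear0.
    by rewrite /ofdeg -[X in gcomp _ X]addr0 -phi_deg hv.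
  - by apply/funext => a; rewrite /d phi_d.
  - by rewrite /DE cmul_map; apply: IH.
move=> /gen; congr (zigzag _ _ _ _ _ _ _).
by apply/funext => -[|a]; rewrite /sg //= linear0.
Qed.

Lemma ext_cyc_col_zero i : ext_cyc_zero (fr_ideal F) i t <-> col_zero N i.
Proof.
split=> [h y hy Dy|h x hx dx kx].
  have [x [z hx dx kx]] := ext_zigzag_left hy Dy.
  exact/(ext_zigzag_cobound z)/h.
have [y [z hy Dy]] := ext_zigzag_right hx dx kx.
exact/(ext_zigzag_cobound z)/h.
Qed.

End Balancing.

End ExtOfCyclicModules.

(** * Minimal free resolutions *)

Section FinitelyGeneratedRows.
Context (B : pzRingType).
Implicit Types (v c : nat -> B) (G : nat -> nat -> B).

Definition row_span m G v : Prop := exists c, v = rmul m c G.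

Definition row_app m G G' (i : nat) : nat -> B :=
  if (i < m)%N then G i else G' (i - m)%N.

Lemma rmul_row_app m m' c c' G G' :
  rmul (m + m') (fun i => if (i < m)%N then c i else c' (i - m)%N) (row_app m G G') =
  rmul m c G + rmul m' c' G'.
Proof.
apply/funext => b; rewrite /rmul big_split_ord; congr (_ + _).
  by apply: eq_bigr => i _ /=; rewrite /row_app ltn_ord.
by apply: eq_bigr => i _ /=; rewrite /row_app ltnNge leq_addr /= addKn.
Qed.

Lemma row_span_app m m' G G' v v' : row_span m G v -> row_span m' G' v' ->
  row_span (m + m') (row_app m G G') (v + v').
Proof. by move=> [c ->] [c' ->]; rewrite -rmul_row_app; eexists. Qed.

Lemma rmul_row m G i : (i < m)%N -> rmul m (fun j => (j == i)%:R) G = G i.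
Proof.
move=> im; apply/funext => b; rewrite /rmul (bigD1 (Ordinal im)) //= eqxx mul1r.
rewrite big1 ?addr0 // => j /negbTE ji.
by rewrite -[nat_of_ord j == i]/(j == Ordinal im) ji mul0r.
Qed.

Lemma row_span_row m G i : (i < m)%N -> row_span m G (G i).
Proof. by move=> im; exists (fun j => (j == i)%:R); rewrite rmul_row. Qed.

(** Induction on [n]. The last coordinates of members of [S] form a left ideal; lifts of its
    generators reduce any member to one whose last coordinate is zero, where one coordinate fewer
    remains. *)
Lemma noetherian_rows (noeB : left_noetherian B) n (S : (nat -> B) -> Prop) :
  S 0 -> (forall u v, S u -> S v -> S (u + v)) ->
  (forall (c : B) v, S v -> S (fun b => c * v b)) ->
  (forall v b, S v -> (n <= b)%N -> v b = 0) ->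
  exists m G, (forall i, (i < m)%N -> S (G i)) /\ forall v, S v -> row_span m G v.
Proof.
elim: n S => [|n IH] S S0 SD SZ Sout.
  exists 0%N, (fun _ => 0); split=> // v Sv; exists 0.
  by apply/funext => b; rewrite (Sout v b Sv) // /rmul big_ord0.
have [|||s hs] := noeB (fun x => exists2 v, S v & x = v n).
- by exists 0.
- by move=> x y [u Su ->] [v Sv ->]; exists (u + v); [apply: SD|].
- by move=> c x [u Su ->]; exists (fun b => c * u b); [apply: SZ|].
have /choice[g hg] : forall i, exists v, (i < size s)%N -> S v /\ s`_i = v n.
  move=> i; have [is_|] := ltnP i (size s); last by exists 0.
  have [|v Sv e] := (hs s`_i).2; last by exists v.
  exists (fun j => (j == i)%:R); rewrite (bigD1 (Ordinal is_)) //= eqxx mul1r.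
  rewrite big1 ?addr0 // => j /negbTE ji.
  by rewrite -[nat_of_ord j == i]/(j == Ordinal is_) ji mul0r.
have [||||m [G [SG hG]]] := IH (fun v => S v /\ v n = 0).
- by [].
- move=> u v [Su u0] [Sv v0]; split; first exact: SD.
  by rewrite -[LHS]/(_ + _) u0 v0 addr0.
- by move=> c v [Sv v0]; split; [apply: SZ|rewrite v0 mulr0].
- move=> v b [Sv v0]; rewrite leq_eqVlt => /orP[/eqP <- //|]; exact: Sout.
exists (size s + m)%N, (row_app (size s) g G); split.
  move=> i im; rewrite /row_app; have [/hg[]//|si] := ltnP i (size s).
  by case: (SG (i - size s)%N) => //; lia.
move=> v Sv; have [c hc] := (hs (v n)).1 (ex_intro2 _ _ v Sv erefl).
have Sr : S (rmul (size s) c g).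
  have gen j : (j <= size s)%N -> S (rmul j c g).
    elim: j => [_|j IHj js].
      by rewrite (_ : rmul 0 c g = 0) //; apply/funext => b; rewrite /rmul big_ord0.
    rewrite (_ : rmul j.+1 c g = rmul j c g + (fun b => c j * g j b)).
      by apply: SD; [apply: IHj; lia|apply: SZ; have [] := hg j js].
    by apply/funext => b; rewrite /rmul big_ord_recr.
  exact: gen.
rewrite -[v](addrNK (rmul (size s) c g)) addrC; apply: row_span_app; first by exists c.
apply: hG; split.
  rewrite -[X in S (_ + X)](_ : (fun b => (-1) * rmul (size s) c g b) = _).
    by apply: SD => //; apply: SZ.
  by apply/funext => b; rewrite mulN1r.
rewrite -[LHS]/(v n - _) hc /rmul -sumrB big1 // => i _.
by have [_ ->] := hg i (ltn_ord i); rewrite subrr.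
Qed.

Context (g : grading B).
Hypothesis gM : forall i j a b, ofdeg g i a -> ofdeg g j b -> ofdeg g (i + j) (a * b).

Lemma graded_gcompMr i j a b : ofdeg g j b -> gcomp g i (a * b) = gcomp g (i - j) a * b.
Proof.
move=> hb; have [s _ ->] := gcomp_sum g a.
rewrite mulr_suml !gcomp_bigsum mulr_suml; apply: eq_bigr => l _.
rewrite (gcomp_ofdeg i (gM (ofdeg_gcomp g l a) hb)) gcomp_gcomp subr_eq.
by case: ifP => // _; rewrite mul0r.
Qed.

Definition row_comp (w : nat -> int) (t : int) v : nat -> B :=
  fun b => gcomp g (t - w b) (v b).

Lemma row_comp_sum n w v : (forall b, (n <= b)%N -> v b = 0) ->
  exists ts : seq int, v = fun b => \sum_(t <- ts) row_comp w t v b.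
Proof.
move=> vout; have [ts _ h] := gcomp_sum_family g (fun b : 'I_n => v b) w.
exists ts; apply/funext => b; have [bn|nb] := ltnP b n; first exact: (h (Ordinal bn)).
by rewrite vout // big1 // => t _; rewrite /row_comp vout // gcomp0.
Qed.

Lemma homogeneous_rmul m w e t c G :
  (forall i b, ofdeg g (e i - w b) (G i b)) ->
  row_comp w t (rmul m c G) = rmul m (row_comp e t c) G.
Proof.
move=> hG; apply/funext => b; rewrite /row_comp /rmul gcomp_bigsum.
apply: eq_bigr => i _; rewrite (graded_gcompMr _ _ (hG i b)).
congr (gcomp _ _ _ * _); ring.
Qed.

(** The components of finitely many generators generate and stay in [S]. As [B] is a bare graded
    ring, right modules are covered through the opposite ring. *)
Lemma noetherian_homogeneous (noeB : left_noetherian B) n w (S : (nat -> B) -> Prop) :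
  S 0 -> (forall u v, S u -> S v -> S (u + v)) ->
  (forall (c : B) v, S v -> S (fun b => c * v b)) ->
  (forall v b, S v -> (n <= b)%N -> v b = 0) ->
  (forall t v, S v -> S (row_comp w t v)) ->
  exists m e G, [/\ forall i, (i < m)%N -> S (G i),
    forall i b, ofdeg g (e i - w b) (G i b) & forall v, S v -> row_span m G v].
Proof.
move=> S0 SD SZ Sout Sc; have [m0 [G0 [SG0 hG0]]] := noetherian_rows noeB S0 SD SZ Sout.
suff [m [e [G [SG degG hG]]]] : exists m e G, [/\ forall i, (i < m)%N -> S (G i),
    forall i b, ofdeg g (e i - w b) (G i b) & forall c, row_span m G (rmul m0 c G0)].
  by exists m, e, G; split=> // v /hG0[c ->].
elim: m0 SG0 {hG0} => [|m0 IH] SG0.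
  exists 0%N, (fun _ => 0), (fun _ _ => 0); split=> // [i b|c]; first exact: ofdeg0.
  by exists 0; apply/funext => b; rewrite /rmul !big_ord0.
have [i im|m [e [G [SG degG hG]]]] := IH; first by apply: SG0; lia.
have Sm : S (G0 m0) by apply: SG0.
have [ts hts] := row_comp_sum w (fun b => Sout _ b Sm).
pose H i := if (i < size ts)%N then row_comp w ts`_i (G0 m0) else 0.
exists (m + size ts)%N, (fun i => if (i < m)%N then e i else ts`_(i - m)), (row_app m G H).
split.
- move=> i im; rewrite /row_app; have [/SG//|mi] := ltnP i m.
  by rewrite /H ifT; [apply: Sc|lia].
- move=> i b; rewrite /row_app; case: ifP => // _; rewrite /H.
  by case: ifP => _; [apply: ofdeg_gcomp|apply: ofdeg0].
move=> c; rewrite (_ : rmul m0.+1 c G0 = rmul m0 c G0 + (fun b => c m0 * G0 m0 b)); last first.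
  by apply/funext => b; rewrite /rmul big_ord_recr.
apply: row_span_app; first exact: hG.
exists (fun=> c m0); apply/funext => b; rewrite /rmul -mulr_sumr; congr (_ * _).
by rewrite {1}hts (big_nth 0) big_mkord; apply: eq_bigr => i _; rewrite /H ltn_ord.
Qed.

End FinitelyGeneratedRows.

Section MinimalResolution.
Context (k : fieldType) (A : algType k) (gA : connected_grading A).
Hypothesis noeA : left_noetherian A.

Let gM i j (a b : A) : ofdeg gA i a -> ofdeg gA j b -> ofdeg gA (i + j) (a * b).
Proof. exact: agr_mul. Qed.

(** A homogeneous generating family of least size: a relation with a coefficient of nonzero
    augmentation would express one generator through the others. Rows from [m] on are set to
    zero. *)
Lemma minimal_generators n w (S : (nat -> A) -> Prop) :
  S 0 -> (forall u v, S u -> S v -> S (u + v)) ->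
  (forall (c : A) v, S v -> S (fun b => c * v b)) ->
  (forall v b, S v -> (n <= b)%N -> v b = 0) ->
  (forall t v, S v -> S (row_comp gA w t v)) ->
  exists m e G, [/\ forall i, S (G i), forall i, (m <= i)%N -> G i = 0,
    forall i b, ofdeg gA (e i - w b) (G i b), forall v, S v -> row_span m G v &
    forall c, rmul m c G = 0 -> forall i, (i < m)%N -> aug gA (c i) = 0].
Proof.
move=> S0 SD SZ Sout Sc.
pose gen m := exists e G, [/\ forall i, (i < m)%N -> S (G i),
    forall i b, ofdeg gA (e i - w b) (G i b) & forall v, S v -> row_span m G v].
have exm : exists m, `[< gen m >].
  have [m [e [G h]]] := noetherian_homogeneous noeA S0 SD SZ Sout Sc.
  by exists m; apply/asboolP; exists e, G.
have [m /asboolP[e [G [SG degG hG]]] min_m] := ex_minnP exm.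
pose G' i := if (i < m)%N then G i else 0.
have rG c : rmul m c G' = rmul m c G.
  by apply/funext => b; apply: eq_bigr => i _; rewrite /G' ltn_ord.
exists m, e, G'; split.
- by move=> i; rewrite /G'; case: ifP => // /SG.
- by move=> i; rewrite /G' leqNgt => /negbTE ->.
- by move=> i b; rewrite /G'; case: ifP => _; [apply: degG|apply: ofdeg0].
- by move=> v /hG[c ->]; exists c; rewrite rG.
move=> c; rewrite rG => rc0 j jm; apply/eqP; case: eqP => // /eqP cj.
suff /asboolP/min_m : gen m.-1 by lia.
case: m {exm min_m G' rG} SG hG rc0 jm => // m SG hG rc0 jm.
(* In degree [e j] the coefficient at j is the nonzero scalar [aug gA (c j)], so the relation can be
   solved for [G j]. *)
pose c' := row_comp gA e (e j) c.
have c'0 : rmul m.+1 c' G = 0.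
  rewrite -(homogeneous_rmul gM m.+1 (e j) c degG) rc0.
  by apply/funext => b; rewrite /row_comp gcomp0.
exists (fun i => e (bump j i)), (fun i => G (bump j i)); split=> [i im|i b|v /hG[d ->]] //=.
  by apply: SG; rewrite /bump; case: (j <= i)%N; lia.
set J := Ordinal jm; set u := aug gA (c j).
have split_sum f b : rmul m.+1 f G b =
    f j * G j b + \sum_(i < m) f (bump j i) * G (bump j i) b.
  by rewrite /rmul (bigD1_ord J).
have Gj b : G j b = \sum_(i < m) (- (u^-1 *: c' (bump j i))) * G (bump j i) b.
  have := congr1 (fun f => f b) c'0; rewrite split_sum.
  rewrite {1}/c' /row_comp subrr gcomp_aug -/u mulr_algl => /(congr1 (fun x => u^-1 *: x)).
  rewrite -[RHS]/(_ *: 0) scaler0 scalerDr scalerA mulVf // scale1r => /eqP.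
  rewrite addr_eq0 => /eqP ->; rewrite scaler_sumr -sumrN.
  by apply: eq_bigr => i _; rewrite mulNr scalerAl.
exists (fun i => d (bump j i) - d j * (u^-1 *: c' (bump j i))).
apply/funext => b; rewrite split_sum {1}Gj mulr_sumr -big_split /=.
by apply: eq_bigr => i _; rewrite mulrA -mulrDl mulrN addrC.
Qed.

(** One differential with the ranks and degrees of its two terms; a resolution arises by iterating a
    choice of [res_step_next]. *)
Record res_step := ResStep {
  rs_n0 : nat; rs_w0 : nat -> int; rs_n1 : nat; rs_w1 : nat -> int;
  rs_d : nat -> nat -> A;
  rs_out : forall a b, (rs_n1 <= a)%N || (rs_n0 <= b)%N -> rs_d a b = 0;
  rs_deg : forall a b, ofdeg gA (rs_w1 a - rs_w0 b) (rs_d a b)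
}.

Definition res_step_next (s s' : res_step) : Prop :=
  [/\ rs_n0 s' = rs_n1 s, rs_w0 s' = rs_w1 s,
    forall a, rmul (rs_n1 s) (rs_d s' a) (rs_d s) = 0,
    forall v, (forall a, (rs_n1 s <= a)%N -> v a = 0) ->
      rmul (rs_n1 s) v (rs_d s) = 0 -> row_span (rs_n1 s') (rs_d s') v &
    forall c, rmul (rs_n1 s') c (rs_d s') = 0 ->
      forall i, (i < rs_n1 s')%N -> aug gA (c i) = 0].

Lemma res_step_exists s : exists s', res_step_next s s'.
Proof.
case: s => n0 w0 n1 w1 D Dout Ddeg.
pose S (v : nat -> A) := (forall a, (n1 <= a)%N -> v a = 0) /\ rmul n1 v D = 0.
have [|||||m [e [G [SG Gout Gdeg Gspan Gmin]]]] := @minimal_generators n1 w1 S.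
- by split=> //; apply: rmul0.
- move=> u v [u0 uD] [v0 vD]; split; last by rewrite rmulD uD vD addr0.
  by move=> a na; rewrite -[LHS]/(_ + _) u0 ?v0 ?addr0.
- move=> c v [v0 vD]; split; first by move=> a na; rewrite v0 ?mulr0.
  by rewrite rmulZ vD; apply/funext => b; rewrite mulr0.
- by move=> v b [v0 _]; apply: v0.
- move=> t v [v0 vD]; split; first by move=> a na; rewrite /row_comp v0 ?gcomp0.
  rewrite -(homogeneous_rmul gM _ _ _ Ddeg) vD.
  by apply/funext => b; rewrite /row_comp gcomp0.
have Gout' a b : (m <= a)%N || (n1 <= b)%N -> G a b = 0.
  by case/orP=> [/Gout -> //|nb]; have [->] := SG a.
exists (ResStep Gout' Gdeg); split=> //= [a|v v0 vD]; first by have [] := SG a.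
exact: Gspan.
Qed.

(** The rows of each differential after the first are relations between a minimal family of
    generators, whence entries of augmentation zero. The first differential is exempt: its rows
    generate J, which need not lie in A_+. *)
Theorem minimal_resolution (J : A -> Prop) :
  @graded_submod _ _ _ (regular_gmod gA) J ->
  exists F : free_res gA, (forall a, fr_ideal F a <-> J a) /\
    forall l a b, aug gA (fr_d F l.+1 a b) = 0.
Proof.
move=> hJ; pose S (v : nat -> A) := J (v 0%N) /\ forall a, (1 <= a)%N -> v a = 0.
have [|||||m [e [G [SG Gout Gdeg Gspan Gmin]]]] := @minimal_generators 1 (fun=> 0) S.
- by split=> //; apply: (gsub0 hJ).
- move=> u v [uJ u0] [vJ v0]; split; first exact: (gsubD hJ).
  by move=> a na; rewrite -[LHS]/(_ + _) u0 ?v0 ?addr0.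
- move=> c v [vJ v0]; split; first exact: (gsubZ hJ).
  by move=> a na; rewrite v0 ?mulr0.
- by move=> v b [_ v0]; apply: v0.
- move=> t v [vJ v0]; split; first exact: (gsub_comp hJ).
  by move=> a na; rewrite /row_comp v0 ?gcomp0.
have Gout' a b : (m <= a)%N || (1 <= b)%N -> G a b = 0.
  by case/orP=> [/Gout -> //|nb]; have [_ ->] := SG a.
have [nxt hnxt] := choice res_step_exists.
pose s l := iter l nxt (ResStep Gout' Gdeg).
have hs l : res_step_next (s l) (s l.+1) by apply: hnxt.
pose n l := rs_n0 (s l); pose w l := rs_w0 (s l); pose D l := rs_d (s l).
have n1 l : n l.+1 = rs_n1 (s l) by have [] := hs l.
have w1 l : w l.+1 = rs_w1 (s l) by have [] := hs l.
have Dout l a b : (n l.+1 <= a)%N || (n l <= b)%N -> D l a b = 0.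
  by rewrite n1; apply: rs_out.
have Ddeg l a b : ofdeg gA (w l.+1 a - w l b) (D l a b) by rewrite w1; apply: rs_deg.
have DD l a : rmul (n l.+1) (D l.+1 a) (D l) = 0.
  by rewrite n1; have [_ _ h _ _] := hs l; apply: h.
have Dex l t v : vec gA (n l.+1) (fun a => t - w l.+1 a) v ->
    rmul (n l.+1) v (D l) = 0 ->
    exists2 u, vec gA (n l.+2) (fun a => t - w l.+2 a) u
             & v = rmul (n l.+2) u (D l.+1).
  move=> [hv ov]; rewrite n1 => vD; have [_ _ _ ex _] := hs l.
  have [|c ec] := ex v _ vD; first by move=> a; rewrite -n1; apply: ov.
  rewrite -/(D l.+1) -n1 in ec.
  (* The coefficients are cut to their component of degree t, and to zero beyond the rank. *)
  pose c' a := if (a < n l.+2)%N then row_comp gA (w l.+2) t c a else 0.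
  exists c'; first by apply: vec_cut => a _; apply: ofdeg_gcomp.
  have -> : v = row_comp gA (w l.+1) t v by apply/funext => a; rewrite /row_comp hv.
  rewrite ec (homogeneous_rmul gM _ _ _ (Ddeg l.+1)).
  by apply/funext => b; apply: eq_bigr => i _; rewrite /c' ltn_ord.
exists (@FreeRes _ _ gA n w D erefl erefl Dout Ddeg DD Dex); split=> [a|l a b] /=.
  split=> [[u ->]|Ja].
    suff [] : S (rmul (n 1%N) u (D 0%N)) by [].
    split; last by move=> b b1; rewrite /rmul big1 // => i _; rewrite Dout ?b1 ?orbT ?mulr0.
    apply: (@gsub_sum _ _ _ (regular_gmod gA) J hJ) => i _.
    by apply: (gsubZ hJ); have [] := SG i.
  have [|c ec] := Gspan (fun b => if b == 0%N then a else 0); first by split=> // -[].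
  exists c; rewrite -[RHS]/(rmul (n 1%N) c (D 0%N) 0%N) n1.
  by have /= := congr1 (fun f => f 0%N) ec.
have [bn|nb] := ltnP b (n l.+1); last by rewrite Dout ?nb ?orbT ?aug0.
case: l bn => [|l] bn.
  have := DD 0%N a; rewrite n1 => e0; rewrite n1 in bn; exact: (Gmin (D 1%N a) e0 b bn).
have [_ _ _ _ mn] := hs l; rewrite n1 in bn; apply: mn bn.
by rewrite -n1; apply: DD.
Qed.

End MinimalResolution.

(** * Ext of modules bounded in degree *)

Section GradedLeftIdeals.
Context (k : fieldType) (A : algType k) (gA : connected_grading A).

Definition graded_ideal (J : A -> Prop) : Prop :=
  @graded_submod _ _ _ (regular_gmod gA) J.

Definition positive (a : A) : Prop := aug gA a = 0.

Definition deg_ge (s : int) (a : A) : Prop := forall i, i < s -> gcomp gA i a = 0.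

Lemma graded_ideal_positive : graded_ideal positive.
Proof.
split; rewrite /positive.
- exact: aug0.
- by move=> x y; rewrite augD => -> ->; rewrite addr0.
- by move=> a x hx; rewrite augM hx mulr0.
- move=> i x hx; have [->|/eqP i0] := eqVneq i 0; first by rewrite /= gcomp_aug aug_scalar.
  exact: (aug_ofdeg (ofdeg_gcomp gA i x)).
Qed.

Lemma deg_ge_mul s t a b : deg_ge s a -> deg_ge t b -> deg_ge (s + t) (a * b).
Proof.
move=> ha hb i ist.
have [sa _ ->] := gcomp_sum gA a; have [sb _ ->] := gcomp_sum gA b.
rewrite mulr_suml gcomp_bigsum big1 // => l _.
rewrite mulr_sumr gcomp_bigsum big1 // => m _.
have [ls|sl] := ltrP l s; first by rewrite (ha _ ls) mul0r gcomp0.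
have [mt|tm] := ltrP m t; first by rewrite (hb _ mt) mulr0 gcomp0.
rewrite (gcomp_ofdeg i (ofdegM (ofdeg_gcomp gA l a) (ofdeg_gcomp gA m b))).
by case: eqP => // e; lia.
Qed.

Lemma deg_ge0 a : deg_ge 0 a.
Proof. by move=> i; apply: agr_ge0. Qed.

Lemma deg_ge_positive a : deg_ge 1 a <-> positive a.
Proof.
split=> [h|h i i1]; last by apply: aug_eq0_gcomp => //; lia.
by rewrite /positive -(aug_scalar gA (aug gA a)) -gcomp_aug h ?aug0.
Qed.

Lemma graded_ideal_deg_ge s : graded_ideal (deg_ge s).
Proof.
split.
- by move=> i _; apply: gcomp0.
- by move=> x y hx hy i si; rewrite gcompD hx ?hy ?addr0.
- move=> a x hx; rewrite -[s]add0r; apply: deg_ge_mul => //; exact: deg_ge0.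
- by move=> i x hx j js; rewrite /= gcomp_gcomp; case: eqP => // <-; apply: hx.
Qed.

Lemma deg_ge_prod (s : seq A) : (forall a, a \in s -> positive a) ->
  deg_ge (size s)%:Z (\prod_(a <- s) a).
Proof.
elim: s => [_|a s IH h] /=; first by rewrite big_nil; apply: deg_ge0.
rewrite big_cons -addn1 addnC PoszD; apply: deg_ge_mul.
  by apply/deg_ge_positive/h; rewrite mem_head.
by apply: IH => b bs; apply: h; rewrite in_cons bs orbT.
Qed.

Lemma ofdeg_deg_ge i s a : ofdeg gA i a -> s <= i -> deg_ge s a.
Proof.
by move=> ha si j js; rewrite (gcomp_ofdeg j ha); case: eqP => // e; lia.
Qed.

End GradedLeftIdeals.

Section Devissage.
Context (k : fieldType) (A : algType k) (gA : connected_grading A).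
Context (N : gmod gA) (E : injective_resolution N).
Local Notation gideal := (graded_ideal gA).
Local Notation pos := (@positive k A gA).

Lemma cobound_ofdeg J i t (x : E i) : cobound J t x -> ofdeg (mgr (E i)) t x.
Proof.
case: i x => [|i] x; first by move=> ->; apply: ofdeg0.
by move=> [y [hy _ ->]]; apply: ir_d_deg0.
Qed.

Lemma cobound_d J i t (x : E i) : cobound J t x -> ir_d E i x = 0.
Proof.
case: i x => [|i] x; first by move=> ->; apply: linear0.
by move=> [y [_ _ ->]]; apply: ir_dd.
Qed.

Lemma cobound0 J i t : cobound J t (0 : E i).
Proof.
case: i => [|i] //; exists 0; split; [exact: ofdeg0| |by rewrite linear0].
by move=> a _; rewrite scaler0.
Qed.

Lemma coboundD J i t (x y : E i) : cobound J t x -> cobound J t y -> cobound J t (x + y).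
Proof.
case: i x y => [|i] x y; first by move=> -> ->; apply: addr0.
move=> [x' [hx kx ->]] [y' [hy ky ->]]; exists (x' + y'); split.
- exact: ofdegD.
- exact: killedD.
- by rewrite linearD.
Qed.

Lemma cobound_sub (J J' : A -> Prop) i t (x : E i) : (forall a, J' a -> J a) ->
  cobound J t x -> cobound J' t x.
Proof.
move=> J'J; case: i x => [|i] x // [y [hy ky ->]].
by exists y; split=> // a /J'J; apply: ky.
Qed.

(* Ext^i(I/J, N)_t = 0: by injectivity, maps I/J -> E i of degree t extend to
   A/J, hence are given by elements of degree t killed by J. *)
Definition ext_sub_zero (I J : A -> Prop) (i : nat) (t : int) : Prop :=
  forall z : E i, ofdeg (mgr (E i)) t z -> killed J z -> killed I (ir_d E i z) ->
  exists2 z', cobound J t z' & killed I (z - z').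

(** Middle term of the long exact sequence of 0 -> J/K -> I/K -> I/J -> 0: one coboundary makes the
    map vanish on J, a second one on I. *)
Lemma ext_sub_zero_trans I J K i t : (forall a, K a -> J a) -> (forall a, J a -> I a) ->
  ext_sub_zero I J i t -> ext_sub_zero J K i t -> ext_sub_zero I K i t.
Proof.
move=> KJ JI hIJ hJK z hz kz kdz.
have [|z1 cz1 k1] := hJK z hz kz; first by move=> a /JI; apply: kdz.
have [|||z2 cz2 k2] := hIJ (z - z1).
- by apply: ofdegB => //; apply: cobound_ofdeg cz1.
- by [].
- by rewrite linearB (cobound_d cz1) subr0.
exists (z1 + z2); last by rewrite opprD addrA.
by apply: coboundD => //; apply: cobound_sub cz2.
Qed.

Lemma ext_sub_zero_eq I I' J i t : (forall a, I' a -> I a) -> (forall a, I a -> I' a) ->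
  ext_sub_zero I J i t -> ext_sub_zero I' J i t.
Proof.
move=> h1 h2 h z hz kz kdz; have [|z' c' k'] := h z hz kz.
  by move=> a /h2; apply: kdz.
by exists z' => // a /h1; apply: k'.
Qed.

Lemma ext_sub_zero_refl (I J : A -> Prop) i t : (forall a, I a -> J a) -> ext_sub_zero I J i t.
Proof.
by move=> IJ z hz kz _; exists 0; [apply: cobound0|rewrite subr0 => a /IJ; apply: kz].
Qed.

(** The sum J + k b. It is an ideal when A_+ b lies in J, and its quotient by J is then zero or a
    shift of k. *)
Definition adjoin_elt (J : A -> Prop) (b : A) (a : A) : Prop :=
  exists c : k, J (a - c *: b).

Lemma adjoin_comp J b s c i x : gideal J -> ofdeg gA s b -> J (x - c *: b) ->
  J (gcomp gA i x - (if i == s then c else 0) *: b).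
Proof.
move=> hJ hb hc; have := gsub_comp hJ i hc; rewrite /= gcompB -mulr_algl.
rewrite (gcompMl _ _ (ofdeg0_scalar gA c)) subr0 (gcomp_ofdeg _ hb) mulr_algl.
by case: ifP => _ //; rewrite scaler0 scale0r.
Qed.

Lemma adjoin_scale (J : A -> Prop) b c e a x y : gideal J -> (forall a, pos a -> J (a * b)) ->
  J (x - c *: b) -> J (y - e *: b) -> J (a * x + y - (aug gA a * c + e) *: b).
Proof.
move=> hJ kb hc he.
have -> : a * x + y - (aug gA a * c + e) *: b =
    (a * (x - c *: b) + (c *: (a - (aug gA a)%:A)) * b) + (y - e *: b).
  rewrite mulrBr -scalerAl mulrBl mulr_algl -scalerAr scalerBr scalerDl opprD.
  rewrite [LHS]addrACA; congr (_ + _).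
  by rewrite addrA subrK scalerA [c * _]mulrC.
apply: (gsubD hJ) => //; apply: (gsubD hJ); first exact: (gsubZ hJ).
by apply: kb; rewrite /positive augZ aug_subr mulr0.
Qed.

Lemma graded_ideal_adjoin J b s : gideal J -> ofdeg gA s b ->
  (forall a, pos a -> J (a * b)) -> gideal (adjoin_elt J b).
Proof.
move=> hJ hb kb; split.
- by exists 0; rewrite scale0r subrr; apply: (gsub0 hJ).
- move=> x y [c hc] [e he]; exists (aug gA 1 * c + e).
  by rewrite -{1}[x]mul1r; apply: adjoin_scale.
- move=> a x [c hc]; exists (aug gA a * c + 0); rewrite -[a *: x]addr0.
  by apply: adjoin_scale => //; rewrite scale0r subr0; apply: (gsub0 hJ).
- by move=> i x [c hc]; exists (if i == s then c else 0); apply: adjoin_comp.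
Qed.

(** The map from (J + k b) / J, a shifted copy of k, that takes b to [y0] extends to A / J by
    injectivity; [y] is the image of 1. *)
Lemma injective_adjoin (M : gmod gA) J b s t (y0 : M) :
  graded_injective M -> gideal J -> ofdeg gA s b ->
  (forall a, pos a -> J (a * b)) -> ~ J b ->
  ofdeg (mgr M) (t + s) y0 -> killed pos y0 ->
  exists y, [/\ ofdeg (mgr M) t y, killed J y & b *: y = y0].
Proof.
move=> injM hJ hb kb nJb hy0 ky0.
have uniq_c c c' x : J (x - c *: b) -> J (x - c' *: b) -> c = c'.
  move=> h h'; apply/eqP; rewrite -subr_eq0; case: eqP => // /eqP cc'.
  have /(gsubZ hJ ((c - c')^-1)%:A) : J ((c - c') *: b).
    have -> : (c - c') *: b = (x - c' *: b) - (x - c *: b).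
      by rewrite scalerBl opprB [RHS]addrC addrA subrK.
    exact: (gsubB hJ).
  by rewrite -[_ *: _]/(_ * _) mulr_algl scalerA mulVf // scale1r.
have /choice[c hc] : forall x, exists c, adjoin_elt J b x -> J (x - c *: b).
  by move=> x; have [[c h]|h] := pselect (adjoin_elt J b x); [exists c|exists 0].
have cE x e : J (x - e *: b) -> c x = e.
  by move=> h; apply: (uniq_c _ _ x) => //; apply: hc; exists e.
(* Rows of length one stand for A; [f] multiplies [y0] by the coefficient of b modulo J. *)
pose S (x : {ffun 'I_1 -> A^o}) := adjoin_elt J b (x ord0 : A).
pose f (x : {ffun 'I_1 -> A^o}) : M := (c (x ord0 : A))%:A *: y0.
have hI := graded_ideal_adjoin hJ hb kb.
have [|a x y Sx Sy|j x Sx|v hv ev] :=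
    @injective_extend_row _ _ _ _ injM 1 (fun=> t) S f.
- split; rewrite /S.
  + by rewrite ffunE; apply: (gsub0 hI).
  + by move=> x y Sx Sy; rewrite ffunE; apply: (gsubD hI).
  + by move=> a x Sx; rewrite ffunE; apply: (gsubZ hI).
  + by move=> j x Sx; rewrite free_gcompE; apply: (gsub_comp hI).
- rewrite /f !ffunE (cE _ _ (adjoin_scale a hJ kb (hc _ Sx) (hc _ Sy))).
  rewrite scalerDl scalerDl; congr (_ + _); apply/eqP.
  rewrite [X in _ == X]scalerA -subr_eq0 -scalerBl; apply/eqP/ky0.
  by rewrite /positive augB augM !aug_scalar subrr.
- rewrite /f free_gcompE (cE _ _ (adjoin_comp (j - t) hJ hb (hc _ Sx))).
  rewrite (gcomp_ofdeg _ (ofdegZk _ hy0)) subr_eq [s + t]addrC.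
  by case: ifP => // _; rewrite scale0r scale0r.
have yE x : adjoin_elt J b x -> (c x)%:A *: y0 = x *: v ord0.
  move=> Ix; have := ev [ffun=> x : A^o]; rewrite /S /f ffunE big_ord1 ffunE.
  exact.
have cb1 : J (b - 1 *: b) by rewrite scale1r subrr; apply: (gsub0 hJ).
exists (v ord0); split=> // [a Ja|].
  rewrite -yE; first by rewrite (cE _ 0) ?scale0r ?scale0r ?subr0.
  by exists 0; rewrite scale0r subr0.
by rewrite -yE ?(cE _ _ cb1) ?scale1r ?scale1r //; exists 1.
Qed.

(** For b outside J the quotient is k placed in degree s, which explains the shift to [t + s]; for b
    in J it is zero. *)
Lemma ext_sub_zero_adjoin J b s i t : gideal J -> ofdeg gA s b ->
  (forall a, pos a -> J (a * b)) -> ext_cyc_zero E pos i (t + s) ->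
  ext_sub_zero (adjoin_elt J b) J i t.
Proof.
move=> hJ hb kb hE z hz kz kdz.
have [Jb|nJb] := pselect (J b).
  apply: (@ext_sub_zero_refl (adjoin_elt J b)) hz kz kdz => a [c hc].
  rewrite -[a](subrK (c *: b)); apply: (gsubD hJ) => //.
  by rewrite -mulr_algl; apply: (gsubZ hJ).
have Ib : adjoin_elt J b b by exists 1; rewrite scale1r subrr; apply: (gsub0 hJ).
have : cobound pos (t + s) (b *: z).
  apply: hE; first by apply: ofdegZ_eq hb hz _; rewrite addrC.
    by rewrite linearZ /= kdz ?scaler0.
  by move=> a pa; rewrite scalerA kz //; apply: kb.
(* On J + k b, an element killed by J is determined by its product with b, so only [b *: z] has to
   be matched. *)
suff lift z' : killed J z' -> b *: z' = b *: z -> killed (adjoin_elt J b) (z - z').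
  case: i z hz kz kdz hE lift => [|i] z hz kz kdz hE lift.
    move=> /= bz0; exists 0 => //; apply: lift; last by rewrite bz0 scaler0.
    by move=> a _; rewrite scaler0.
  move=> [y0 [hy0 ky0 bz]].
  have [y [hy ky by0]] := injective_adjoin (@ir_injective _ _ _ _ E i) hJ hb kb nJb hy0 ky0.
  exists (ir_d E i y); first by exists y.
  apply: lift; first by move=> a Ja; rewrite -linearZ ky ?linear0.
  by rewrite -linearZ by0 bz.
move=> kz' bz' a [c hc]; rewrite -[a](subrK (c *: b)) scalerDl.
rewrite (killedB kz kz' hc) add0r -mulr_algl -scalerA scalerBr bz' subrr.
exact: scaler0.
Qed.

Fixpoint adjoin_rows (J : A -> Prop) (G : nat -> A) (m : nat) : A -> Prop :=
  if m is m'.+1 then adjoin_elt (adjoin_rows J G m') (G m') else J.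

Lemma adjoin_rowsP J G m a :
  adjoin_rows J G m a <-> exists c : nat -> k, J (a - \sum_(i < m) c i *: G i).
Proof.
elim: m a => [|m IH] a /=.
  split=> [Ja|[c]]; last by rewrite big_ord0 subr0.
  by exists (fun=> 0); rewrite big_ord0 subr0.
split=> [[e /IH[c hc]]|[c]].
  exists (fun i => if i == m then e else c i).
  rewrite big_ord_recr /= eqxx [in X in J X](eq_bigr (fun i : 'I_m => c i *: G i)).
    by rewrite opprD addrA addrAC.
  by move=> i _; rewrite ltn_eqF.
rewrite big_ord_recr /= => hc; exists (c m); apply/IH; exists c.
by move: hc; rewrite opprD addrA addrAC.
Qed.

End Devissage.

(** * Devissage of quotients bounded in degree *)

Section NoetherianIdeals.
Context (k : fieldType) (A : algType k) (gA : connected_grading A).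
Hypothesis noeA : left_noetherian A.

Lemma ideal_generators J : graded_ideal gA J ->
  exists m e (G : nat -> A), [/\ forall i, (i < m)%N -> J (G i),
    forall i, ofdeg gA (e i) (G i) &
    forall x, J x -> exists c : nat -> A, x = \sum_(i < m) c i * G i].
Proof.
move=> hJ; pose S (v : nat -> A) := J (v 0%N) /\ forall a, (1 <= a)%N -> v a = 0.
have [|||||m [e [G [SG Gdeg Gspan]]]] := @noetherian_homogeneous _ (agr gA) noeA 1 (fun=> 0) S.
- by split=> //; apply: (gsub0 hJ).
- move=> u v [uJ u0] [vJ v0]; split; first exact: (gsubD hJ).
  by move=> a na; rewrite -[LHS]/(_ + _) u0 ?v0 ?addr0.
- move=> c v [vJ v0]; split; first exact: (gsubZ hJ).
  by move=> a na; rewrite v0 ?mulr0.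
- by move=> v b [_ v0]; apply: v0.
- move=> t v [vJ v0]; split; first exact: (gsub_comp hJ).
  by move=> a na; rewrite /row_comp v0 ?gcomp0.
exists m, e, (fun i => G i 0%N); split=> [i /SG[]//|i|x Jx].
  by have := Gdeg i 0%N; rewrite subr0.
have [|c ec] := Gspan (fun b => if b == 0%N then x else 0); first by split=> // -[].
by exists c; have /= := congr1 (fun f => f 0%N) ec.
Qed.

(** In degree s only the generators of degree s contribute, each through the augmentation of its
    coefficient: those of higher degree start later, and those of lower degree are zero. *)
Lemma ideal_degree_part J s : graded_ideal gA J -> (forall x, J x -> deg_ge gA s x) ->
  exists m (H : nat -> A), [/\ forall i, J (H i), forall i, ofdeg gA s (H i) &
    forall x, J x -> exists c : nat -> k, deg_ge gA (s + 1) (x - \sum_(i < m) c i *: H i)].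
Proof.
move=> hJ Js; have [m [e [G [JG Gdeg Gspan]]]] := ideal_generators hJ.
pose H i := if (i < m)%N && (e i == s) then G i else 0.
have Hs i : ofdeg gA s (H i).
  by rewrite /H; case: ifP => [/andP[_ /eqP <-]|_]; [apply: Gdeg|apply: ofdeg0].
exists m, H; split=> // [i|x Jx].
  by rewrite /H; case: ifP => [/andP[/JG]|_] //; apply: (gsub0 hJ).
have [c ec] := Gspan x Jx; exists (fun i => aug gA (c i)) => j js.
have [ltjs|gejs] := ltrP j s.
  rewrite gcompB (Js x Jx j ltjs) sub0r gcomp_bigsum big1 ?oppr0 // => i _.
  rewrite -mulr_algl (gcompMr _ _ (Hs i)) (gcomp_ofdeg _ (ofdeg0_scalar gA _)).
  by case: eqP => [e0|_]; [lia|rewrite mul0r].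
have {js gejs} -> : j = s by lia.
rewrite gcompB ec !gcomp_bigsum -sumrB big1 // => i _.
rewrite (gcompMr _ _ (Gdeg i)) -mulr_algl (gcompMr _ _ (Hs i)).
rewrite subrr (gcomp_ofdeg _ (ofdeg0_scalar gA _)) eqxx /H ltn_ord /=.
case: eqP => [->|es]; first by rewrite subrr gcomp_aug subrr.
rewrite mulr0 subr0; have [es'|se] := ltrP (e i) s; last by rewrite agr_ge0 ?mul0r //; lia.
by have := Js _ (JG i (ltn_ord i)) _ es'; rewrite (Gdeg i) => ->; rewrite mulr0.
Qed.

Context (N : gmod gA) (E : injective_resolution N).
Local Notation gideal := (graded_ideal gA).
Local Notation pos := (@positive k A gA).

Lemma ext_sub_zero_adjoin_rows J s i t G m : gideal J -> (forall j, ofdeg gA s (G j)) ->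
  (forall j a, pos a -> J (a * G j)) -> ext_cyc_zero E pos i (t + s) ->
  ext_sub_zero E (adjoin_rows J G m) J i t.
Proof.
move=> hJ hG kG hE.
suff [_ []] : gideal (adjoin_rows J G m) /\
    (forall a, J a -> adjoin_rows J G m a) /\ ext_sub_zero E (adjoin_rows J G m) J i t by [].
elim: m => [|m [hI [JI IH]]] /=.
  by split=> //; split=> //; apply: ext_sub_zero_refl.
have kI a : pos a -> adjoin_rows J G m (a * G m) by move=> pa; apply/JI/kG.
have hI' := graded_ideal_adjoin hI (hG m) kI.
have II' a : adjoin_rows J G m a -> adjoin_elt (adjoin_rows J G m) (G m) a.
  by exists 0; rewrite scale0r subr0.
split=> //; split=> [a /JI/II' //|].
apply: ext_sub_zero_trans JI II' _ IH.
exact: ext_sub_zero_adjoin (hG m) kI hE.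
Qed.

(** Filtration of I / J by [F s], the sum of J and the part of I in degrees at least s: it starts at
    I, reaches J at s = n, and each layer is a finite sum of copies of k in degree s. *)
Theorem ext_sub_zero_bounded I J n i t : gideal I -> gideal J ->
  (forall a, J a -> I a) -> (forall a, deg_ge gA n%:Z a -> J a) ->
  (forall s : nat, ext_cyc_zero E pos i (t + s%:Z)) -> ext_sub_zero E I J i t.
Proof.
move=> hI hJ JI nJ hE.
pose F s a := exists b, [/\ I b, deg_ge gA s b & J (a - b)].
have hF s : gideal (F s).
  have hs := graded_ideal_deg_ge gA s.
  split.
  - by exists 0; rewrite subrr; split; [apply: (gsub0 hI)|apply: (gsub0 hs)|apply: (gsub0 hJ)].
  - move=> x y [b [Ib sb Jb]] [c [Ic sc Jc]]; exists (b + c); rewrite opprD addrACA.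
    by split; [apply: (gsubD hI)|apply: (gsubD hs)|apply: (gsubD hJ)].
  - move=> a x [b [Ib sb Jb]]; exists (a * b); rewrite -[a *: x]/(a * x) -mulrBr.
    by split; [apply: (gsubZ hI)|apply: (gsubZ hs)|apply: (gsubZ hJ)].
  - move=> j x [b [Ib sb Jb]]; exists (gcomp gA j b); rewrite /= -gcompB.
    by split; [apply: (gsub_comp hI)|apply: (gsub_comp hs)|apply: (gsub_comp hJ)].
have JF s a : J a -> F s a.
  move=> Ja; exists 0; rewrite subr0; split=> //; first exact: (gsub0 hI).
  exact: (gsub0 (graded_ideal_deg_ge gA s)).
have FS s a : F (s + 1) a -> F s a.
  by move=> [b [Ib sb Jb]]; exists b; split=> // j js; apply: sb; lia.
have step (s : nat) : ext_sub_zero E (F s%:Z) (F (s%:Z + 1)) i t.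
  have [||m [H [IH sH hH]]] := @ideal_degree_part (fun a => I a /\ deg_ge gA s%:Z a) s.
  - have hs := graded_ideal_deg_ge gA s%:Z; split.
    + by split; [apply: (gsub0 hI)|apply: (gsub0 hs)].
    + by move=> x y [Ix sx] [Iy sy]; split; [apply: (gsubD hI)|apply: (gsubD hs)].
    + by move=> a x [Ix sx]; split; [apply: (gsubZ hI)|apply: (gsubZ hs)].
    + by move=> j x [Ix sx]; split; [apply: (gsub_comp hI)|apply: (gsub_comp hs)].
  - by move=> x [].
  have kH j a : pos a -> F (s%:Z + 1) (a * H j).
    move=> pa; exists (a * H j); rewrite subrr; split; last exact: (gsub0 hJ).
      by apply: (gsubZ hI); have [] := IH j.
    by rewrite addrC; apply: deg_ge_mul; [apply/deg_ge_positive|have [] := IH j].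
  have := ext_sub_zero_adjoin_rows (m := m) (hF _) sH kH (hE s); apply: ext_sub_zero_eq.
    move=> a [b [Ib sb Jb]]; apply/adjoin_rowsP.
    have [c hc] := hH b (conj Ib sb); exists c, (b - \sum_(j < m) c j *: H j).
    split=> //; last by rewrite opprB addrA subrK.
    apply: (gsubB hI) => //; apply: (gsub_sum hI) => j _.
    by rewrite -mulr_algl; apply: (gsubZ hI); have [] := IH j.
  move=> a /adjoin_rowsP[c /FS[b [Ib sb Jb]]].
  exists (b + \sum_(j < m) c j *: H j); split.
  - apply: (gsubD hI) => //; apply: (gsub_sum hI) => j _.
    by rewrite -mulr_algl; apply: (gsubZ hI); have [] := IH j.
  - have hs := graded_ideal_deg_ge gA s%:Z.
    apply: (gsubD hs) => //; apply: (gsub_sum hs) => j _.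
    by rewrite -mulr_algl; apply: (gsubZ hs); have [] := IH j.
  - by rewrite opprD addrA addrAC.
have all (m s : nat) : (s + m)%N = n -> ext_sub_zero E (F s%:Z) J i t.
  elim: m s => [|m IH] s sm.
    apply: ext_sub_zero_refl => a [b [_ sb Jb]].
    rewrite -[a](subrK b); apply: (gsubD hJ) => //; apply: nJ.
    by rewrite -sm addn0.
  apply: ext_sub_zero_trans (JF (s%:Z + 1)) (FS s%:Z) (step s) _.
  by rewrite -[s%:Z + 1]/(Posz (s + 1)%N) addn1; apply: IH; lia.
have := all n 0%N (add0n n); apply: ext_sub_zero_eq => [a Ia|a [b [Ib _ Jb]]].
  by exists a; split=> //; [apply: deg_ge0|rewrite subrr; apply: (gsub0 hJ)].
by rewrite -[a](subrK b); apply: (gsubD hI) => //; apply: JI.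
Qed.

Lemma ext_cyc_zero_bounded J n i t : gideal J ->
  (forall a, deg_ge gA n%:Z a -> J a) ->
  (forall s : nat, ext_cyc_zero E pos i (t + s%:Z)) -> ext_cyc_zero E J i t.
Proof.
move=> hJ nJ hE x hx dx kx.
have [||z cz /(_ 1 I)] :=
  @ext_sub_zero_bounded (fun=> True) J n i t _ hJ (fun _ _ => I) nJ hE x hx kx.
- by [].
- by move=> a _; rewrite dx scaler0.
by rewrite scale1r => /subr0_eq ->.
Qed.

(** Injectivity of Ext^i(A / I, N) -> Ext^i(A / J, N): the kernel comes from Ext^(i-1)(I / J, N),
    which vanishes by devissage. *)
Lemma cobound_enlarge I J n i t x : gideal I -> gideal J ->
  (forall a, J a -> I a) -> (forall a, deg_ge gA n%:Z a -> J a) ->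
  (forall (j : nat) (s : nat), (j < i)%N -> ext_cyc_zero E pos j (t + s%:Z)) ->
  killed I x -> @cobound _ _ _ _ E J i t x -> cobound I t x.
Proof.
case: i x => [//|i] x hI hJ JI nJ hE kx [y [hy ky xy]].
have [||z cz kz] := @ext_sub_zero_bounded I J n i t hI hJ JI nJ _ y hy ky.
- by move=> s; apply: hE.
- by rewrite -xy.
exists (y - z); split=> //; last by rewrite linearB (cobound_d cz) subr0.
by apply: ofdegB => //; apply: cobound_ofdeg cz.
Qed.

End NoetherianIdeals.

(** * Length and top term of the minimal resolution *)

Section ProjectiveLifting.
Context (k : fieldType) (A : algType k) (gA : connected_grading A).

Lemma sub_corestrict (X Y : gmod gA) (S : Y -> Prop) (hS : graded_submod S)
    (f : {linear X -> Y}) : homogeneous 0 f -> (forall x, S (f x)) ->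
  exists2 f' : {linear X -> sub_gmod hS}, homogeneous 0 f' &
    forall x, submod_val (f' x) = f x.
Proof.
move=> hf Sf; have inS x : f x \in submod_pred hS by apply/asboolP.
pose f' (x : X) : sub_gmod hS := SubmodType (inS x).
have lf : linear f' by move=> a x y; apply: val_inj; rewrite /= linearP.
pose fL := GRing.isLinear.Build A X (sub_gmod hS) _ f' lf.
pose fl : {linear X -> sub_gmod hS} := HB.pack f' fL.
exists fl => // n x; apply: val_inj; exact: hf.
Qed.

(** After corestriction to its image [u] is surjective, so only the values of [f] have to be
    reached. *)
Lemma projective_lift (P : gmod gA) (X Y : gmod gA) (u : {linear X -> Y})
    (f : {linear P -> Y}) : graded_projective P -> homogeneous 0 u -> homogeneous 0 f ->
  (forall p, exists x, u x = f p) ->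
  exists2 g : {linear P -> X}, homogeneous 0 g & forall p, u (g p) = f p.
Proof.
move=> projP hu hf hex; pose S y := exists x, u x = y.
have hS : graded_submod S.
  split.
  - by exists 0; rewrite linear0.
  - by move=> _ _ [x <-] [y <-]; exists (x + y); rewrite linearD.
  - by move=> a _ [x <-]; exists (a *: x); rewrite linearZ.
  - by move=> i _ [x <-]; exists (gcomp (mgr X) i x); rewrite hu addr0.
have [|u' hu' uE] := sub_corestrict hS hu; first by move=> x; exists x.
have [|f' hf' fE] := sub_corestrict hS hf; first exact: hex.
have [y|g hg ug] := projP _ _ u' f' _ hu' hf'.
  have /asboolP[x ux] := submod_valP y; exists x; apply: val_inj.
  by rewrite /= uE.
by exists g => // p; rewrite -uE ug fE.
Qed.

End ProjectiveLifting.

Section FiniteResolution.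
Context (k : fieldType) (A : algType k) (gA : connected_grading A) (F : free_res gA).
Local Notation n := (fr_n F).
Local Notation w := (fr_w F).
Local Notation D := (fr_d F).

Let gM i j (a b : A) : ofdeg gA i a -> ofdeg gA j b -> ofdeg gA (i + j) (a * b).
Proof. exact: agr_mul. Qed.

Lemma fr_exact_ungraded l (v : nat -> A) : (forall a, (n l.+1 <= a)%N -> v a = 0) ->
  rmul (n l.+1) v (D l) = 0 -> exists u, v = rmul (n l.+2) u (D l.+1).
Proof.
move=> ov vD; have [ts ->] := row_comp_sum (agr gA) (w l.+1) ov.
elim: ts => [|t ts [u hu]].
  by exists 0; rewrite rmul0; apply/funext => b; rewrite big_nil.
have [||u' _ hu'] := @fr_exact _ _ _ F l t (row_comp gA (w l.+1) t v).
- split=> a; first exact: ofdeg_gcomp.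
  by move=> na; rewrite /row_comp ov ?gcomp0.
- rewrite -(homogeneous_rmul gM _ _ _ (fr_deg F l)) vD.
  by apply/funext => b; rewrite /row_comp gcomp0.
exists (u' + u); rewrite rmulD -hu' -hu.
by apply/funext => b; rewrite big_cons.
Qed.

Hypothesis F_triv : forall a, fr_ideal F a <-> positive gA a.
Hypothesis F_min : forall l a b, aug gA (D l a b) = 0.

Let Fr l : gmod gA := free_gmod gA (fun a : 'I_(n l) => w l a).

Let aug_rmul l (u : nat -> A) b m : aug gA (rmul m u (D l) b) = 0.
Proof. by rewrite /rmul aug_bigsum big1 // => i _; rewrite augM F_min mulr0. Qed.

Let free_d l : exists2 u : {linear Fr l.+1 -> Fr l}, homogeneous 0 u &
  forall x (b : 'I_(n l)), u x b = rmul (n l.+1) (fext (x : {ffun _ -> A})) (D l) b.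
Proof.
pose u (x : Fr l.+1) : Fr l :=
  [ffun b : 'I_(n l) => rmul (n l.+1) (fext (x : {ffun _ -> A})) (D l) b : A^o].
have lu : linear u.
  move=> a x y; apply/ffunP => b; rewrite !ffunE.
  rewrite -[RHS]/(a * rmul _ _ _ _ + rmul _ _ _ _) /rmul mulr_sumr -big_split /=.
  apply: eq_bigr => c _; by rewrite !fext_ord !ffunE mulrDl mulrA.
pose uL := GRing.isLinear.Build A (Fr l.+1) (Fr l) _ u lu.
pose ul : {linear Fr l.+1 -> Fr l} := HB.pack u uL.
exists ul => [t x|x b] /=; last by rewrite ffunE.
apply/ffunP => b; rewrite addr0 ffunE free_gcompE ffunE gcomp_rmul.
by apply: eq_bigr => a _; rewrite !fext_ord free_gcompE.
Qed.

Context (P : projective_resolution (trivial_gmod gA)).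

Let Z i : P i -> Prop :=
  match i return P i -> Prop with
  | 0 => fun p => pr_eps P p = 0
  | i'.+1 => fun p => pr_d P i' p = 0
  end.

Let Z_exact i (p : P i) : Z p -> exists q, p = pr_d P i q.
Proof.
case: i p => [|i] p h; first exact: (@pr_exact0 _ _ _ _ P p).1.
exact: (@pr_exactS _ _ _ _ P i p).1.
Qed.

Let Z_d i (p : P i.+1) : Z (pr_d P i p).
Proof.
case: i p => [|i] p; first by apply: (@pr_exact0 _ _ _ _ P _).2; exists p.
by apply: (@pr_exactS _ _ _ _ P i _).2; exists p.
Qed.

Let ZF i : (nat -> A) -> Prop :=
  match i with
  | 0 => fun v => aug gA (v 0%N) = 0
  | i'.+1 => fun v => rmul (n i'.+1) v (D i') = 0
  end.

Let ZF_exact i (v : nat -> A) : (forall a, (n i <= a)%N -> v a = 0) -> ZF i v ->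
  exists u, v = rmul (n i.+1) u (D i).
Proof.
case: i => [|i] ov /=; last exact: fr_exact_ungraded.
move=> /F_triv[u eu]; exists u; apply/funext => -[//|b].
by rewrite ov ?fr_n0 // /rmul big1 // => a _; rewrite fr_out ?fr_n0 ?orbT ?mulr0.
Qed.

(** Comparison maps [f] : F -> P and [g] : P -> F over the identity of k. The composite of [f] and
    [g] is the identity plus [q] plus a boundary given by the homotopy [h]; [q] comes from the
    homotopy of the previous stage and has entries in A_+ by minimality. As F is free, [f] is
    recorded on basis vectors. A single induction carries all the data, since each stage uses the
    homotopy of the one before. *)
Let comparison i : exists (f : nat -> P i) (g : {linear P i -> Fr i}) (q h : nat -> nat -> A),
  let G p := fext (g p : {ffun _ -> A}) in homogeneous 0 g /\
  [/\ forall a, Z (\sum_(b < n i) D i a b *: f b),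
      forall p, Z p -> ZF i (G p),
      forall a b, (a < n i)%N -> (b < n i)%N ->
        G (f a) b = (a == b)%:R + q a b + rmul (n i.+1) (h a) (D i) b,
      forall a b, (b < n i)%N -> rmul (n i) (D i a) q b = 0
    & forall a b, aug gA (q a b) = 0].
Proof.
elim: i => [|i [f [g [q [h [hg0]]]]]].
  have [p0 ep0] := pr_eps_surj P (1 : k).
  pose u (x : Fr 0) : trivial_gmod gA := aug gA (fext (x : {ffun _ -> A}) 0%N).
  have fextE (x : {ffun 'I_(n 0) -> A}) a (an : (a < n 0)%N) : fext x a = x (Ordinal an).
    by rewrite -[a]/(nat_of_ord (Ordinal an)) fext_ord.
  have n0 : (0 < n 0)%N by rewrite fr_n0.
  have lu : linear u.
    move=> a x y; rewrite /u !(fextE _ _ n0) !ffunE augD augM; exact: erefl.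
  pose uL := GRing.isLinear.Build A (Fr 0) (trivial_gmod gA) _ u lu.
  pose ul : {linear Fr 0 -> trivial_gmod gA} := HB.pack u uL.
  have hu : homogeneous 0 ul.
    move=> t x; rewrite addr0 /= /u !(fextE _ _ n0) free_gcompE fr_w0 subr0.
    rewrite -[RHS]/(if t == 0 then _ else 0); case: eqP => [->|t0].
      by rewrite gcomp_aug aug_scalar.
    exact: (aug_ofdeg (ofdeg_gcomp gA t _)).
  have [|g hg ug] := projective_lift (@pr_projective _ _ _ _ P 0) hu (@pr_eps_deg _ _ _ _ P).
    move=> p; exists [ffun=> ((pr_eps P p : k)%:A : A) : A^o].
    by rewrite /= /u (fextE _ _ n0) ffunE aug_scalar.
  have ugE p : aug gA (fext (g p : {ffun _ -> A}) 0%N) = pr_eps P p by rewrite -ug.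
  have [|c ec] := (F_triv (fext (g p0 : {ffun _ -> A}) 0%N - 1)).2.
    by rewrite /positive augB ugE ep0 aug1 subrr.
  exists (fun=> p0), g, (fun _ _ => 0), (fun=> c); split=> //; split=> //=.
  - move=> a; rewrite linear_sum big1 // => b _; rewrite linearZ /=.
    by rewrite -[LHS]/(aug gA _ * _) F_min mul0r.
  - by move=> p zp; rewrite ugE.
  - move=> a b an bn.
    have [-> ->] : a = 0%N /\ b = 0%N by move: an bn; rewrite (fr_n0 F); lia.
    by rewrite eqxx -ec addr0 addrC subrK.
  - by move=> a b _; rewrite /rmul big1 // => j _; rewrite mulr0.
  - by move=> a b; rewrite aug0.
move=> /= [hf hg hgf hq aq].
have /choice[f' hf'] : forall a, exists p, \sum_(b < n i) D i a b *: f b = pr_d P i p.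
  by move=> a; apply: Z_exact.
have [u hu uE] := free_d i.
pose gd : {linear P i.+1 -> Fr i} := g \o pr_d P i.
have hgd : homogeneous 0 gd by move=> t p; rewrite /= pr_d_deg hg0 !addr0.
have out_fext m (x : 'I_m -> A) a : (m <= a)%N -> fext x a = 0 by apply: fext_out.
have out_rmul m v a : (n i <= a)%N -> rmul m v (D i) a = 0.
  by move=> na; rewrite /rmul big1 // => b _; rewrite fr_out ?na ?orbT ?mulr0.
have [|g' hg' ug'] := projective_lift (@pr_projective _ _ _ _ P i.+1) hu hgd.
  move=> p; have [|c ec] := ZF_exact _ (hg _ (Z_d p)); first by move=> a; apply: out_fext.
  exists [ffun a : 'I_(n i.+1) => c a : A^o]; apply/ffunP => b.
  rewrite uE -[RHS]fext_ord ec; apply: eq_bigr => a _.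
  by rewrite fext_ord ffunE.
have kd p : rmul (n i.+1) (fext (g' p : {ffun _ -> A})) (D i) =
    fext (g (pr_d P i p) : {ffun _ -> A}).
  apply/funext => b; have [bn|nb] := ltnP b (n i); last by rewrite out_rmul ?out_fext.
  by rewrite -[b]/(nat_of_ord (Ordinal bn)) fext_ord -uE ug'.
(* [q'] is the differential followed by the previous homotopy, and [v] the remaining discrepancy
   between the composite and the identity. It is a cycle, so exactness of F supplies the next
   homotopy. *)
pose q' a := rmul (n i) (D i a) h.
pose v a b :=
  if (b < n i.+1)%N then fext (g' (f' a) : {ffun _ -> A}) b - (a == b)%:R - q' a b else 0.
have vD a : (a < n i.+1)%N -> rmul (n i.+1) (v a) (D i) = 0.
  move=> an; transitivity (rmul (n i.+1) (fext (g' (f' a) : {ffun _ -> A})) (D i)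
      - D i a - rmul (n i.+1) (q' a) (D i)).
    rewrite -[in RHS](rmul_row (D i) an) -!rmulB; apply/funext => c; apply: eq_bigr => b _.
    rewrite /v ltn_ord; congr ((_ - _ - _) * _); by rewrite eq_sym.
  rewrite kd -hf'; apply/funext => c; have [cn|nc] := ltnP c (n i); last first.
    rewrite -[LHS]/(_ - _ - _) out_fext // fr_out ?nc ?orbT // out_rmul //.
    by rewrite !subr0.
  rewrite rmul_rmul -[LHS]/(_ - _ - _) -[c in fext _ c]/(nat_of_ord (Ordinal cn)) fext_ord.
  rewrite linear_sum sum_ffunE.
  rewrite (eq_bigr (fun b : 'I_(n i) => D i a b * ((b : nat) == c)%:R + D i a b * q b c +
      D i a b * rmul (n i.+1) (h b) (D i) c)); last first.
    move=> b _; rewrite linearZ ffunE -[LHS]/(D i a b * g (f b) (Ordinal cn)).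
    by rewrite -fext_ord hgf // !mulrDr.
  rewrite !big_split /=.
  have := hq a c cn; rewrite /rmul => ->; rewrite addr0.
  rewrite (bigD1 (Ordinal cn)) //= eqxx mulr1 big1; last first.
    by move=> b /negbTE bc; rewrite -[(b : nat) == c]/(b == Ordinal cn) bc mulr0.
  by rewrite addr0 /= -addrA -opprD subrr.
have /choice[h' hh'] : forall a, exists c, (a < n i.+1)%N -> v a = rmul (n i.+2) c (D i.+1).
  move=> a; have [an|na] := ltnP a (n i.+1); last by exists 0.
  have [|//|c ec] := @ZF_exact i.+1 (v a); last by exists c.
  - by move=> b nb; rewrite /v ltnNge nb.
  - exact: vD.
exists f', g', q', h'; split=> //; split=> /=.
- move=> a; rewrite linear_sum.
  transitivity (\sum_(b < n i.+1) D i.+1 a b *: cmul (n i) (D i) f b).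
    by apply: eq_bigr => b _; rewrite linearZ /= -hf'.
  by rewrite -rmul_cmul big1 // => b _; rewrite fr_dd scale0r.
- move=> p dp; rewrite kd dp linear0; apply/funext => b.
  by rewrite /fext; case: insubP => //= j _ _; rewrite ffunE.
- move=> a b an bn; rewrite -(hh' a an) /v bn.
  set x := fext _ _; set y := (_ == _)%:R; set z := q' _ _.
  by rewrite -[x - y - z]addrA -opprD [RHS]addrC subrK.
- by move=> a b _; rewrite -[q']/(fun a => rmul (n i) (D i a) h) -rmul_rmul fr_dd rmul0.
- by move=> a b; rewrite /q' /rmul aug_bigsum big1 // => c _; rewrite augM F_min mul0r.
Qed.

(** If P_i is zero, so is the composite F_i -> P_i -> F_i, and the augmentation of its entry (0, 0)
    would read 0 = 1. *)
Lemma minimal_resolution_length (g : nat) :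
  (forall i, (g < i)%N -> forall x : P i, x = 0) ->
  forall i, (g < i)%N -> n i = 0%N.
Proof.
move=> P0 i gi; have [f [g0 [q [h [_ [_ _ /(_ 0%N 0%N) hf _ aq]]]]]] := comparison i.
case: (posnP (n i)) => // ni; move: (hf ni ni).
rewrite (P0 i gi (f 0%N)) linear0 => /(congr1 (aug gA)).
rewrite !augD aug_rmul aq !addr0 aug1 => /eqP.
have -> : fext ((0 : Fr i) : {ffun _ -> A}) 0%N = 0.
  by rewrite /fext; case: insubP => //= j _ _; rewrite ffunE.
by rewrite aug0 eq_sym oner_eq0.
Qed.

End FiniteResolution.

(** * Linear forms separating a vector from a subspace *)

Section SeparatingForm.
Context (k : fieldType) (A : algType k) (V : lmodType A).
Local Open Scope classical_set_scope.

(** A subspace containing [W] and maximal among those avoiding [x] is a complement of the line k x;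
    the form reads off the coefficient of [x]. *)
Lemma separating_form (W : set V) (x : V) :
  W 0 -> (forall (c : k) u v, W u -> W v -> W (c%:A *: u + v)) -> ~ W x ->
  exists f : V -> k, [/\ forall (c : k) u v, f (c%:A *: u + v) = c * f u + f v,
    forall u, W u -> f u = 0 & f x = 1].
Proof.
move=> W0 WD Wx.
pose sub (S : set V) := [/\ W `<=` S,
  forall (c : k) u v, S u -> S v -> S (c%:A *: u + v) & ~ S x].
have subW : sub W by split.
(* The first alternative admits the union of the empty chain, which does not contain [W]. *)
have [F FP Ftot|S [PS maxS]] := @Zorn_bigcup V (fun S => (forall u, ~ S u) \/ sub S).
  have [[X [FX [u Xu]]]|noX] := pselect (exists X, F X /\ exists u, X u); last first.
    by left=> u [X FX Xu]; apply: noX; exists X; split=> //; exists u.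
  right; have [/(_ u)//|[WX XD Xx]] := FP X FX; split.
  - by move=> v Wv; exists X => //; apply: WX.
  - move=> c v1 v2 [Y1 FY1 Yv1] [Y2 FY2 Yv2].
    have [h|h] := Ftot _ _ FY1 FY2.
      exists Y2 => //; have [/(_ v2)//|[_ YD _]] := FP Y2 FY2.
      by apply: YD => //; apply: h.
    exists Y1 => //; have [/(_ v1)//|[_ YD _]] := FP Y1 FY1.
    by apply: YD => //; apply: h.
  - by move=> [Y FY Yx]; have [/(_ x)//|[_ _]] := FP Y FY.
have {PS} [WS SD Sx] : sub S.
  case: PS => // S0; case: (maxS W); last by right.
  by split=> [u /S0//|/(_ 0 W0)/S0].
have SZ (c : k) u : S u -> S (c%:A *: u).
  by move=> Su; rewrite -[_ *: _]addr0; apply: SD => //; apply: WS.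
have SB u v : S u -> S v -> S (u - v).
  move=> Su Sv; rewrite addrC -[- v]scale1r scalerN -scaleNr.
  by rewrite -[- (1 : A)]scaleN1r; apply: SD.
have lincomb (c e1 e2 : k) u v1 v2 : c%:A *: v1 + v2 - (c * e1 + e2)%:A *: u =
    c%:A *: (v1 - e1%:A *: u) + (v2 - e2%:A *: u).
  rewrite scalerBr addrACA -opprD; congr (_ - _); rewrite scalerA -scalerDl.
  by rewrite -scalerAl mul1r scalerA -scalerDl.
(* For u outside S, maximality puts [x] in S + k u; solving for u decomposes it. *)
have ex u : exists c : k, S (u - c%:A *: x).
  have [Su|Su] := pselect (S u); first by exists 0; rewrite scale0r scale0r subr0.
  pose S' v := exists c : k, S (v - c%:A *: u).
  have SS' v : S v -> S' v by exists 0; rewrite scale0r scale0r subr0.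
  have [[c hc]|S'x] := pselect (S' x).
    have [c0|c0] := eqVneq c 0.
      by case: Sx; move: hc; rewrite c0 scale0r scale0r subr0.
    exists c^-1; have -> : u - (c^-1)%:A *: x = (- c^-1)%:A *: (x - c%:A *: u).
      rewrite scalerBr scalerA -scalerAl mul1r scalerA mulNr mulVf //.
      by rewrite !scaleNr !scale1r opprK addrC.
    exact: SZ.
  case: (maxS S'); last right.
    split=> // h; apply: Su; apply: h; exists 1.
    by rewrite scale1r scale1r subrr; apply/WS.
  split=> //; first by move=> v /WS/SS'.
  move=> c v1 v2 [e1 h1] [e2 h2]; exists (c * e1 + e2).
  by rewrite lincomb; apply: SD.
have uniq_c u (c e : k) : S (u - c%:A *: x) -> S (u - e%:A *: x) -> c = e.
  move=> hc he; apply/eqP; rewrite -subr_eq0; case: eqP => // /eqP ce; case: Sx.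
  have -> : x = ((c - e)^-1)%:A *: ((u - e%:A *: x) - (u - c%:A *: x)).
    rewrite opprB [X in _ *: X]addrC addrA subrK -scalerBl -scalerBl.
    by rewrite scalerA -scalerAl mul1r scalerA mulVf // !scale1r.
  exact/SZ/SB.
have [f hf] := choice ex; exists f; split=> [c u v|u /WS Su|].
- by apply: uniq_c (hf _) _; rewrite lincomb; apply: SD.
- by apply: uniq_c (hf u) _; rewrite scale0r scale0r subr0.
- by apply: uniq_c (hf x) _; rewrite scale1r scale1r subrr; apply: WS.
Qed.

End SeparatingForm.

(** * The last term of the minimal resolution of k *)

Section TopTerm.
Context (k : fieldType) (A : algType k) (gA : connected_grading A) (F : free_res gA).
Local Notation n := (fr_n F).
Local Notation w := (fr_w F).
Local Notation D := (fr_d F).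
Hypothesis F_triv : forall a, fr_ideal F a <-> positive gA a.
Hypothesis F_min : forall l a b, aug gA (D l a b) = 0.
Context (E : injective_resolution (regular_gmod gA)) (d : nat) (l : int).
Hypothesis E_gor : forall i j, (i, j) != (d, - l) -> ext_zero E (trivial_gmod gA) i j.

Lemma killed_iff (M : lmodType A) (I J : A -> Prop) (x : M) :
  (forall a, I a <-> J a) -> killed I x <-> killed J x.
Proof. by move=> IJ; split=> h a /IJ; apply: h. Qed.

Lemma cobound_iff (N : gmod gA) (E' : injective_resolution N) (I J : A -> Prop) i t
    (x : E' i) :
  (forall a, I a <-> J a) -> cobound I t x <-> cobound J t x.
Proof. by move=> IJ; split; apply: cobound_sub => a /IJ. Qed.

Lemma ext_cyc_zero_iff (N : gmod gA) (E' : injective_resolution N) (I J : A -> Prop) i t :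
  (forall a, I a <-> J a) -> ext_cyc_zero E' I i t <-> ext_cyc_zero E' J i t.
Proof.
move=> IJ; split=> h x hx dx /(killed_iff x IJ) kx.
  exact/(cobound_iff _ _ IJ)/h.
by apply/(cobound_iff _ _ IJ)/h.
Qed.

(** The dual of a basis vector of the last term is a cocycle of Hom(F, A), and not a coboundary,
    since minimality puts the entries of coboundaries in A_+. Thus Ext^i(k, A) is nonzero in degree
    [- w i a], which the Gorenstein condition allows only at (d, - l). *)
Lemma top_term_degree i a : n i.+1 = 0%N -> (a < n i)%N -> i = d /\ w i a = l.
Proof.
move=> ni an; have [/eqP[-> /oppr_inj//]|h] := boolP ((i, - w i a) == (d, - l)).
have /ext_zero_trivialP := E_gor h.
move=> /(ext_cyc_zero_iff E i _ F_triv).2 /ext_cyc_col_zero.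
pose y b : regular_gmod gA := if b == a then 1 : A else 0.
have hy : is_col F (- w i a) i y.
  split=> b; rewrite /y; last by move=> nb; rewrite gtn_eqF //; lia.
  by case: eqP => [->|_]; rewrite ?addNr; [apply: ofdeg1|apply: ofdeg0].
move=> /(_ y hy) h0; have {h0} : col_cobound F (- w i a) i y.
  by apply: h0; apply/funext => b; rewrite /cmul big1 // => c _; rewrite fr_out ?ni ?scale0r.
clear ni h hy; case: i an @y => [|i] an y /=; [|case=> v _];
  move=> /(congr1 (fun f => f a)).
  by rewrite /y eqxx => /eqP; rewrite oner_eq0.
rewrite /y eqxx => /(congr1 (aug gA)); rewrite aug1 /cmul aug_bigsum big1.
  by move=> /eqP; rewrite oner_eq0.
by move=> b _; rewrite augM F_min mul0r.
Qed.

(** Descending induction from the bound [g]: a nonzero term above d followed by zero would be a last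
    term in the wrong place. *)
Lemma terms_above_zero (g : nat) : (forall i, (g < i)%N -> n i = 0%N) ->
  forall i, (d < i)%N -> n i = 0%N.
Proof.
move=> hg i di; suff gen m : forall j, (d < j)%N -> (g < j + m)%N -> n j = 0%N.
  by apply: (gen g.+1) => //; lia.
elim: m => [|m IH] j dj gj; first by apply: hg; lia.
have nj1 : n j.+1 = 0%N by apply: IH; lia.
have [//|nj] := posnP (n j); have [jd _] := top_term_degree nj1 nj.
by lia.
Qed.

End TopTerm.

(** * Invariants of a semisimple Hopf algebra *)

Section Sweedler.
Context (k : fieldType) (H : falgType k) (D : hopf_algebra H).
Local Notation b := (vbasis {:H}).
Local Notation Delta := (comul D).

Definition bilinear_map (V : lmodType k) (F : H -> H -> V) : Prop :=
  (forall y, linear (F^~ y)) /\ (forall x, linear (F x)).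

Lemma linear_coord (V : lmodType k) (f : H -> V) x : linear f ->
  f x = \sum_i coord b i x *: f b`_i.
Proof.
move=> lf; have f0 : f 0 = 0.
  by have := lf (-1) 0 0; rewrite scaler0 addr0 scaleN1r addNr.
have fD : {morph f : u v / u + v} by move=> u v; rewrite -[u]scale1r lf !scale1r.
have fZ c u : f (c *: u) = c *: f u by rewrite -[c *: u]addr0 lf f0 addr0.
rewrite {1}(coord_vbasis (memvf x)) (big_morph f fD f0).
by apply: eq_bigr => i _; rewrite fZ.
Qed.

Lemma tapply_tens2 (V : lmodType k) (F : H -> H -> V) x y : bilinear_map F ->
  tapply (tens2 x y) F = F x y.
Proof.
move=> [Fl Fr]; rewrite (linear_coord x (Fl y)) /tapply; apply: eq_bigr => i _.
rewrite (linear_coord y (Fr _)) scaler_sumr; apply: eq_bigr => j _.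
by rewrite mxE scalerA.
Qed.

Lemma tapply_sum (V : lmodType k) (I : finType) (c : I -> k) m (F : H -> H -> V) :
  tapply (\sum_i c i *: m i) F = \sum_i c i *: tapply (m i) F.
Proof.
have lin : linear (fun m' => tapply m' F).
  move=> e x y; rewrite /tapply scaler_sumr -big_split; apply: eq_bigr => i _.
  rewrite scaler_sumr -big_split; apply: eq_bigr => j _.
  by rewrite !mxE scalerDl scalerA.
apply: (big_ind2 (fun x y => tapply x F = y)) => [|x1 x2 y1 y2 <- <-|i _].
- by rewrite /tapply big1 // => i _; rewrite big1 // => j _; rewrite mxE scale0r.
- by rewrite -[x1]scale1r lin !scale1r.
- rewrite -[c i *: m i]addr0 lin; rewrite [X in _ + X = _](_ : _ = 0) ?addr0 //.
  by rewrite /tapply big1 // => i' _; rewrite big1 // => j _; rewrite mxE scale0r.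
Qed.

Lemma tapply_tapply (V : lmodType k) m (F' : H -> H -> 'M_(_, _)) (F : H -> H -> V) :
  tapply (tapply m F') F = tapply m (fun x y => tapply (F' x y) F).
Proof.
rewrite {2}/tapply pair_big_dep tapply_sum /=.
by rewrite /tapply pair_big_dep.
Qed.

Lemma tapply_map (V W : lmodType k) (f : V -> W) m (F : H -> H -> V) : linear f ->
  f (tapply m F) = tapply m (fun x y => f (F x y)).
Proof.
move=> lf; have f0 : f 0 = 0.
  by have := lf (-1) 0 0; rewrite scaler0 addr0 scaleN1r addNr.
have fD : {morph f : u v / u + v} by move=> u v; rewrite -[u]scale1r lf !scale1r.
have fZ c u : f (c *: u) = c *: f u by rewrite -[c *: u]addr0 lf f0 addr0.
rewrite /tapply (big_morph f fD f0); apply: eq_bigr => i _.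
by rewrite (big_morph f fD f0); apply: eq_bigr => j _.
Qed.

Lemma eq_tapply (V : lmodType k) m (F G : H -> H -> V) :
  (forall x y, F x y = G x y) -> tapply m F = tapply m G.
Proof. by move=> FG; apply: eq_bigr => i _; apply: eq_bigr => j _; rewrite FG. Qed.

Lemma tapply_exchange (V : lmodType k) m m' (F : H -> H -> H -> H -> V) :
  tapply m (fun x y => tapply m' (F x y)) =
  tapply m' (fun z u => tapply m (fun x y => F x y z u)).
Proof.
rewrite /tapply !pair_big_dep /=.
under eq_bigr do rewrite pair_big_dep scaler_sumr.
under [RHS]eq_bigr do rewrite pair_big_dep scaler_sumr.
rewrite exchange_big /=; apply: eq_bigr => i _; apply: eq_bigr => j _.
by rewrite !scalerA mulrC.
Qed.

Lemma tapply_comulM (V : lmodType k) (F : H -> H -> V) g h : bilinear_map F ->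
  tapply (Delta (g * h)) F = tapply (Delta g) (fun g1 g2 =>
    tapply (Delta h) (fun h1 h2 => F (g1 * h1) (g2 * h2))).
Proof.
move=> bF; rewrite comulM tapply_tapply; apply: eq_tapply => g1 g2.
by rewrite tapply_tapply; apply: eq_tapply => h1 h2; apply: tapply_tens2.
Qed.

Definition tapply3 (V : lmodType k)
    (m : {ffun 'I_(\dim {:H}) * 'I_(\dim {:H}) * 'I_(\dim {:H}) -> k^o})
    (G : H -> H -> H -> V) : V :=
  \sum_p (m p : k) *: G b`_p.1.1 b`_p.1.2 b`_p.2.

Lemma tapply3_tens3 (V : lmodType k) (G : H -> H -> H -> V) x y z :
  (forall y z, linear (fun x => G x y z)) -> (forall x z, linear (fun y => G x y z)) ->
  (forall x y, linear (G x y)) -> tapply3 (tens3 x y z) G = G x y z.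
Proof.
move=> l1 l2 l3; rewrite (linear_coord x (l1 y z)) /tapply3.
under [RHS]eq_bigr => i _ do rewrite (linear_coord y (l2 _ _)) scaler_sumr.
rewrite pair_big /=.
under [RHS]eq_bigr => p _ do rewrite (linear_coord z (l3 _ _)) !scaler_sumr.
rewrite [RHS]pair_big /=; apply: eq_bigr => -[[p1 p2] p3] _ /=.
by rewrite ffunE !scalerA.
Qed.

Lemma tapply3_tapply (V : lmodType k) (m : 'M[k]_(\dim {:H}, \dim {:H}))
    (F : H -> H -> {ffun 'I_(\dim {:H}) * 'I_(\dim {:H}) * 'I_(\dim {:H}) -> k^o})
    (G : H -> H -> H -> V) :
  tapply3 (tapply m F) G = tapply m (fun x y => tapply3 (F x y) G).
Proof.
have lin : linear (fun m' => tapply3 m' G).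
  move=> c x y; rewrite /tapply3 scaler_sumr -big_split; apply: eq_bigr => i _.
  by rewrite !ffunE scalerDl scalerA.
exact: (tapply_map _ _ lin).
Qed.

Lemma tapply_comulA (V : lmodType k) (G : H -> H -> H -> V) h :
  (forall y z, linear (fun x => G x y z)) -> (forall x z, linear (fun y => G x y z)) ->
  (forall x y, linear (G x y)) ->
  tapply (Delta h) (fun h1 h2 => tapply (Delta h1) (fun h11 h12 => G h11 h12 h2)) =
  tapply (Delta h) (fun h1 h2 => tapply (Delta h2) (fun h21 h22 => G h1 h21 h22)).
Proof.
move=> l1 l2 l3; have := congr1 (fun m => tapply3 m G) (comulA D h).
have e2 m (m' : H -> H -> 'M_(\dim {:H}, \dim {:H})) F :
    tapply3 (tapply m (fun x y => tapply (m' x y) (F x y))) G =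
    tapply m (fun x y => tapply (m' x y) (fun x' y' => tapply3 (F x y x' y') G)).
  by rewrite tapply3_tapply; apply: eq_tapply => x y; apply: tapply3_tapply.
rewrite !e2 => e; etransitivity; [|etransitivity; first exact: e].
  by apply: eq_tapply => x y; apply: eq_tapply => x' y'; rewrite tapply3_tens3.
by apply: eq_tapply => x y; apply: eq_tapply => x' y'; rewrite tapply3_tens3.
Qed.

(** [t] is the component of 1 in a left ideal complementing the kernel of the counit: h t - eps(h) t
    lies in both ideals. *)
Lemma integral_exists : semisimple H ->
  exists2 t : H, (counit D t : k) = 1 & forall h, h * t = (counit D h : k) *: t.
Proof.
move=> ssH; pose eps (h : H) : k := counit D h.
have epsM x y : eps (x * y) = eps x * eps y by exact: rmorphM.
have epsD x y : eps (x + y) = eps x + eps y by exact: raddfD.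
have epsB x y : eps (x - y) = eps x - eps y by exact: raddfB.
have epsZ c x : eps (c *: x) = c * eps x by rewrite /eps linearZ.
have eps1 : eps 1 = 1 by exact: rmorph1.
pose I := lker (linfun (counit D)).
have inI x : (x \in I) = (eps x == 0) by rewrite memv_ker lfunE.
have [|J [JJ IJ I0]] := ssH I.
  by apply/prodvP => x y _; rewrite !inI epsM => /eqP ->; rewrite mulr0.
have : 1 \in (I + J)%VS by rewrite IJ memvf.
move=> /memv_addP[i iI [t tJ it]].
have et : eps t = 1.
  by rewrite -eps1 it epsD; move: iI; rewrite inI => /eqP ->; rewrite add0r.
exists t => // h; apply/eqP; rewrite -subr_eq0 -memv0 -I0 memv_cap; apply/andP; split.
  by rewrite inI epsB epsM epsZ et mulr1 subrr.
apply: memvB; last exact: memvZ.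
by move/prodvP: JJ; apply => //; apply: memvf.
Qed.

(** If eta o S is the counit, then eta(h) = eps(h_1) eta(h_2) = eta(S(h_1) h_2) = eps(h). *)
Lemma counit_antipode_unique (eta : {lrmorphism H -> k^o}) :
  (forall h, (counit D h : k) = eta (antipode D h)) -> forall h, (eta h : k) = counit D h.
Proof.
move=> he h.
have le : linear (eta : H -> k^o) by move=> c x y; rewrite linearP.
rewrite -[in LHS](counit_l D h) (tapply_map _ _ le).
transitivity (eta (tapply (Delta h) (fun h1 h2 => antipode D h1 * h2))).
  have he' x y : eta (counit D x *: y) = eta (antipode D x * y).
    by rewrite linearZ /= rmorphM he.
  rewrite (tapply_map _ _ le); apply: eq_bigr => i _; apply: eq_bigr => j _.
  by rewrite he'.
by rewrite antipode_l linearZ rmorph1 /= [LHS]mulr1.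
Qed.

End Sweedler.

(** * Averaging by an integral and finiteness over the invariants *)

Section ModuleAlgebras.
Context (k : fieldType) (H : falgType k) (D : hopf_algebra H).
Context (R : algType k) (gR : connected_grading R) (X : module_algebra D gR).
Local Notation Delta := (comul D).
Local Notation b := (vbasis {:H}).
Local Notation eps := (counit D).

Lemma act_hlinear r : linear (fun h => act X h r).
Proof. by move=> c x y; apply: act_linear. Qed.

Lemma act_rlinear h : linear (act X h : R -> R).
Proof. by move=> c x y; apply: linearP. Qed.

Lemma act_zero r : act X 0 r = 0.
Proof. by have := act_hlinear r (-1) 0 0; rewrite scaler0 addr0 scaleN1r addNr. Qed.

Lemma actZ c h r : act X (c *: h) r = c *: act X h r.
Proof.
by have := act_hlinear r c h 0; rewrite !addr0 act_zero addr0.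
Qed.

Lemma act_invr h r a : a \in invariants X -> act X h (r * a) = act X h r * a.
Proof.
move=> /invariantsP aI; rewrite act_mul -[in RHS](counit_r D h).
rewrite (tapply_map _ _ (act_hlinear r)) (tapply_map (f := fun x => x * a)).
  by apply: eq_tapply => x y; rewrite aI actZ -scalerAr -scalerAl.
by move=> c x y; rewrite mulrDl scalerAl.
Qed.

Context (t : H) (eps_t : (eps t : k) = 1).
Hypothesis t_int : forall h, h * t = (eps h : k) *: t.

Lemma act_integral_inv r : act X t r \in invariants X.
Proof. by apply/invariantsP => h; rewrite -actM t_int actZ. Qed.

Lemma act_integral_id r : r \in invariants X -> act X t r = r.
Proof. by move=> /invariantsP ->; rewrite eps_t scale1r. Qed.

(* Combining S(t_1 e_1) t_2 e_2 = 1 with the invariance of Delta(t) moves the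
   average over H onto the second factor. *)
Lemma antipode_average x c :
  tapply (Delta t) (fun e1 e2 => tapply (Delta t) (fun t1 t2 =>
    act X (antipode D (t1 * e1)) (act X t2 (act X e2 x * c)))) = x * act X t c.
Proof.
pose K u v w := act X (antipode D u) (act X v x * act X w c).
have K1 v w : linear (fun u => K u v w).
  by move=> a u u'; rewrite /K linearP act_hlinear.
have K2 u w : linear (fun v => K u v w).
  by move=> a v v'; rewrite /K act_hlinear mulrDl -scalerAl linearP.
have K3 u v : linear (K u v).
  by move=> a w w'; rewrite /K act_hlinear mulrDr -scalerAr linearP.
pose f w := tapply (Delta t) (fun u v => K u v w).
have lf : linear f.
  move=> a w w'; rewrite /f /tapply scaler_sumr -big_split; apply: eq_bigr => i _.
  rewrite scaler_sumr -big_split; apply: eq_bigr => j _.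
  by rewrite K3 scalerDr !scalerA mulrC.
transitivity (tapply (Delta t) (fun t1 t2 => (eps t1 : k) *: f t2)).
  rewrite tapply_exchange.
  transitivity (tapply (Delta t) (fun t1 t2 => tapply (Delta t2) (fun t21 t22 =>
      tapply (Delta t) (fun e1 e2 => K (t1 * e1) (t21 * e2) t22)))).
    apply: eq_tapply => t1 t2; rewrite [RHS]tapply_exchange; apply: eq_tapply => e1 e2.
    rewrite act_mul (tapply_map _ _ (act_rlinear _)).
    by apply: eq_tapply => t21 t22; rewrite /K actM.
  rewrite -(tapply_comulA D (G := fun x1 x2 x3 =>
    tapply (Delta t) (fun e1 e2 => K (x1 * e1) (x2 * e2) x3))).
  - apply: eq_tapply => t1 t2.
    rewrite -(tapply_comulM D (F := fun u v => K u v t2)); last by split.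
    rewrite t_int /f /tapply linearZ /= scaler_sumr; apply: eq_bigr => i _.
    by rewrite scaler_sumr; apply: eq_bigr => j _; rewrite mxE scalerA.
  - move=> y z a u v; rewrite /tapply scaler_sumr -big_split; apply: eq_bigr => i _.
    rewrite scaler_sumr -big_split; apply: eq_bigr => j _.
    by rewrite mulrDl -scalerAl K1 scalerDr !scalerA mulrC.
  - move=> y z a u v; rewrite /tapply scaler_sumr -big_split; apply: eq_bigr => i _.
    rewrite scaler_sumr -big_split; apply: eq_bigr => j _.
    by rewrite mulrDl -scalerAl K2 scalerDr !scalerA mulrC.
  - move=> y z a u v; rewrite /tapply scaler_sumr -big_split; apply: eq_bigr => i _.
    rewrite scaler_sumr -big_split; apply: eq_bigr => j _.
    by rewrite K3 scalerDr !scalerA mulrC.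
transitivity (f t).
  rewrite -[in RHS](counit_l D t) (tapply_map _ _ lf); apply: eq_tapply => u v.
  have f0 : f 0 = 0 by have := lf (-1) 0 0; rewrite scaler0 addr0 scaleN1r addNr.
  by rewrite -[_ *: v]addr0 lf f0 addr0.
transitivity (act X (tapply (Delta t) (fun u v => antipode D u * v)) x * act X t c).
  rewrite (tapply_map _ _ (act_hlinear x)) (tapply_map (f := fun x => x * act X t c)).
    apply: eq_tapply => u v; rewrite /K act_invr ?actM //; exact: act_integral_inv.
  by move=> a u v; rewrite mulrDl scalerAl.
by rewrite antipode_l actZ act1 eps_t scale1r.
Qed.

(** Delta(t) is the sum of the tensors b_i (x) [leg i], so the vector [rho r] records the second
    factor of Delta(t) applied to r. *)
Let leg (i : nat) : H := if insub i is Some i' then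
  \sum_j Delta t (i' : 'I_(\dim {:H})) j *: b`_j else 0.

Let rho (r : R) (i : nat) : R := act X (leg i) r.

Let rho_c (s : nat -> R) (j : nat) : nat -> R^c := rho (s j).

Let tapply_rho (V : lmodType k) (G : H -> R -> V) (y : R -> R) r :
  (forall g, linear (G g)) -> linear y ->
  tapply (Delta t) (fun e1 e2 => G e1 (y (act X e2 r))) =
  \sum_(i < \dim {:H}) G b`_i (y (rho r i)).
Proof.
move=> lG ly; rewrite /tapply; apply: eq_bigr => i _.
rewrite /rho /leg valK.
have lin : linear (fun h => G b`_i (y (act X h r))).
  by move=> a u v; rewrite act_hlinear ly lG.
have f0 : G b`_i (y (act X 0 r)) = 0.
  by have := lin (-1) 0 0; rewrite scaler0 addr0 scaleN1r addNr.
rewrite (big_morph _ (_ : {morph (fun h => G b`_i (y (act X h r))) : u v / u + v}) f0).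
  by apply: eq_bigr => j _; rewrite -[_ *: b`_j]addr0 lin f0 addr0.
by move=> u v; rewrite -[u]scale1r lin !scale1r.
Qed.

(** The right R-submodule generated by all vectors [rho r] is finitely generated. If rho(r) = sum_j
    rho(s_j) c_j, then [antipode_average] turns this into r = sum_j s_j (t c_j), where the
    coefficients t c_j are invariant. *)
Lemma invariants_finite : right_noetherian R ->
  exists m (s : nat -> R), forall r, exists2 a : nat -> R,
    forall j, a j \in invariants X & r = \sum_(j < m) s j * a j.
Proof.
move=> noeR.
have noeRc : left_noetherian (R^c : pzRingType) by exact: noeR.
(* Right modules over R are handled as left modules over the opposite ring. *)
pose S (v : nat -> R^c) := exists p (s : nat -> R), row_span p (rho_c s) v.
have [|u v [p [s su]] [q [s' sv]]|c v [p [s [e ->]]]|v i [p [s [e ->]]] di|m [G [SG hG]]] :=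
  @noetherian_rows _ noeRc (\dim {:H}) S.
- by exists 0%N, (fun=> 0), 0; rewrite rmul0.
- exists (p + q)%N, (fun j => if (j < p)%N then s j else s' (j - p)%N).
  have := row_span_app su sv; congr (row_span _ _ _).
  by apply/funext => j; rewrite /row_app /rho_c; case: ifP.
- by exists p, s, (fun j => c * e j); rewrite rmulZ.
- rewrite /rmul big1 // => j _; rewrite /rho_c /rho /leg insubF ?ltnNge ?di //.
  by rewrite act_zero mulr0.
(* Each generator is a finite combination of vectors [rho s_j]; all these s_j are collected in one
   family. *)
have [p [s hs]] : exists p (s : nat -> R), forall c : nat -> R^c,
    row_span p (rho_c s) (rmul m c G).
  elim: m SG {hG} => [|m IH] SG.
    exists 0%N, (fun=> 0) => c; exists 0; rewrite rmul0.
    by apply/funext => i; rewrite /rmul big_ord0.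
  have [i im|p [s hs]] := IH; first by apply: SG; lia.
  have [q [s' [e he]]] := SG m (leqnn _).
  exists (p + q)%N, (fun j => if (j < p)%N then s j else s' (j - p)%N) => c.
  have -> : rmul m.+1 c G = rmul m c G + rmul q (fun j => c m * e j) (rho_c s').
    by rewrite rmulZ -he; apply/funext => i; rewrite /rmul big_ord_recr.
  have := row_span_app (hs c) (ex_intro _ _ erefl : row_span q (rho_c s')
     (rmul q (fun j => c m * e j) (rho_c s'))).
  congr (row_span _ _ _).
  by apply/funext => j; rewrite /row_app /rho_c; case: ifP.
exists p, s => r.
have [c hc] : row_span p (rho_c s) (rho r).
  have [|c ->] := hG (rho r); last exact: hs.
  by exists 1%N, (fun=> r); apply: (row_span_row (fun=> rho r : nat -> R^c) (i := 0)).
exists (fun j => act X t (c j)) => [j|]; first exact: act_integral_inv.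
pose G' g x := tapply (Delta t) (fun t1 t2 => act X (antipode D (t1 * g)) (act X t2 x)).
have lG g : linear (G' g).
  move=> a u v; rewrite /G' /tapply scaler_sumr -big_split; apply: eq_bigr => i _.
  rewrite scaler_sumr -big_split; apply: eq_bigr => j _.
  by rewrite !act_rlinear scalerDr !scalerA mulrC.
have av x e : \sum_(i < \dim {:H}) G' b`_i (rho x i * e) = x * act X t e.
  rewrite -antipode_average -(tapply_rho (y := fun z => z * e) x lG) //.
  by move=> a u v; rewrite mulrDl scalerAl.
transitivity (\sum_(i < \dim {:H}) G' b`_i (rho r i * 1)).
  by rewrite av act_one eps_t scale1r mulr1.
under [RHS]eq_bigr => j _ do rewrite -av.
rewrite [RHS]exchange_big; apply: eq_bigr => i _.
have G0 : G' b`_i 0 = 0 by have := lG b`_i (-1) 0 0; rewrite scaler0 addr0 scaleN1r addNr.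
rewrite mulr1 hc (big_morph _ (_ : {morph G' b`_i : u v / u + v}) G0) //.
by move=> u v; rewrite -[u]scale1r lG !scale1r.
Qed.

End ModuleAlgebras.

(** * Base change of the resolution from A to R *)

Section BoundedTor.
Context (k : fieldType) (A : algType k) (gA : connected_grading A) (F : free_res gA).
Local Notation n := (fr_n F).
Local Notation w := (fr_w F).
Local Notation D := (fr_d F).
Hypothesis F_triv : forall a, fr_ideal F a <-> positive gA a.
Hypothesis noeA : right_noetherian A.

Definition graded_right_submod (m : nat) (v : nat -> int) (K : (nat -> A) -> Prop) : Prop :=
  [/\ K 0, forall x y, K x -> K y -> K (x + y),
      forall (a : A) x, K x -> K (fun j => x j * a),
      forall x j, K x -> (m <= j)%N -> x j = 0 &
      forall t x, K x -> K (fun j => gcomp gA (t - v j) (x j))].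

Definition lcomb (m : nat) (P : nat -> nat -> A) (x : nat -> A) (j : nat) : A :=
  \sum_(e < m) P e j * x e.

Lemma right_generators m v K : graded_right_submod m v K ->
  exists m' v' P, [/\ forall e, (e < m')%N -> K (P e),
    forall e j, ofdeg gA (v' e - v j) (P e j) &
    forall x, K x -> exists c, x = lcomb m' P c].
Proof.
move=> [K0 KD KM Kout Kcomp].
have noeAc : left_noetherian (A^c : pzRingType) by exact: noeA.
have [m' [v' [P [KP Pdeg Pspan]]]] := @noetherian_homogeneous _ (agr gA : grading A^c)
  noeAc m v K K0 KD (fun c x => @KM c x) Kout Kcomp.
by exists m', v', P; split=> // x /Pspan[c ->]; exists c.
Qed.

(** [U] represents an element of A^m (x) F_q; it is a cycle modulo K when the coordinates of its
    boundary on the basis of F_{q-1} lie in K. *)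
Let tor_cycle q (K : (nat -> A) -> Prop) (U : nat -> nat -> A) : Prop :=
  match q with
  | 0 => True
  | q'.+1 => forall b, (b < n q')%N -> K (fun j => \sum_(a < n q'.+1) U a j * D q' a b)
  end.

Let bounded_above m (v : nat -> int) : exists N : int, forall j, (j < m)%N -> v j <= N.
Proof.
elim: m => [|m [N hN]]; first by exists 0.
exists (Num.max N (v m)) => j; rewrite ltnS leq_eqVlt => /orP[/eqP ->|/hN jN].
  by rewrite le_max lexx orbT.
by rewrite le_max jN.
Qed.

(* The cycles and boundaries are those of (A^m / K) (x) F; the induction on q
   replaces K by the module of relations between its generators. *)
Lemma tor_bounded_above q m v K : graded_right_submod m v K ->
  exists N : int, forall t U, N < t ->
    (forall a j, ofdeg gA (t - w q a - v j) (U a j)) ->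
    (forall a j, (m <= j)%N -> U a j = 0) -> tor_cycle q K U ->
    exists V : nat -> nat -> A, (forall c j, (m <= j)%N -> V c j = 0) /\
      forall a, (a < n q)%N -> K (fun j => U a j - \sum_(c < n q.+1) V c j * D q c a).
Proof.
elim: q m v K => [|q IH] m v K hK; have [K0 KD KM Kout Kcomp] := hK.
  (* Beyond the degrees of the generators, every coordinate has positive degree, hence lies in A_+,
     the image of F_1. *)
  have [N hN] := bounded_above m v; exists N => t U Nt hU oU _.
  have /choice[V hV] : forall j, exists c : nat -> A,
      ((m <= j)%N -> c = 0) /\ U 0%N j = rmul (n 1) c (D 0) 0.
    move=> j; have [mj|jm] := leqP m j; first by exists 0; rewrite oU // rmul0.
    have [|c ec] := (F_triv (U 0%N j)).2; last by exists c.
    apply: (aug_ofdeg (hU 0%N j)); rewrite fr_w0; have := hN j jm; lia.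
  exists (fun c j => V j c); split=> [c j mj|a]; first by have [->] := hV j.
  rewrite fr_n0; case: a => // _; rewrite (_ : (fun j => _) = 0) //.
  by apply/funext => j; have [_ ->] := hV j; rewrite subrr.
have [m' [v' [P [KP Pdeg Pspan]]]] := right_generators hK.
(* Dimension shift: K is A^m' modulo [K'], and Tor_{q+1} of A^m / K is controlled by Tor_q of K. *)
pose K' x := (forall e, (m' <= e)%N -> x e = 0) /\ lcomb m' P x = 0.
have hK' : graded_right_submod m' v' K'.
  split.
  - by split=> //; apply/funext => j; rewrite /lcomb big1 // => e _; rewrite mulr0.
  - move=> x y [ox Px] [oy Py]; split.
      by move=> e me; rewrite -[LHS]/(x e + y e) ox ?oy ?addr0.
    apply/funext => j; transitivity (lcomb m' P x j + lcomb m' P y j).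
      by rewrite -big_split; apply: eq_bigr => e _; rewrite /= -mulrDr.
    by rewrite Px Py addr0.
  - move=> a x [ox Px]; split=> [e me|]; first by rewrite ox ?mul0r.
    apply/funext => j; have := congr1 (fun f => f j * a) Px.
    rewrite mul0r mulr_suml => e; rewrite -[RHS]e; apply: eq_bigr => e' _.
    by rewrite mulrA.
  - by move=> x j [ox _]; apply: ox.
  - move=> t x [ox Px]; split=> [e me|]; first by rewrite ox ?gcomp0.
    apply/funext => j; have := congr1 (fun f => gcomp gA (t - v j) (f j)) Px.
    rewrite gcomp0 gcomp_bigsum => e; rewrite -[RHS]e; apply: eq_bigr => e' _.
    rewrite (gcompMl _ _ (Pdeg e' j)); congr (_ * gcomp _ _ _); ring.
have [N hN] := IH m' v' K' hK'; exists N => t U Nt hU oU zU.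
have /choice[x hx] : forall b, exists c, (b < n q)%N ->
    (fun j => \sum_(a < n q.+1) U a j * D q a b) = lcomb m' P c.
  by move=> b; have [bq|] := ltnP b (n q); [have [c] := Pspan _ (zU b bq); exists c|exists 0].
(* The boundary of [U] lies in K (x) F_q; its expression through the generators [P], cut to the
   right degree, is a cycle modulo [K']. *)
pose U' b e := if (e < m')%N then gcomp gA (t - w q b - v' e) (x b e) else 0.
have oU' b e : (m' <= e)%N -> U' b e = 0 by rewrite /U' ltnNge => ->.
have hU' b j : (b < n q)%N -> lcomb m' P (U' b) j = \sum_(a < n q.+1) U a j * D q a b.
  move=> bq; transitivity (gcomp gA (t - w q b - v j) (\sum_(a < n q.+1) U a j * D q a b)).
    rewrite (congr1 (fun f => f j) (hx b bq)) gcomp_bigsum; apply: eq_bigr => e _.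
    rewrite (gcompMl _ _ (Pdeg e j)) /U' ltn_ord; congr (_ * gcomp _ _ _); ring.
  rewrite gcomp_bigsum; apply: eq_bigr => a _.
  apply: ofdegM_eq (hU a j) (fr_deg F q a b) _; ring.
have [|b e me||V' [oV' hV']] := hN t U' Nt.
- by move=> b e; rewrite /U'; case: ifP => _; [apply: ofdeg_gcomp|apply: ofdeg0].
- exact: oU'.
- case: q {IH hN} zU x hx U' oU' hU' hU => //= q zU x hx U' oU' hU' hU c cq; split.
    by move=> e me; rewrite big1 // => b _; rewrite oU' ?mul0r.
  apply/funext => j; transitivity (\sum_(b < n q.+1) lcomb m' P (U' b) j * D q b c).
    rewrite /lcomb; under eq_bigr do rewrite mulr_sumr.
    under [RHS]eq_bigr do rewrite mulr_suml.
    by rewrite exchange_big; apply: eq_bigr => e _; apply: eq_bigr => b _; rewrite mulrA.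
  under eq_bigr => b _ do rewrite hU' // mulr_suml.
  rewrite exchange_big big1 // => a _.
  under eq_bigr do rewrite -mulrA.
  have := congr1 (fun f => f c) (fr_dd F q a); rewrite /rmul => e.
  by rewrite -mulr_sumr e mulr0.
(* Subtracting the combination of the [P] with coefficients [V'] leaves a genuine cycle of A^m (x)
   F, which bounds because F is exact. *)
pose PV a := lcomb m' P (V' a).
have kerD j b : \sum_(a < n q.+1) (U a j - PV a j) * D q a b = 0.
  have [bq|qb] := ltnP b (n q); last first.
    by rewrite big1 // => a _; rewrite fr_out ?qb ?orbT ?mulr0.
  under eq_bigr do rewrite mulrBl.
  rewrite sumrB -hU' //; have [_ /(congr1 (fun f => f j))] := hV' b bq.
  rewrite /lcomb; under eq_bigr do rewrite mulrBr mulr_sumr.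
  rewrite sumrB => /subr0_eq ->; apply/eqP; rewrite subr_eq0; apply/eqP.
  rewrite exchange_big; apply: eq_bigr => a _.
  by rewrite /PV /lcomb mulr_suml; apply: eq_bigr => e _; rewrite mulrA.
have /choice[V hV] : forall j, exists c : nat -> A, ((m <= j)%N -> c = 0) /\
    forall a, (a < n q.+1)%N -> U a j - PV a j = rmul (n q.+2) c (D q.+1) a.
  move=> j; have [mj|jm] := leqP m j.
    exists 0; split=> // a an; rewrite rmul0 oU // sub0r /PV.
    suff -> : lcomb m' P (V' a) j = 0 by rewrite oppr0.
    by rewrite /lcomb big1 // => e _; rewrite (Kout _ j (KP e (ltn_ord e))) ?mul0r.
  have [||c ec] := @fr_exact_ungraded _ _ _ F q
    (fun a => if (a < n q.+1)%N then U a j - PV a j else 0).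
  - by move=> a na; rewrite ltnNge na.
  - apply/funext => b; rewrite -[RHS](kerD j b); apply: eq_bigr => a _.
    by rewrite ltn_ord.
  - by exists c; split=> [|a an]; [lia|rewrite -ec an].
exists (fun c j => V j c); split=> [c j mj|a an]; first by have [->] := hV j.
rewrite (_ : (fun j => _) = PV a); last first.
  apply/funext => j; have [_ /(_ a an) e] := hV j; rewrite /rmul in e.
  by rewrite -e opprB addrC subrK.
have gen p : (p <= m')%N -> K (lcomb p P (V' a)).
  elim: p => [_|p IHp pm].
    by rewrite (_ : lcomb 0 _ _ = 0) //; apply/funext => j; rewrite /lcomb big_ord0.
  rewrite (_ : lcomb p.+1 _ _ = lcomb p P (V' a) + (fun j => P p j * V' a p)).
    by apply: KD; [apply: IHp; lia|apply: KM; apply: KP].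
  by apply/funext => j; rewrite /lcomb big_ord_recr.
exact: gen.
Qed.

Context (R : algType k) (gR : connected_grading R) (iota : {rmorphism A -> R}).
Hypothesis iota_deg : forall i a, ofdeg gA i a -> ofdeg gR i (iota a).
Hypothesis R_fin : exists m (s : nat -> R), forall r, exists a : nat -> A,
  r = \sum_(j < m) s j * iota (a j).

Lemma iota_gcomp i a : iota (gcomp gA i a) = gcomp gR i (iota a).
Proof.
have [s _ ->] := gcomp_sum gA a.
rewrite gcomp_bigsum !rmorph_sum gcomp_bigsum; apply: eq_bigr => j _.
rewrite gcomp_gcomp (gcomp_ofdeg i (iota_deg (ofdeg_gcomp gA j a))).
by case: eqP => // _; rewrite rmorph0.
Qed.

Lemma homogeneous_right_generators : exists m (v : nat -> int) (s : nat -> R),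
  (forall j, ofdeg gR (v j) (s j)) /\
  forall r, exists a : nat -> A, r = \sum_(j < m) s j * iota (a j).
Proof.
have [m [s hs]] := R_fin.
have [T _ hT] := gcomp_sum_family gR (fun j : 'I_m => s j) (fun=> 0).
pose I : finType := ('I_m * 'I_(size T))%type.
pose el (p : I) : R := gcomp gR T`_p.2 (s p.1).
exists #|I|, (fun e => oapp (fun e' : 'I_#|I| => T`_(enum_val e').2) 0 (insub e)),
  (fun e => oapp (fun e' : 'I_#|I| => el (enum_val e')) 0 (insub e)).
split=> [e|r]; first by case: insubP => [e' _ _|_] /=; [apply: ofdeg_gcomp|apply: ofdeg0].
have [a ->] := hs r.
exists (fun e => oapp (fun e' : 'I_#|I| => a (enum_val e').1) 0 (insub e)).
under [RHS]eq_bigr => e _ do rewrite valK /=.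
rewrite -(big_enum_val (fun p : I => el p * iota (a p.1))) /=.
rewrite (eq_bigl xpredT) //.
rewrite -(pair_bigA _ (fun i j => el (i, j) * iota (a i))) /=.
apply: eq_bigr => j _; rewrite -mulr_suml; congr (_ * _).
rewrite {1}hT (big_nth 0) big_mkord; apply: eq_bigr => e _; by rewrite subr0.
Qed.

Definition base_d l a b : R := iota (D l a b).
Local Notation D' := base_d.

(** R is A^m modulo the relations [K] between homogeneous right generators, so the homology in
    question is that of (A^m / K) (x) F. *)
Lemma base_tor_bounded q : exists N : int, forall t z, N < t ->
  vec gR (n q) (fun a => t - w q a) z ->
  (match q with 0 => True | q'.+1 => rmul (n q) z (D' q') = 0 end) ->
  exists2 u, vec gR (n q.+1) (fun a => t - w q.+1 a) u & z = rmul (n q.+1) u (D' q).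
Proof.
have [m [v [s [sdeg hs]]]] := homogeneous_right_generators.
pose ev (x : nat -> A) := \sum_(j < m) s j * iota (x j).
have evD x y : ev (x + y) = ev x + ev y.
  by rewrite /ev -big_split; apply: eq_bigr => j _; rewrite rmorphD mulrDr.
have ev_comp t x : ev (fun j => gcomp gA (t - v j) (x j)) = gcomp gR t (ev x).
  rewrite gcomp_bigsum; apply: eq_bigr => j _.
  by rewrite iota_gcomp (gcompMl _ _ (sdeg j)).
have evM x a : ev (fun j => x j * a) = ev x * iota a.
  by rewrite /ev mulr_suml; apply: eq_bigr => j _; rewrite rmorphM mulrA.
have ev0 : ev 0 = 0 by rewrite /ev big1 // => j _; rewrite rmorph0 mulr0.
have ev_sum p (X : nat -> nat -> A) (c : nat -> A) :
    ev (fun j => \sum_(i < p) X i j * c i) = \sum_(i < p) ev (X i) * iota (c i).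
  under [RHS]eq_bigr do rewrite -evM.
  rewrite /ev exchange_big; apply: eq_bigr => j _.
  by rewrite rmorph_sum mulr_sumr.
pose K x := (forall j, (m <= j)%N -> x j = 0) /\ ev x = 0.
have hK : graded_right_submod m v K.
  split.
  - by [].
  - move=> x y [ox ex] [oy ey]; split; last by rewrite evD ex ey addr0.
    by move=> j mj; rewrite -[LHS]/(x j + y j) ox ?oy ?addr0.
  - by move=> a x [ox ex]; split=> [j mj|]; [rewrite ox ?mul0r|rewrite evM ex mul0r].
  - by move=> x j [ox _]; apply: ox.
  - by move=> t x [ox ex]; split=> [j mj|]; [rewrite ox ?gcomp0|rewrite ev_comp ex gcomp0].
have [N hN] := tor_bounded_above q hK; exists N => t z Nt [hz oz] zD.
have /choice[U0 hU0] : forall a, exists x, z a = ev x by move=> a; apply: hs.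
pose U a j := if (j < m)%N then gcomp gA (t - w q a - v j) (U0 a j) else 0.
have evU a : ev (U a) = z a.
  rewrite -hz [in RHS]hU0 -ev_comp; apply: eq_bigr => j _; by rewrite /U ltn_ord.
have oU a j : (m <= j)%N -> U a j = 0 by rewrite /U ltnNge => ->.
have [|||V [oV hV]] := hN t U Nt.
- by move=> a j; rewrite /U; case: ifP => _; [apply: ofdeg_gcomp|apply: ofdeg0].
- exact: oU.
- case: q {hN} zD hz oz U0 hU0 U oU evU => //= q zD hz oz U0 hU0 U oU evU b bq; split.
    by move=> j mj; rewrite big1 // => a _; rewrite oU ?mul0r.
  rewrite (ev_sum (n q.+1) U (fun a => D q a b)); have := congr1 (fun f => f b) zD.
  by under eq_bigr do rewrite evU.
pose u0 c := ev (V c).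
have zE a : (a < n q)%N -> z a = rmul (n q.+1) u0 (D' q) a.
  move=> aq; have [_] := hV a aq.
  rewrite (_ : (fun j => _) = U a + (fun j => \sum_(c < n q.+1) V c j * - D q c a)).
    rewrite evD evU (ev_sum (n q.+1) V (fun c => - D q c a)).
    under eq_bigr do rewrite rmorphN mulrN.
    by rewrite sumrN => /subr0_eq.
  by apply/funext => j; congr (_ + _); rewrite -sumrN; apply: eq_bigr => c _; rewrite mulrN.
pose u c := if (c < n q.+1)%N then gcomp gR (t - w q.+1 c) (u0 c) else 0.
exists u; first by apply: vec_cut => c _; apply: ofdeg_gcomp.
apply/funext => a; have [aq|qa] := ltnP a (n q); last first.
  by rewrite oz // /rmul big1 // => c _; rewrite /D' fr_out ?qa ?orbT // rmorph0 mulr0.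
rewrite -hz zE // gcomp_bigsum; apply: eq_bigr => c _.
rewrite (gcompMr _ _ (iota_deg (fr_deg F q c a))) /u ltn_ord.
congr (gcomp _ _ _ * _); ring.
Qed.

End BoundedTor.

(** * The acyclicity lemma *)

Section Acyclicity.
Context (k : fieldType) (A : algType k) (gA : connected_grading A) (F : free_res gA).
Context (R : algType k) (gR : connected_grading R) (iota : {rmorphism A -> R}).
Hypothesis iota_deg : forall i a, ofdeg gA i a -> ofdeg gR i (iota a).
Context (Q : free_res gR) (d : nat).
Local Notation n := (fr_n F).
Local Notation w := (fr_w F).
Local Notation D := (base_d F iota).
Local Notation nQ := (fr_n Q).
Local Notation wQ := (fr_w Q).
Local Notation DQ := (fr_d Q).

Let D_out l a b : (n l.+1 <= a)%N || (n l <= b)%N -> D l a b = 0.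
Proof. by move=> h; rewrite /base_d fr_out ?rmorph0. Qed.

Let D_deg l a b : ofdeg gR (w l.+1 a - w l b) (D l a b).
Proof. exact/iota_deg/fr_deg. Qed.

Let DD l a : rmul (n l.+1) (D l.+1 a) (D l) = 0.
Proof.
apply/funext => b; have := congr1 (fun f => iota (f b)) (fr_dd F l a).
rewrite rmorph0 rmorph_sum => e; rewrite -[RHS]e; apply: eq_bigr => c _.
by rewrite rmorphM.
Qed.

Let rmulDD l u : rmul (n l.+1) (rmul (n l.+2) u (D l.+1)) (D l) = 0.
Proof.
rewrite rmul_rmul; apply/funext => b; rewrite /rmul big1 // => a _.
by have := congr1 (fun f => f b) (DD l a); rewrite /rmul => ->; rewrite mulr0.
Qed.

(** [frow q t] is the degree t part of R (x) F_q, and [brow q t] that of its submodule B_q of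
    boundaries. *)
Let frow q t (z : nat -> R) : Prop := vec gR (n q) (fun a => t - w q a) z.

Let brow q t (z : nat -> R) : Prop :=
  exists2 u, frow q.+1 t u & z = rmul (n q.+1) u (D q).

Let frow_rmul q t u : frow q.+1 t u -> frow q t (rmul (n q.+1) u (D q)).
Proof.
move=> [hu ou]; split=> b.
  apply: ofdeg_bigsum => a _; apply: ofdegM_eq (hu a) (D_deg q a b) _; ring.
by move=> nb; rewrite /rmul big1 // => a _; rewrite D_out ?nb ?orbT ?mulr0.
Qed.

Let brow0 q t : brow q t 0.
Proof. by exists 0; [apply: vec0|rewrite rmul0]. Qed.

(* Ext^i(k, -) vanishes on the graded module of rows described by S. *)
Let depth_ge (i : nat) (S : int -> (nat -> R) -> Prop) : Prop :=
  forall t (y : nat -> nat -> R), (forall a, S (t + wQ i a) (y a)) ->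
    (forall a, (nQ i <= a)%N -> y a = 0) ->
    (forall a c, \sum_(b < nQ i) DQ i a b * y b c = 0) ->
  match i with
  | 0 => forall a, y a = 0
  | i'.+1 => exists v, [/\ forall a, S (t + wQ i' a) (v a),
      forall a, (nQ i' <= a)%N -> v a = 0 &
      forall a c, y a c = \sum_(b < nQ i') DQ i' a b * v b c]
  end.

Hypothesis R_depth : forall i t, (i < d)%N -> @col_zero _ _ _ Q t (regular_gmod gR) i.

(** R (x) F_q is a finite sum of shifts of R, so the hypothesis on R applies coordinate by
    coordinate. *)
Let depth_frow q i : (i < d)%N -> depth_ge i (frow q).
Proof.
move=> id t y hy oy yD.
have col c : (c < n q)%N ->
    @col_cobound _ _ _ Q (t - w q c) (regular_gmod gR) i (fun a => y a c).
  move=> cn; apply: R_depth => //; last by apply/funext => a; apply: yD.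
  split=> a; last by move=> na; rewrite oy.
  have [h _] := hy a; have := h c; rewrite /ofdeg => e; rewrite -[RHS]e.
  by congr (gcomp _ _ _); ring.
case: i id hy oy yD col => [|i] id hy oy yD col.
  move=> a; apply/funext => c; have [cn|nc] := ltnP c (n q).
    exact: (congr1 (fun f => f a) (col c cn)).
  by have [_ ->] := hy a.
have /choice[v hv] : forall c, exists v : nat -> R,
    [/\ (c < n q)%N -> is_col Q (t - w q c) i (v : nat -> regular_gmod gR),
        (n q <= c)%N -> v = 0 & forall a, y a c = \sum_(b < nQ i) DQ i a b * v b].
  move=> c; have [cn|nc] := ltnP c (n q).
    have [v hv e] := col c cn; exists v; split=> // a.
    exact: (congr1 (fun f => f a) e).
  exists 0; split=> // a; have [_ ->] := hy a; rewrite ?nc // big1 // => b _.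
  by rewrite mulr0.
exists (fun a c => v c a); split=> [a|a ia|a c]; last by have [_ _] := hv c.
  split=> c; last by move=> nc; have [_ h _] := hv c; rewrite h.
  have [cn|nc] := ltnP c (n q); last first.
    by have [_ h _] := hv c; have vca : v c a = 0; [rewrite h|rewrite vca; apply: ofdeg0].
  have [/(_ cn)[h _] _ _] := hv c; have := h a; rewrite /ofdeg => e; rewrite -[RHS]e.
  by congr (gcomp _ _ _); ring.
apply/funext => c; have [cn|nc] := ltnP c (n q); last by have [_ h _] := hv c; rewrite h.
by have [/(_ cn)[_ h] _ _] := hv c; apply: h.
Qed.

Let exact_at q : Prop :=
  forall t z, frow q.+1 t z -> rmul (n q.+1) z (D q) = 0 -> brow q.+1 t z.

Let frow_comb q i t (u : nat -> nat -> R) a :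
  (forall b, frow q (t + wQ i b) (u b)) ->
  frow q (t + wQ i.+1 a) (fun c => \sum_(b < nQ i) DQ i a b * u b c).
Proof.
move=> hu; split=> c.
  apply: ofdeg_bigsum => b _; have [h _] := hu b.
  apply: ofdegM_eq (fr_deg Q i a b) (h c) _; ring.
by move=> nc; rewrite big1 // => b _; have [_ ->] := hu b; rewrite ?mulr0.
Qed.

Let rmul_comb q m (c : nat -> R) (u : nat -> nat -> R) :
  rmul (n q.+1) (fun e => \sum_(b < m) c b * u b e) (D q) =
  fun e => \sum_(b < m) c b * rmul (n q.+1) (u b) (D q) e.
Proof.
apply/funext => e; rewrite /rmul; under eq_bigr do rewrite mulr_suml.
rewrite exchange_big; apply: eq_bigr => b _; rewrite mulr_sumr.
by apply: eq_bigr => a _; rewrite mulrA.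
Qed.

(** Exactness gives 0 -> B_{q+1} -> R (x) F_{q+1} -> B_q -> 0, and Ext^i(k, B_q) then lies between
    Ext^i(k, R (x) F_{q+1}) = 0 and Ext^(i+1)(k, B_{q+1}) = 0. *)
Let depth_brow q i : (i < d)%N -> exact_at q -> depth_ge i.+1 (brow q.+1) ->
  depth_ge i (brow q).
Proof.
move=> id exq hB t y hy oy yD.
have /choice[u hu] : forall a, exists u, [/\ frow q.+1 (t + wQ i a) u,
    y a = rmul (n q.+1) u (D q) & (nQ i <= a)%N -> u = 0].
  move=> a; have [na|an] := leqP (nQ i) a.
    by exists 0; split; [apply: vec0|rewrite rmul0 oy|].
  by have [u hu e] := hy a; exists u.
pose x a c := \sum_(b < nQ i) DQ i a b * u b c.
have fu b : frow q.+1 (t + wQ i b) (u b) by have [] := hu b.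
have xB a : brow q.+1 (t + wQ i.+1 a) (x a).
  apply: exq; first exact: frow_comb.
  rewrite /x rmul_comb; apply/funext => c; rewrite -[RHS](yD a c).
  by apply: eq_bigr => b _; have [_ ->] := hu b.
have [|a c|v [vB ov xv]] := hB t x xB.
- move=> a na; apply/funext => c; rewrite /x big1 // => b _.
  by rewrite fr_out ?na ?mul0r.
- rewrite /x; under eq_bigr do rewrite mulr_sumr.
  rewrite exchange_big big1 // => b _; under eq_bigr do rewrite mulrA.
  rewrite -mulr_suml; have := congr1 (fun f => f (b : nat)) (fr_dd Q i a).
  by rewrite /rmul => ->; rewrite mul0r.
have fv a : frow q.+1 (t + wQ i a) (v a).
  by have [s fs ->] := vB a; apply: frow_rmul.
have vD a : rmul (n q.+1) (v a) (D q) = 0 by have [s _ ->] := vB a; apply: rmulDD.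
have yE a : y a = rmul (n q.+1) (u a - v a) (D q).
  by have [_ -> _] := hu a; rewrite rmulB vD subr0.
have hF : depth_ge i (frow q.+1) by apply: depth_frow.
have uv0 a : (nQ i <= a)%N -> u a - v a = 0.
  by move=> na; have [_ _ ->] := hu a; rewrite ?ov ?subrr.
have uvD a c : \sum_(b < nQ i) DQ i a b * (u b - v b) c = 0.
  under eq_bigr => b _ do rewrite -[(u b - v b) c]/(u b c - v b c) mulrBr.
  by rewrite sumrB -xv subrr.
have {hF} := hF t (fun a => u a - v a) (fun a => vecB (fu a) (fv a)) uv0 uvD.
clear -yE rmul_comb; case: i u v y yE => [|i] u v y yE; first by move=> h a; rewrite yE h rmul0.
move=> [s [fs os es]]; exists (fun a => rmul (n q.+1) (s a) (D q)); split.
- by move=> a; exists (s a).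
- by move=> a na; rewrite os // rmul0.
move=> a c; rewrite yE -(congr1 (fun f => f c) (rmul_comb q (nQ i) (DQ i a) s)).
by congr (rmul _ _ _ _); apply/funext => e; rewrite -es.
Qed.

Hypothesis Q_pos : forall a, fr_ideal Q a <-> positive gR a.
Hypothesis tor_bounded : forall q, exists N : int, forall t z, N < t ->
  frow q.+1 t z -> rmul (n q.+1) z (D q) = 0 -> brow q.+1 t z.

(** Descending induction on the degree, started by the bound on Tor. If R_+ z consists of
    boundaries, then, as Ext^1(k, B_{q+1}) = 0, the cycle z differs from a boundary by an element
    killed by R_+; this is zero because the free module has positive depth. *)
Let exact_of_depth q : (q < d)%N -> depth_ge 1 (brow q.+1) -> exact_at q.
Proof.
move=> qd hB; have [N hN] := tor_bounded q.
have d0 : (0 < d)%N by lia.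
suff gen (s : nat) t z : N - s%:Z < t -> frow q.+1 t z -> rmul (n q.+1) z (D q) = 0 ->
    brow q.+1 t z.
  by move=> t z; apply: (gen `|N - t|%N.+1); lia.
elim: s t z => [|s IH] t z st fz zD; first by apply: hN => //; lia.
(* The products of z with the generators of R_+, boundaries by induction, form a cocycle for
   Ext^1(k, B_{q+1}). *)
pose x a c := DQ 0 a 0 * z c.
have xB a : brow q.+1 (t + wQ 1%N a) (x a).
  have [wa|wa] := ltrP 0 (wQ 1%N a).
    apply: IH; first lia.
      have [hz oz] := fz; split=> [c|c nc]; last by rewrite /x oz ?mulr0.
      by apply: ofdegM_eq (fr_deg Q 0 a 0) (hz c) _; rewrite fr_w0; ring.
    apply/funext => c; rewrite /rmul /x; under eq_bigr do rewrite -mulrA.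
    rewrite -mulr_sumr; have := congr1 (fun f => f c) zD; rewrite /rmul => ->.
    exact: mulr0.
  suff -> : x a = 0 by apply: brow0.
  apply/funext => c; rewrite /x.
  have [na|an] := leqP (nQ 1%N) a; first by rewrite fr_out ?na ?mul0r.
  have /Q_pos pa : fr_ideal Q (DQ 0 a 0) by exists (fun j => (j == a)%:R); rewrite rmul_row.
  have := fr_deg Q 0 a 0; rewrite fr_w0 subr0 /ofdeg => <-.
  by rewrite (aug_eq0_gcomp pa wa) mul0r.
have [|a c|v [vB ov xv]] := hB t x xB.
- by move=> a na; apply/funext => c; rewrite /x fr_out ?na ?mul0r.
- rewrite /x; under eq_bigr do rewrite mulrA.
  rewrite -mulr_suml; have := congr1 (fun f => f 0%N) (fr_dd Q 0 a).
  by rewrite /rmul => ->; rewrite mul0r.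
have fv0 : frow q.+1 t (v 0%N).
  by have [s' fs ->] := vB 0%N; have := frow_rmul fs; rewrite fr_w0 addr0.
have h0 := @depth_frow q.+1 0 d0 t (fun a => if a == 0%N then z - v 0%N else 0).
have /(_ 0%N)/subr0_eq -> : forall a, (if a == 0%N then z - v 0%N else 0) = 0.
  apply: h0.
  - case=> [|a] /=; last exact: vec0.
    by have := vecB fz fv0; rewrite fr_w0 addr0.
  - by case=> //; rewrite fr_n0.
  - move=> a c; rewrite fr_n0 big_ord1 /= -[(z - v 0%N) c]/(z c - v 0%N c) mulrBr.
    have := xv a c; rewrite fr_n0 big_ord1 /= => <-; exact: subrr.
by have := vB 0%N; rewrite fr_w0 addr0.
Qed.

Hypothesis F_short : forall i, (d < i)%N -> n i = 0%N.

(** Descending induction from q = d, where there are no boundaries other than zero; along with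
    exactness it carries Ext^i(k, B_q) = 0 for i <= q. *)
Lemma base_exact q : exact_at q.
Proof.
have nil_row m t z : n m = 0%N -> frow m t z -> z = 0.
  by move=> nm [_ oz]; apply/funext => a; rewrite oz // nm.
have triv q' i : (d <= q')%N -> depth_ge i (brow q').
  move=> dq t y hy _ _.
  have y0 a : y a = 0.
    have [u fu ->] := hy a; rewrite (nil_row q'.+1 _ u _ fu) ?rmul0 //.
    by apply: F_short; lia.
  case: i hy => [|i] hy //; exists (fun=> 0); split=> // a c.
  by rewrite y0 big1 // => b _; rewrite mulr0.
have exb q' : (d <= q')%N -> exact_at q'.
  move=> dq t z fz _; rewrite (nil_row q'.+1 _ z _ fz) //.
  by apply: F_short; lia.
suff gen m : forall q', (d <= q' + m)%N ->
    (forall i, (i <= q')%N -> depth_ge i (brow q')) /\ exact_at q'.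
  by have [] := gen d q (leq_addl _ _).
elim: m => [|m IH] q' dq; first by split=> [i _|]; [apply: triv|apply: exb]; lia.
have [dq'|qd] := leqP d q'; first by split=> [i _|]; [apply: triv|apply: exb].
have [hB _] := IH q'.+1 (ltac:(lia)).
have exq : exact_at q' by apply: exact_of_depth => //; apply: hB.
by split=> // i iq; apply: depth_brow => //; [lia|apply: hB].
Qed.

Definition base_resolution : free_res gR :=
  FreeRes (fr_n0 F) (fr_w0 F) D_out D_deg DD base_exact.

End Acyclicity.

(** * Local cohomology and the homological determinant *)

Section TorsionElements.
Context (k : fieldType) (A : algType k) (gA : connected_grading A) (M : gmod gA).

Lemma killed_torsion (N : nat) (x : M) : killed (deg_ge gA N%:Z) x -> torsion x.
Proof.
move=> kx; exists N => s sN sp; apply: kx; rewrite -sN; apply: deg_ge_prod => a /sp.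
by move/pos_idealP.
Qed.

(** If A_+ is generated in degrees at most b, an element of degree at least (l + 1)(b + 1) is a
    combination of generators with coefficients of degree at least l (b + 1). Hence the degrees from
    l (b + 1) on lie in the l-th power of A_+. *)
Lemma torsion_killed (x : M) : left_noetherian A -> torsion x ->
  exists N : nat, killed (deg_ge gA N%:Z) x.
Proof.
move=> noeA; have [m [e [G [Gpos Gdeg Gspan]]]] :=
  ideal_generators noeA (graded_ideal_positive gA).
have [b hb] : exists b : nat, forall j, (j < m)%N -> e j <= b%:Z.
  elim: m {Gpos Gspan} => [|m [b IH]]; first by exists 0%N.
  exists (b + `|e m|)%N => j; rewrite ltnS leq_eqVlt => /orP[/eqP ->|/IH]; lia.
move=> [l hl]; exists (l * b.+1)%N; elim: l x hl => [|l IH] x hl.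
  by have := hl [::] erefl; rewrite big_nil scale1r => -> // a _; rewrite scaler0.
move=> a ha; have [T _ ->] := gcomp_sum gA a.
rewrite scaler_suml big1 // => i _; set a' := gcomp gA i a.
have [il|li] := ltrP i (l.+1 * b.+1)%N%:Z; first by rewrite /a' ha ?scale0r.
have [|c ec] := Gspan a'.
  by apply: (aug_ofdeg (ofdeg_gcomp gA i a)); lia.
have -> : a' = \sum_(j < m) gcomp gA (i - e j) (c j) * G j.
  transitivity (gcomp gA i a'); first by rewrite gcomp_gcomp eqxx.
  rewrite ec gcomp_bigsum; apply: eq_bigr => j _.
  exact: gcompMr.
rewrite scaler_suml big1 // => j _; rewrite -scalerA; apply: (IH (G j *: x)).
  move=> s sl sp; rewrite scalerA.
  have := hl (rcons s (G j)); rewrite size_rcons sl => /(_ erefl).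
  rewrite -cats1 big_cat big_seq1; apply=> d; rewrite mem_cat mem_seq1.
  by case/orP=> [/sp //|/eqP ->]; apply/pos_idealP; apply: Gpos.
apply: ofdeg_deg_ge (ofdeg_gcomp gA _ _) _.
by have := hb j (ltn_ord j); lia.
Qed.

End TorsionElements.

Lemma graded_ideal_fr (k : fieldType) (A : algType k) (gA : connected_grading A)
  (F : free_res gA) : graded_ideal gA (fr_ideal F).
Proof.
split.
- by exists 0; rewrite rmul0.
- by move=> x y [u ->] [v ->]; exists (u + v); rewrite rmulD.
- by move=> a x [u ->]; exists (fun i => a * u i); rewrite rmulZ.
- move=> i x [u ->]; exists (fun a => gcomp gA (i - fr_w F 1 a) (u a)).
  by rewrite -gcomp_rmul fr_w0 subr0.
Qed.

(** For a left ideal I of A, the left ideal of B generated by v(I) is generated by finitely many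
    [v a] with a in I; applying [p] to expressions through them shows that these a generate I. *)
Lemma retract_noetherian (B A : pzRingType) (v : A -> B) (p : B -> A) :
  (forall x y, p (x + y) = p x + p y) -> (forall a, p (v a) = a) ->
  (forall x a, p (x * v a) = p x * a) -> left_noetherian B -> left_noetherian A.
Proof.
move=> pD pv pM noeB I I0 ID IM.
have p0 : p 0 = 0 by apply: (addrI (p 0)); rewrite -pD !addr0.
pose span := fix span (l : seq A) (x : B) : Prop :=
  if l is a :: l' then exists c y, x = c * v a + y /\ span l' y else x = 0.
have span0 l : span l 0 by elim: l => //= a l IH; exists 0, 0; rewrite mul0r addr0.
have spanD l x y : span l x -> span l y -> span l (x + y).
  elim: l x y => [|a l IH] x y /=; first by move=> -> ->; rewrite addr0.
  move=> [c [x' [-> hx]]] [d [y' [-> hy]]]; exists (c + d), (x' + y').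
  by rewrite mulrDl addrACA; split=> //; apply: IH.
have spanM l c x : span l x -> span l (c * x).
  elim: l x => [|a l IH] x /=; first by move=> ->; rewrite mulr0.
  move=> [d [y [-> hy]]]; exists (c * d), (c * y).
  by rewrite mulrDr mulrA; split=> //; apply: IH.
have span_catl l l' x : span l x -> span (l ++ l') x.
  elim: l x => [|a l IH] x /=; first by move=> ->; apply: span0.
  by move=> [c [y [-> hy]]]; exists c, y; split=> //; apply: IH.
have span_catr l l' x : span l' x -> span (l ++ l') x.
  by elim: l => //= a l IH hx; exists 0, x; rewrite mul0r add0r; split=> //; apply: IH.
pose good l := forall i, (i < size l)%N -> I (nth 0 l i).
have good_cat l l' : good l -> good l' -> good (l ++ l').
  move=> hl hl' i; rewrite size_cat nth_cat.
  case: (ltnP i (size l)) => [il _|li il']; first exact: hl.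
  by apply: hl'; lia.
have [|x y [l [gl hx]] [l' [gl' hy]]|c x [l [gl hx]]|s hs] :=
    noeB (fun x => exists l, good l /\ span l x).
- by exists [::].
- exists (l ++ l'); split; first exact: good_cat.
  by apply: spanD; [apply: span_catl|apply: span_catr].
- by exists l; split=> //; apply: spanM.
have [l [gl hl]] : exists l, good l /\ forall i, (i < size s)%N -> span l s`_i.
  have /choice[l0 hl0] : forall i, exists l, (i < size s)%N -> good l /\ span l s`_i.
    move=> i; have [si|] := ltnP i (size s); last by exists [::].
    have [|l hl] := (hs s`_i).2; last by exists l.
    exists (fun j => (j == i)%:R); rewrite (bigD1 (Ordinal si)) //= eqxx mul1r.
    rewrite big1 ?addr0 // => j /negbTE ji.
    by rewrite -[nat_of_ord j == i]/(j == Ordinal si) ji mul0r.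
  suff gen m : (m <= size s)%N -> exists l, good l /\ forall i, (i < m)%N -> span l s`_i.
    exact: gen.
  elim: m => [_|m IH ms]; first by exists [::].
  have [|l [gl hl]] := IH; first by lia.
  have [gm hm] := hl0 m ms; exists (l ++ l0 m); split; first exact: good_cat.
  move=> i; rewrite ltnS leq_eqVlt => /orP[/eqP ->|im]; first exact: span_catr.
  by apply: span_catl; apply: hl.
exists l => a; split=> [Ia|[c ->]]; last first.
  elim/big_ind: _ => // i _; apply: IM; exact: gl.
have : span l (v a).
  have [|c ->] := (hs (v a)).1.
    by exists [:: a]; split=> [[]|] //=; exists 1, 0; rewrite mul1r addr0.
  by elim/big_ind: _ => // [x y|i _]; [apply: spanD|apply: spanM; apply: hl].
rewrite -[in X in _ -> X](pv a); move: (v a); elim: l {gl hl} => [|b l IH] x /=.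
  by move=> ->; exists (fun=> 0); rewrite big_ord0.
move=> [c [y [-> /IH[d hd]]]]; exists (fun i => if i is i'.+1 then d i' else p c).
by rewrite big_ord_recl /= pD pM hd.
Qed.

Section InvariantRing.
Context (k : fieldType) (H : falgType k) (D : hopf_algebra H).
Context (R : algType k) (gR : connected_grading R) (X : module_algebra D gR).
Local Notation A := (inv_alg X).
Local Notation gA := (inv_grading X).

Definition inv_incl : {rmorphism A -> R} := (\val : A -> R).

Lemma inv_incl_deg i (a : A) : ofdeg gA i a -> ofdeg gR i (inv_incl a).
Proof. by move=> /(congr1 val). Qed.

Context (t : H) (eps_t : (counit D t : k) = 1).
Hypothesis t_int : forall h, h * t = (counit D h : k) *: t.

(** The projection R -> A given by the integral; being linear over A on both sides, it transfers
    both chain conditions. *)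
Let tr (r : R) : A := InvAlg (act_integral_inv X t_int r).

Let trD x y : tr (x + y) = tr x + tr y.
Proof. by apply: val_inj; apply: (raddfD (act X t)). Qed.

Let trK (a : A) : tr (val a) = a.
Proof. by apply: val_inj; apply: act_integral_id => //; apply: valP. Qed.

Lemma inv_left_noetherian : left_noetherian R -> left_noetherian A.
Proof.
apply: (retract_noetherian trD trK) => x a; apply: val_inj.
by rewrite /= act_invr //; apply: valP.
Qed.

Lemma inv_right_noetherian : right_noetherian R -> right_noetherian A.
Proof.
apply: (@retract_noetherian (R^c : pzRingType) (A^c : pzRingType) val tr trD trK).
by move=> x a; apply: val_inj; apply: act_invl; apply: valP.
Qed.

Lemma inv_finite : right_noetherian R -> exists m (s : nat -> R), forall r,
  exists a : nat -> A, r = \sum_(j < m) s j * inv_incl (a j).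
Proof.
move=> /(invariants_finite X eps_t t_int)[m [s hs]]; exists m, s => r.
by have [a aI ->] := hs r; exists (fun j => InvAlg (aI j)).
Qed.

End InvariantRing.

Section LocalCohomology.
Context (k : fieldType) (A : algType k) (gA : connected_grading A).
Hypothesis noeA : left_noetherian A.
Context (N : gmod gA) (E : injective_resolution N).

Lemma cobound_lc (n : nat) i t (x : E i) : cobound (deg_ge gA n%:Z) t x -> lc_coboundary x.
Proof.
case: i x => [|i] x //= [y [_ ky ->]].
by exists y => //; apply: killed_torsion ky.
Qed.

Lemma killed_gcomp (M : gmod gA) J t (x : M) : graded_ideal gA J -> killed J x ->
  killed J (gcomp (mgr M) t x).
Proof.
move=> hJ kx a Ja; have [T _ ea] := gcomp_sum gA a.
rewrite [in LHS]ea scaler_suml big1 // => j _.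
rewrite -[t](addrK j) -(gcompZl _ _ (ofdeg_gcomp gA j a)) kx ?gcomp0 //.
exact: (gsub_comp hJ).
Qed.

(** Part of the description of H^i_m(N) as the direct limit of the Ext^i(A / A_{>=n}, N): a torsion
    element is killed by some A_{>=n}. *)
Lemma lc_cobound i t (x : E i) : ofdeg (mgr (E i)) t x -> lc_coboundary x ->
  exists n : nat, cobound (deg_ge gA n%:Z) t x.
Proof.
case: i x => [|i] x hx /=; first by exists 0%N.
move=> [y ty xy]; have [n kn] := torsion_killed noeA ty; exists n.
exists (gcomp (mgr (E i)) t y); split; first exact: ofdeg_gcomp.
  by apply: killed_gcomp kn; apply: graded_ideal_deg_ge.
by rewrite ir_d_gcomp -xy hx.
Qed.

Lemma torsionD (M : gmod gA) (x y : M) : torsion x -> torsion y -> torsion (x + y).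
Proof.
move=> /(torsion_killed noeA)[n kx] /(torsion_killed noeA)[m ky].
apply: (@killed_torsion _ _ _ _ (n + m)) => a ha; rewrite scalerDr kx ?ky ?addr0 //.
  by move=> i im; apply: ha; lia.
by move=> i im; apply: ha; lia.
Qed.

Lemma torsionZ (M : gmod gA) (c : k) (x : M) : torsion x -> torsion (c%:A *: x).
Proof.
move=> [n hn]; exists n => s sn sp.
rewrite scalerA -scalerAr mulr1 -mulr_algl -scalerA hn //; exact: scaler0.
Qed.

Lemma lc_coboundary_lin i (c : k) (x y : E i) :
  lc_coboundary x -> lc_coboundary y -> lc_coboundary (c%:A *: x + y).
Proof.
case: i x y => [|i] x y /=; first by move=> -> ->; rewrite scaler0 addr0.
move=> [x' tx ->] [y' ty ->]; exists (c%:A *: x' + y'); last by rewrite linearP.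
by apply: torsionD => //; apply: torsionZ.
Qed.

Lemma lc_dual_nonzero i n (x : E i) : lc_cocycle (- n) x -> ~ lc_coboundary x ->
  exists f : E i -> k, lc_dual n f /\ f x <> 0.
Proof.
move=> cx ncx.
have [||f [flin f0 f1]] :=
  @separating_form k A (E i) (@lc_coboundary _ _ _ _ E i) x _ _ ncx.
- case: i {x cx ncx} => [|i] //=; exists 0; last by rewrite linear0.
  by exists 0%N => s _ _; rewrite scaler0.
- by move=> c u v; apply: lc_coboundary_lin.
exists f; split; last by rewrite f1; apply/eqP/oner_neq0.
by split=> [c u v _ _|u _]; [apply: flin|apply: f0].
Qed.

End LocalCohomology.

Section HdetIndex.
Context (k : fieldType) (H : falgType k) (D : hopf_algebra H).
Context (R : algType k) (gR : connected_grading R) (X : module_algebra D gR).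
Local Notation A := (inv_alg X).
Local Notation gA := (inv_grading X).
Local Notation N := (inv_gmod X).
Context (t : H).
Hypothesis t_int : forall h, h * t = (counit D h : k) *: t.
Hypothesis noeA : left_noetherian A.
Context (E : injective_resolution N) (EA : injective_resolution (regular_gmod gA)).

(* The class of x comes from Ext^d(A / A_{>= m}, R) for some m; in terms of a
   free resolution of A / A_{>= m}, the projection R -> A acts entrywise. *)
Lemma lc_projection_ext d n (phi : forall i, {linear E i -> E i}) (x : E d) :
  extends_to (N := N) (act X t : R -> R) phi -> lc_cocycle n x ->
  ~ lc_coboundary (phi d x) ->
  exists s : nat, ~ ext_cyc_zero EA (@positive _ _ gA) d (n + s%:Z).
Proof.
(* If Ext^d(k, A) vanished in all degrees n + s, devissage would kill Ext^d(A / A_{>=m}, A) in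
   degree n. *)
move=> ext_phi [tx dx hx] nphi; apply: contrapT => /forallNP hE.
have {}hE (s : nat) : ext_cyc_zero EA (@positive _ _ gA) d (n + s%:Z).
  exact: contrapT (hE s).
have [m kx] := torsion_killed noeA tx.
pose J := deg_ge gA m%:Z; have hJ : graded_ideal gA J := graded_ideal_deg_ge gA m%:Z.
have [F [FJ _]] := minimal_resolution noeA hJ.
have [y [z hy Dy]] := ext_zigzag_right hx dx ((killed_iff x FJ).2 kx).
have lp : linear (act X t : N -> N).
  move=> a u v; rewrite raddfD /=; congr (_ + _).
  by apply: act_invl; apply: inv_valP.
pose pL := GRing.isLinear.Build A N N _ (act X t : N -> N) lp.
pose p : {linear N -> N} := HB.pack (act X t : N -> N) pL.
have p_deg : homogeneous 0 p by move=> i u; rewrite addr0 /= act_deg.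
have zp := @ext_zigzag_map _ _ _ N E F n p phi d x y ext_phi p_deg z.
(* The projected column has entries in A, so it is a cocycle of Hom(F, A), and bounding there
   implies bounding in Hom(F, R). *)
pose y' a : regular_gmod gA := InvAlg (act_integral_inv X t_int (y a)).
have ey a : inv_val (y' a : A) = p (y a) by [].
have vD (u : nat -> regular_gmod gA) i a :
    inv_val (cmul (fr_n F i) (fr_d F i) u a : A) =
    cmul (fr_n F i) (fr_d F i) (fun b => inv_val (u b : A) : N) a.
  exact: (big_morph (@inv_val k H D R gR X) (@inv_valD k H D R gR X) (@inv_val0 k H D R gR X)).
have hy' : is_col F n d y'.
  have [h o] := hy; split=> [a|a na]; apply: val_inj; last by rewrite /= o // linear0.
  by rewrite /= -act_deg; congr (act X t _); apply: h.
have Dy' : cmul (fr_n F d) (fr_d F d) y' = 0.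
  apply/funext => a; apply: val_inj; rewrite /= vD.
  have := congr1 (fun f => p (f a)) Dy; rewrite /= linear0 => <-.
  by rewrite -[RHS]/(p _) linear_sum; apply: eq_bigr => b _; rewrite linearZ.
have /ext_cyc_col_zero/(_ y' hy' Dy') cy' : ext_cyc_zero EA (fr_ideal F) d n.
  apply/(ext_cyc_zero_iff EA d n FJ).
  exact: (@ext_cyc_zero_bounded _ _ _ noeA _ EA J m d n hJ (fun _ h => h) hE).
apply: nphi.
suff /(ext_zigzag_cobound zp).2 /(cobound_iff _ _ FJ).1 :
    col_cobound F n d (fun a => p (y a)).
  exact: cobound_lc.
move: y' ey {hy' Dy'} cy' => y' ey; clear -y y' ey vD; case: d => [|d].
  by move=> cy'; apply/funext => a; rewrite -ey cy'.
case=> v [hv ov] e; exists (fun a => inv_val (v a : A)).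
  by split=> [a|a na]; [exact: (congr1 val (hv a))|rewrite ov].
by apply/funext => a; rewrite -ey e vD.
Qed.

End HdetIndex.

(** * Consequences for R of a short resolution of k over A *)

Section RestrictionToInvariants.
Context (k : fieldType) (H : falgType k) (D : hopf_algebra H).
Context (R : algType k) (gR : connected_grading R) (X : module_algebra D gR).
Local Notation A := (inv_alg X).
Local Notation gA := (inv_grading X).
Local Notation N := (inv_gmod X).
Local Notation posA := (@positive _ _ gA).
Local Notation posR := (@positive _ _ gR).
Hypothesis noeR : left_noetherian R.
Hypothesis noeA : left_noetherian A.
Hypothesis noeA_r : right_noetherian A.
Hypothesis R_fin : exists m (s : nat -> R), forall r,
  exists a : nat -> A, r = \sum_(j < m) s j * inv_incl X (a j).
Context (ER : injective_resolution (regular_gmod gR)) (d : nat) (l : int).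
Hypothesis ER_zero : forall i t, (i, t) != (d, - l) -> ext_cyc_zero ER posR i t.
Hypothesis ER_nonzero : ~ ext_cyc_zero ER posR d (- l).
Context (F : free_res gA).
Hypothesis F_triv : forall a, fr_ideal F a <-> posA a.
Hypothesis F_short : forall i, (d < i)%N -> fr_n F i = 0%N.
Context (E : injective_resolution N).

(** R (x) F as a resolution of W over R. As W = H_0(R (x) F), the bound [b] is the Tor bound for q =
    0. *)
Let bounded_resolution : exists G : free_res gR, [/\ fr_n G = fr_n F, fr_w G = fr_w F,
  fr_d G = base_d F (inv_incl X) &
  exists b : nat, forall a, deg_ge gR b%:Z a -> fr_ideal G a].
Proof.
have [Q [Qpos _]] := minimal_resolution noeR (graded_ideal_positive gR).
have depth i t : (i < d)%N -> @col_zero _ _ _ Q t (regular_gmod gR) i.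
  move=> id; apply/(ext_cyc_col_zero ER)/(ext_cyc_zero_iff ER i t Qpos).
  by apply: ER_zero; apply/eqP => -[]; lia.
have tor q := base_tor_bounded F_triv noeA_r (@inv_incl_deg _ _ _ _ _ X) R_fin q.+1.
pose G := base_resolution (@inv_incl_deg _ _ _ _ _ X) depth Qpos tor F_short.
exists G; split=> //.
have [b hb] := base_tor_bounded F_triv noeA_r (@inv_incl_deg _ _ _ _ _ X) R_fin 0.
exists `|b|%N.+1 => a ha; have [T _ ->] := gcomp_sum gR a.
apply: (gsub_sum (graded_ideal_fr G)) => i _.
have [ib|bi] := ltrP i (`|b|%N.+1)%:Z.
  by rewrite ha //; apply: (gsub0 (graded_ideal_fr G)).
have [|||u _ /(congr1 (fun f => f 0%N)) e] :=
  hb i (fun j => if j == 0%N then gcomp gR i a else 0).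
- by lia.
- split=> [[|j]|[|j]] //=; rewrite ?fr_w0 ?subr0 ?fr_n0 //; first exact: ofdeg_gcomp.
  exact: ofdeg0.
- by [].
by exists u.
Qed.

(** Hom_R(R (x) F, R) and Hom_A(F, R) consist of the same columns with the same differentials. *)
Let col_zero_base (G : free_res gR) : fr_n G = fr_n F -> fr_w G = fr_w F ->
  fr_d G = base_d F (inv_incl X) ->
  forall i t, @col_zero _ _ _ G t (regular_gmod gR) i <-> @col_zero _ _ _ F t N i.
Proof.
move=> nG wG dG i t; rewrite /col_zero /is_col nG wG dG.
case: i => [|i]; first exact: iff_refl.
by rewrite /= /is_col nG wG dG; exact: iff_refl.
Qed.

Let positive_fr (G : free_res gR) : fr_n G = fr_n F -> fr_d G = base_d F (inv_incl X) ->
  forall a, fr_ideal G a -> posR a.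
Proof.
move=> nG dG a [u ->]; rewrite nG dG /positive aug_bigsum big1 // => j _.
have /F_triv pj : fr_ideal F (fr_d F 0 j 0).
  by exists (fun i : nat => (i == j)%:R); rewrite rmul_row.
by rewrite augM -[X in _ * X]/(aug gA (fr_d F 0 j 0)) pj mulr0.
Qed.

(** Ext_A^i(k, R) is Ext_R^i(W, R), and W is bounded in degree, so devissage reduces the claim to
    Ext_R^i(k, R) = 0. *)
Lemma inv_depth i t : (i < d)%N -> ext_cyc_zero E posA i t.
Proof.
move=> id; have [G [nG wG dG [b hb]]] := bounded_resolution.
apply/(ext_cyc_zero_iff E i t F_triv)/ext_cyc_col_zero/(col_zero_base nG wG dG).
apply/(ext_cyc_col_zero ER).
apply: (@ext_cyc_zero_bounded _ _ _ noeR _ ER _ b i t (graded_ideal_fr G) hb) => s.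
by apply: ER_zero; apply/eqP => -[]; lia.
Qed.

(** Ext_R^d(k, R) embeds into Ext_R^d(W, R) along W -> k, since Ext_R^(d-1) of the kernel
    vanishes. *)
Lemma inv_ext_top : ~ ext_cyc_zero E posA d (- l).
Proof.
have [G [nG wG dG [b hb]]] := bounded_resolution => h; apply: ER_nonzero => x hx dx kx.
have hG : ext_cyc_zero ER (fr_ideal G) d (- l).
  apply/ext_cyc_col_zero/(col_zero_base nG wG dG)/(ext_cyc_col_zero E).
  exact/(ext_cyc_zero_iff E d (- l) F_triv).
have Gpos := positive_fr nG dG.
apply: (@cobound_enlarge _ _ _ noeR _ ER posR (fr_ideal G) b) => //.
- exact: graded_ideal_positive.
- exact: graded_ideal_fr.
- by move=> j s jd; apply: ER_zero; apply/eqP => -[]; lia.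
- by apply: hG => // a /Gpos; apply: kx.
Qed.

(** Ext_A^d(k, R) -> H^d_m(R) is injective: a cocycle killed by A_+ that is the image of a torsion
    element is a coboundary for some A / A_{>=b}, hence for k by the vanishing below d. *)
Lemma lc_top_nonzero : exists x : E d, lc_cocycle (- l) x /\ ~ lc_coboundary x.
Proof.
apply: contrapT => /forallNP h; apply: inv_ext_top => x hx dx kx.
have /(lc_cobound noeA hx)[b cx] : lc_coboundary x.
  apply: contrapT => ncx; apply: (h x); split=> //; split=> //.
  by apply: (@killed_torsion _ _ _ _ 1) => a /deg_ge_positive; apply: kx.
(* With [b.+1] in place of [b], the smaller ideal lies in A_+ even when b = 0. *)
apply: (@cobound_enlarge _ _ _ noeA _ E posA (deg_ge gA b.+1%:Z) b.+1) => //.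
- exact: graded_ideal_positive.
- exact: graded_ideal_deg_ge.
- by move=> a ha; apply/deg_ge_positive => i i1; apply: ha; lia.
- by move=> j s jd; apply: inv_depth.
- by apply: cobound_sub cx => a ha i ib; apply: ha; lia.
Qed.

Context (lA : int).
Hypothesis F_top : forall a, (a < fr_n F d)%N -> fr_w F d a = lA.
Hypothesis lA_le : lA <= l.

(** Let J = R A_+ and suppose that b, of degree p > 0, is outside J although R_+ b lies in J. Then
    (J + k b) / J is k in degree p, and Ext^d(R / J, R) maps onto its Ext^d because Ext^(d+1)
    vanishes. In degree - l - p the source is zero, since Hom(F_d, R) starts in degree - lA >= - l;
    so Ext^d(k, R) would vanish in degree - l. *)
Let generated_by_invariants (G : free_res gR) : fr_n G = fr_n F -> fr_w G = fr_w F ->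
  fr_d G = base_d F (inv_incl X) ->
  (exists b : nat, forall a, deg_ge gR b%:Z a -> fr_ideal G a) ->
  forall p b, 0 < p -> ofdeg gR p b -> fr_ideal G b.
Proof.
move=> nG wG dG [B hB]; set J := fr_ideal G.
have hJ : graded_ideal gR J := graded_ideal_fr G.
suff gen (m : nat) p b : B%:Z - m%:Z < p -> 0 < p -> ofdeg gR p b -> J b.
  by move=> p b p0; apply: (gen B.+1) => //; lia.
elim: m p b => [|m IH] p b mp p0 hb.
  by apply: hB; apply: ofdeg_deg_ge hb _; lia.
apply: contrapT => nJb.
have kb a : posR a -> J (a * b).
  move=> pa; have [T _ ea] := gcomp_sum gR a; rewrite ea mulr_suml.
  apply: (gsub_sum hJ) => i _; have [i0|i0] := ltrP 0 i.
    by apply: (IH (i + p)); [lia|lia|apply: ofdegM => //; apply: ofdeg_gcomp].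
  by rewrite (aug_eq0_gcomp pa i0) mul0r; apply: (gsub0 hJ).
have hI := graded_ideal_adjoin hJ hb kb.
have JI a : J a -> adjoin_elt J b a by exists 0; rewrite scale0r subr0.
(* An arbitrary cocycle for Ext^d(k, R) in degree - l, to be shown a coboundary. *)
apply: ER_nonzero => x0 hx0 dx0 kx0.
have [||z [hz kz bz]] := @injective_adjoin _ _ _ (ER d) J b p (- l - p) x0
  (@ir_injective _ _ _ _ ER d) hJ hb kb nJb.
- by rewrite subrK.
- exact: kx0.
have kdz : killed (adjoin_elt J b) (ir_d ER d z).
  move=> a [c hc]; have az : a *: z = c%:A *: x0.
    by rewrite -[a](subrK (c *: b)) scalerDl kz // add0r -[c *: b]mulr_algl -scalerA bz.
  have : ir_d ER d (a *: z) = 0 by rewrite az linearZ /= dx0 scaler0.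
  by rewrite linearZ.
(* Vanishing of Ext^(d+1): subtracting a suitable [y] killed by J + k b makes [z] a cocycle and
   leaves its product with b unchanged. *)
have [||y [hy ky dzy]] := @ext_cyc_zero_bounded _ _ _ noeR _ ER (adjoin_elt J b) B d.+1
    (- l - p) hI _ _ (ir_d ER d z) (ir_d_deg0 hz) (ir_dd _) kdz.
- by move=> a /hB/JI.
- by move=> s; apply: ER_zero; apply/eqP => -[]; lia.
(* The entries of such a column have degree - l - p + lA, which is negative. *)
have : col_zero G (- l - p) (regular_gmod gR) d.
  move=> u [hu ou] _; suff -> : u = 0.
    case: (d) => [|i] //=; exists 0; first exact: vec0.
    by rewrite cmul0.
  apply/funext => a; have [an|na] := ltnP a (fr_n G d); last exact: ou.
  apply: (ofdeg_lt0 (hu a)); rewrite wG F_top -?nG //; lia.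
move=> /(ext_cyc_col_zero ER) hzero.
have cz : cobound J (- l - p) (z - y).
  apply: hzero; first exact: ofdegB.
    by rewrite linearB -dzy subrr.
  by apply: killedB => // a /JI; apply: ky.
have x0E : x0 = b *: (z - y).
  rewrite scalerBr bz (_ : b *: y = 0) ?subr0 //; apply: ky.
  by exists 1; rewrite scale1r subrr; apply: (gsub0 hJ).
rewrite x0E; move: cz; clear -hb kb; case: d (z - y) => [|i] u /=.
  by move=> ->; rewrite scaler0.
move=> [u' [hu' ku' ->]]; exists (b *: u'); split; last by rewrite linearZ.
  by apply: ofdegZ_eq hb hu' _; ring.
by move=> a pa; rewrite scalerA; apply/ku'/kb.
Qed.

(** A homogeneous element of positive degree lies in R A_+; in an expression sum_j u_j a_j the u_j
    have smaller degree, hence are invariant by induction. *)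
Lemma all_invariant r : r \in invariants X.
Proof.
have [G [nG wG dG hB]] := bounded_resolution.
have gen := generated_by_invariants nG wG dG hB.
suff hom (m : nat) p a : p < m%:Z -> ofdeg gR p a -> a \in invariants X.
  have [T _ ->] := gcomp_sum gR r; apply: rpred_sum => i _.
  by apply: (hom `|i|%N.+1 i _ _ (ofdeg_gcomp gR i r)); lia.
elim: m p a => [|m IH] p a pm ha.
  by rewrite (ofdeg_lt0 ha) ?rpred0.
have [p0|p0] := ltrP 0 p; last first.
  have [pn|pn] := ltrP p 0; first by rewrite (ofdeg_lt0 ha) ?rpred0.
  have p00 : p = 0 by lia.
  by rewrite p00 in ha; rewrite (ofdeg0_aug ha); apply: rpredZ; apply: rpred1.
have [u] := gen p a p0 ha; rewrite nG dG => ea.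
rewrite -ha ea gcomp_bigsum; apply: rpred_sum => j _.
have dj := inv_incl_deg (fr_deg F 0 j 0).
rewrite fr_w0 subr0 in dj.
rewrite /base_d (gcompMr _ _ dj).
have [w0|w0] := ltrP 0 (fr_w F 1 j).
  apply: rpredM; last exact: inv_valP.
  by apply: (IH _ _ _ (ofdeg_gcomp gR _ _)); lia.
have /F_triv pj : fr_ideal F (fr_d F 0 j 0).
  by exists (fun i : nat => (i == j)%:R); rewrite rmul_row.
have d0 : inv_incl X (fr_d F 0 j 0) = 0.
  by have := aug_eq0_gcomp (gA := gR) pj w0; rewrite dj.
by rewrite d0 mulr0 rpred0.
Qed.

End RestrictionToInvariants.

Theorem theorem0p6 (k : closedFieldType) (hk : (GRing.pchar k) =i pred0)
  (H : falgType k) (D : hopf_algebra H) (ssH : semisimple H)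
  (R : algType k) (gR : connected_grading R) (nR : noetherian R)
  (d : nat) (l : int) (regR : AS_regular_of gR d l)
  (X : module_algebra D gR) :
  ~ (forall r : R, r \in invariants X) ->
  hdet_trivial X d ->
  ~ AS_regular (inv_grading X).
Proof.
move=> ninv [E [phi [n [e [eta [hext hlow [le ne _] hact hchi]]]]]] [dA [lA regA]].
apply: ninv; have [noeR noeR_r] := nR.
have [[_ [ER [ER1 ER0]]] _ _] := regR.
have [[_ [EA [_ EA0]]] [g /(_ (trivial_gmod _))[P P0]] _] := regA.
have [t eps_t t_int] := integral_exists D ssH.
have noeA := @inv_left_noetherian _ _ _ _ _ X _ eps_t t_int noeR.
have noeA_r := @inv_right_noetherian _ _ _ _ _ X _ eps_t t_int noeR_r.
have R_fin := @inv_finite _ _ _ _ _ X _ eps_t t_int noeR_r.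
have [F [F_triv F_min']] := minimal_resolution noeA (graded_ideal_positive (inv_grading X)).
(* The entries of the first differential lie in A_+ because F resolves k; minimality covers the
   others. *)
have F_min i a b : aug (inv_grading X) (fr_d F i a b) = 0.
  case: i => [|i]; last exact: F_min'.
  case: b => [|b]; last by rewrite fr_out ?fr_n0 ?orbT ?aug0.
  have [na|an] := leqP (fr_n F 1) a; first by rewrite fr_out ?na ?aug0.
  by apply/F_triv; exists (fun i : nat => (i == a)%:R); rewrite rmul_row.
have F_len := minimal_resolution_length F_triv F_min P0.
have F_short := terms_above_zero F_triv F_min EA0 F_len.
have [x cx ex] : exists2 x, lc_cocycle (- n) x & e x <> 0.
  apply: contrapT => h; apply: ne => x cx; apply: contrapT => ex.
  by apply: h; exists x.
(* Triviality of the determinant makes [eta] the counit, whose value at t is 1. *)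
have ephi : e (phi t d x) = e x.
  by rewrite hact // (counit_antipode_unique hchi) eps_t mul1r.
have nphi : ~ lc_coboundary (phi t d x).
  move=> bphi; apply: ex; rewrite -ephi; apply: le.2 => //.
  have [tx dx hx] := cx; have [phi_deg _ phi_d] := hext t; split.
  - have [m hm] := tx; exists m => s sm sp; by rewrite -linearZ hm ?linear0.
  - by rewrite -phi_d dx linear0.
  - by rewrite -[X in gcomp _ X]addr0 -phi_deg hx.
(* As s is a natural number, the equality of degrees obtained next gives lA <= n. *)
have [s hs] := lc_projection_ext t_int noeA EA (hext t) cx nphi.
have [dE lE] : d = dA /\ - n + s%:Z = - lA.
  have [/eqP[]//|h] := boolP ((d, - n + s%:Z) == (dA, - lA)).
  by case: hs; apply/ext_zero_trivialP/EA0.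
have {}F_short i : (d < i)%N -> fr_n F i = 0%N by rewrite dE; apply: F_short.
have F_top a : (a < fr_n F d)%N -> fr_w F d a = lA.
  move=> an; have nd : fr_n F d.+1 = 0%N by apply: F_short.
  by have [_] := top_term_degree F_triv F_min EA0 nd an.
have ER_zero i j : (i, j) != (d, - l) -> ext_cyc_zero ER (@positive _ _ gR) i j.
  by move=> ij; apply/ext_zero_trivialP/ER0.
have ER_nonzero : ~ ext_cyc_zero ER (@positive _ _ gR) d (- l).
  by move/ext_zero_trivialP => h; have [f [/h]] := ER1.
(* If l < n, the dual of H^d_m(R) is zero in degree l, against the nonzero class in degree - l. *)
have nl : n <= l.
  have [//|ln] := lerP n l.
  have [y [cy ncy]] :=
    lc_top_nonzero noeR noeA noeA_r R_fin ER_zero ER_nonzero F_triv F_short E.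
  have [f [hf fy]] := lc_dual_nonzero noeA cy ncy.
  by case: fy; apply: (hlow l f ln hf).
have lA_le : lA <= l by lia.
exact: (all_invariant noeR noeA_r R_fin ER_zero ER_nonzero F_triv F_short F_top lA_le).
Qed.
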